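(* Let $n \geq 2$, let $D \subset \mathbb{C}^n$ be a non-degenerate $\mathbb{C}$-convex domain, and let $z \in D$. Then $$\frac{1}{(16n)^n} \leq v_D(z)\, p_D^2(z) \leq \left(\frac{4^n-1}{3}\right)^n$$ both for $v_D = c_D$ (the Carathéodory-Eisenman volume element) and for $v_D = k_D$ (the Kobayashi-Eisenman volume element).
   Context: A domain is a nonempty connected open set. A domain $D\subset\mathbb{C}^n$ is $\mathbb{C}$-convex if $D\cap l$ is a simply connected domain (in particular connected) for each complex affine line $l$ that meets $D$. A domain $D\subset\mathbb{C}^n$ is non-degenerate if it contains no complex lines (complex affine lines). $\mathbb{B}^n$ is the open unit ball of $\mathbb{C}^n$, $\mathcal{O}(X,Y)$ is the set of holomorphic maps from $X$ to $Y$, and $\det\psi'$ is the complex Jacobian determinant of a holomorphic map $\psi$. The Carathéodory and Kobayashi-Eisenman volume elements of a domain $D\subset \mathbb{C}^n$ at $z^0\in D$ are $$c_D(z^0)=\sup\{|\det\psi'(z^0)|^2:\psi\in\mathcal{O}(D,\mathbb{B}^n),\ \psi(z^0)=0\},$$ $$k_D(z^0)=\inf\{|\det\psi'(0)|^{-2}:\psi\in\mathcal{O}(\mathbb{B}^n,D),\ \psi(0)=z^0\}$$ (with $|\det\psi'(0)|^{-2}=+\infty$ if $\det\psi'(0)=0$). The number $p_D(z^0)$: let $D$ be non-degenerate and $z^0\in D$. Put $H_0=\mathbb{C}^n$. Let $\tau_{1,D}(z^0)$ be the minimum (Euclidean) distance from $z^0$ to $\partial D$ and let $p^1\in\partial D$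 be a point realising it. Let $H_1$ be the complex hyperplane through $z^0$ orthogonal (for the standard Hermitian inner product) to $p^1-z^0$. Inductively, for $j=2,\ldots,n$, let $\tau_{j,D}(z^0)$ be the minimum distance from $z^0$ to $\partial D\cap H_{j-1}$, let $p^j\in\partial D\cap H_{j-1}$ be a point realising it, and (for $j<n$) let $H_j$ be the complex affine subspace of $H_{j-1}$ of codimension one in $H_{j-1}$ that passes through $z^0$ and is orthogonal to $p^j-z^0$. All $\tau_{j,D}(z^0)=\|p^j-z^0\|$ are finite because $D$ is non-degenerate. Then $p_D(z^0):=\tau_{1,D}(z^0)\cdots\tau_{n,D}(z^0)$. The points $p^j$ need not be unique; $p_D(z^0)$ is formed from any such choice, and the claim is for an arbitrary choice. $p_D^2(z)$ means $(p_D(z))^2$. *)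

(* Defs.v *)
From HB Require Import structures.
From mathcomp Require Import all_boot all_order all_algebra.
From mathcomp Require Import all_classical all_reals all_analysis.
From mathcomp Require Import complex.

Set Implicit Arguments.
Unset Strict Implicit.
Unset Printing Implicit Defensive.

Import Order.TTheory GRing.Theory Num.Theory.
Import numFieldNormedType.Exports.
Import ComplexField.Normc.

Local Open Scope classical_set_scope.
Local Open Scope ring_scope.

(* The library puts its usual topology and norm on abstract numFieldTypes only;
   this makes them available on the concrete type R[i]. *)
HB.instance Definition _ (R : rcfType) := NormedModule.copy R[i] R[i]^o.

Definition is_domain (T : topologicalType) (D : set T) : Prop :=
  [/\ D !=set0, open D & connected D].

Section SimplyConnected.
Context (R : realType) (T : topologicalType).

Definition path_in (A : set T) (g : R -> T) : Prop :=
  {within `[0, 1], continuous g} /\ (forall t, t \in `[0, 1] -> A (g t)).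

Definition path_connected (A : set T) : Prop :=
  A !=set0 /\
  forall x y, A x -> A y -> exists g, [/\ path_in A g, g 0 = x & g 1 = y].

(* [H (s, t)]: [s] is the deformation parameter, [t] the loop parameter. *)
Definition null_homotopic (A : set T) (g : R -> T) : Prop :=
  exists H : R * R -> T,
    [/\ {within `[0, 1] `*` `[0, 1], continuous H},
        forall s t, s \in `[0, 1] -> t \in `[0, 1] -> A (H (s, t)),
        forall t, t \in `[0, 1] -> H (0, t) = g t,
        forall t, t \in `[0, 1] -> H (1, t) = g 0 &
        forall s, s \in `[0, 1] -> H (s, 0) = g 0 /\ H (s, 1) = g 0].

Definition simply_connected (A : set T) : Prop :=
  path_connected A /\
  forall g, path_in A g -> g 0 = g 1 -> null_homotopic A g.

End SimplyConnected.

Section VolumeElements.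
Context (R : realType) (n : nat).
Notation Cn := 'rV[R[i]]_n.
Implicit Types (D E l : set Cn) (z : Cn).

Definition complex_line l : Prop :=
  exists a v : Cn, v != 0 /\ l = [set a + t *: v | t in [set: R[i]]].

(* Only used for D open, so that D `&` l is automatically open in l. *)
Definition C_convex D : Prop :=
  forall l, complex_line l -> D `&` l !=set0 -> simply_connected R (D `&` l).

Definition non_degenerate D : Prop :=
  forall l, complex_line l -> ~ (l `<=` D).

(* The library norm on 'rV is the sup norm, hence a separate Euclidean norm;
   the two define the same topology. *)
Definition enorm (v : Cn) : R := Num.sqrt (\sum_i normc (v 0 i) ^+ 2).

Definition unit_ball : set Cn := [set w | enorm w < 1].

(* Maps are total functions on C^n, their values outside the open set D being
   irrelevant; differentiability is over the complex field. *)
Definition holomorphic D E (f : Cn -> Cn) : Prop :=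
  (forall x, D x -> differentiable f x) /\ (forall x, D x -> E (f x)).

(* ['J f x] acts on row vectors, so it is the transpose of the usual Jacobian
   matrix, with the same determinant. *)
Definition jac2 (f : Cn -> Cn) (x : Cn) : R := normc (\det ('J f x)) ^+ 2.

Definition caratheodory_volume D z : \bar R :=
  ereal_sup [set (jac2 f z)%:E | f in
    [set f | holomorphic D unit_ball f /\ f z = 0]].

(* The inverse in \bar R satisfies 0^-1 = +oo. *)
Definition kobayashi_volume D z : \bar R :=
  ereal_inf [set ((jac2 f 0)%:E^-1)%E | f in
    [set f | holomorphic unit_ball D f /\ f 0 = z]].

Definition boundary D : set Cn := closure D `\` interior D.

(* Indices are shifted by one: [p k] is the point p^{k+1}. Only the values
   [p k] with k < n matter. *)
Fixpoint minimal_flag z (p : nat -> Cn) (j : nat) : set Cn :=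
  if j is k.+1 then
    minimal_flag z p k `&` [set w | dotmx (w - z) (p k - z) = 0]
  else [set: Cn].

Definition minimal_points D z (p : nat -> Cn) : Prop :=
  forall j, (j < n)%N ->
    (boundary D `&` minimal_flag z p j) (p j) /\
    (forall q, (boundary D `&` minimal_flag z p j) q ->
       enorm (p j - z) <= enorm (q - z)).

Definition minimal_product z (p : nat -> Cn) : R :=
  \prod_(j < n) enorm (p j - z).

End VolumeElements.

(* Main.v *)
(* Upper bounds. If [p] is a boundary point of [D] nearest to a point of [D], the complex
   tangent plane at [p] of the ball through [p] misses [D]; a limiting argument gives a
   complex hyperplane through every boundary point that misses [D]. Hence
   [w |-> z + sum_k (w_k / sqrt n) (p k - z)] maps the unit ball into [D]. Since
   [|det G'(0)| <= 1] for holomorphic self-maps [G] of the ball fixing [0], this yields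
   [v_D(z) p_D(z)^2 <= n^n] for both volume elements, and [n <= (4^n - 1) / 3].

   Lower bounds. Let [h_j] be the affine form that vanishes on a hyperplane through [p j]
   missing [D], with [h_j z = 1]. The domain [G = h_j(D)] inherits from [D] square roots of
   nonvanishing continuous functions and omits [0], so it carries holomorphic maps to the
   disc vanishing at [1] with derivative there of modulus above [1/4 - eta]: among
   the univalent ones, the square root trick makes a near-extremal map almost onto, and the
   Bieberbach-Eilenberg inequality, obtained here from Cauchy's determinant at Leja points,
   bounds its derivative. Dividing by [sqrt n] and collecting the [n] coordinates gives a
   map of [D] to the ball. Its Jacobian is triangular with respect to the vectors
   [p k - z], because the hyperplane at [p j] is parallel to [p k - z] for [k > j]. *)

Require Import Defs.
From mathcomp Require Import all_boot all_order all_algebra.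
From mathcomp Require Import all_classical all_reals all_analysis.
From mathcomp Require Import complex perm.
From mathcomp Require Import ring lra zify.

Set Implicit Arguments.
Unset Strict Implicit.
Unset Printing Implicit Defensive.

Import Order.TTheory GRing.Theory Num.Theory.
Import numFieldNormedType.Exports.
Import ComplexField.Normc.

Local Open Scope classical_set_scope.
Local Open Scope ring_scope.

(** * Complex differentiability *)

Section ComplexPlane.
Context {R : realType}.
Local Notation C := R[i].
Implicit Types (x y z w : C).

(** C-convexity is exploited by continuing square roots inside the slices of [D] by complex lines:
    monodromy on a simply connected slice makes the continued value independent of the path, hence
    continuous in the slice. The same device shows that tangent planes miss [D] and provides roots
    on all of [D]. Simple connectivity of the planar image [G] is never established; roots descend
    to [G] instead, since a root of a constant is constant on connected slices of a fibre.

    No normal family is extracted: near-extremal maps replace extremal ones, so the Koebe constant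
    is only approached and the defect is removed at the very end. The value 1/4 is the product of
    two halves, the derivatives at 1 of the square root and, up to sign, of [(1 - q) / (1 + q)].
    Squared and divided by [n] it gives the factor [1 / (16 n)] per coordinate.

    All one-variable analysis rests on the maximum principle, obtained from Goursat's theorem on
    rectangles in logarithmic polar coordinates. *)

Lemma normr_normc x : `|x| = ((normc x)%:C)%C.
Proof. by []. Qed.

Lemma normc_ge0 x : 0 <= normc x.
Proof. by case: x => a b; rewrite sqrtr_ge0. Qed.

Lemma normc_eq0 x : (normc x == 0) = (x == 0).
Proof. by apply/eqP/eqP => [/eq0_normc//|->]; rewrite normc0. Qed.

Lemma normc_gt0 x : (0 < normc x) = (x != 0).
Proof. by rewrite lt_def normc_ge0 andbT normc_eq0. Qed.

Lemma normcB x y : normc (x - y) = normc (y - x).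
Proof. by rewrite -normcN opprB. Qed.

Lemma le_normcB x y : normc (x - y) <= normc x + normc y.
Proof. by rewrite (le_trans (le_normcD _ _))// normcN. Qed.

Lemma normcX x n : normc (x ^+ n) = normc x ^+ n.
Proof. by elim: n => [|n IH]; rewrite ?normc1 // !exprS normcM IH. Qed.

Lemma normc_prod (I : Type) (r : seq I) (P : pred I) (F : I -> C) :
  normc (\prod_(i <- r | P i) F i) = \prod_(i <- r | P i) normc (F i).
Proof. by apply: (big_morph (@normc R)); [exact: normcM|exact: normc1]. Qed.

Lemma le_normc_sum (I : Type) (r : seq I) (P : pred I) (F : I -> C) :
  normc (\sum_(i <- r | P i) F i) <= \sum_(i <- r | P i) normc (F i).
Proof.
elim/big_rec2: _ => [|i a b _ le_ab]; first by rewrite normc0.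
by rewrite (le_trans (le_normcD _ _))// lerD2l.
Qed.

Lemma normc_real (a : R) : normc (a%:C)%C = `|a|.
Proof. by rewrite /normc /= expr0n /= addr0 sqrtr_sqr. Qed.

Lemma normc_nat n : normc (n%:R : C) = n%:R.
Proof. by rewrite -(rmorph_nat (real_complex R)) normc_real normr_nat. Qed.

Lemma sqr_normc_ReIm x : normc x ^+ 2 = complex.Re x ^+ 2 + complex.Im x ^+ 2.
Proof. by case: x => a b; rewrite sqr_sqrtr// addr_ge0 ?sqr_ge0. Qed.

Lemma le_Re_normc x : `|complex.Re x| <= normc x.
Proof.
rewrite -(@ler_pXn2r _ 2%N) ?nnegrE ?normc_ge0//.
by rewrite sqr_normc_ReIm real_normK ?num_real// lerDl sqr_ge0.
Qed.

Lemma le_Im_normc x : `|complex.Im x| <= normc x.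
Proof.
rewrite -(@ler_pXn2r _ 2%N) ?nnegrE ?normc_ge0//.
by rewrite sqr_normc_ReIm real_normK ?num_real// lerDr sqr_ge0.
Qed.

Lemma normc_le_ReIm x : normc x <= `|complex.Re x| + `|complex.Im x|.
Proof.
rewrite -(@ler_pXn2r _ 2%N) ?nnegrE ?normc_ge0 ?addr_ge0//.
rewrite sqr_normc_ReIm sqrrD !real_normK ?num_real//.
by rewrite lerD2r lerDl mulrn_wge0// mulr_ge0.
Qed.

Lemma normc_conj x : normc (conjc x) = normc x.
Proof. by case: x => a b; rewrite /normc /= sqrrN. Qed.

Lemma mul_conjc x : x * conjc x = ((normc x ^+ 2)%:C)%C.
Proof. by rewrite -sqr_normc normr_normc rmorphXn. Qed.

Lemma nbhs_normcP x (A : set C) :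
  nbhs x A <-> exists2 e : R, 0 < e & forall y, normc (y - x) < e -> A y.
Proof.
split.
  move=> /nbhs_normP [e /=]; case: e => a b.
  rewrite ltcE /= => /andP[/eqP -> a0] sA; exists a => // y xy.
  by apply: sA => /=; rewrite normr_normc normcB complexr0 ltcR.
move=> [e e0 sA]; apply/nbhs_normP; exists (e%:C)%C => /=; first by rewrite ltcR.
by move=> y /=; rewrite normr_normc normcB ltcR => /sA.
Qed.

Lemma near_normc x (e : R) : 0 < e -> \forall y \near x, normc (y - x) < e.
Proof. by move=> e0; apply/nbhs_normcP; exists e. Qed.

(** Tolerances are real because the library norm on [R[i]] takes values in [R[i]]; [locked] keeps
    unification from unfolding the filter statement. *)
Definition ccont {T : topologicalType} (f : T -> C) (t : T) : Prop :=
  locked (forall e : R, 0 < e -> \forall s \near t, normc (f s - f t) < e).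

Section Continuity.
Context {T : topologicalType}.
Implicit Types (f g : T -> C) (t : T).

Lemma ccontP f t : ccont f t <->
  forall e : R, 0 < e -> \forall s \near t, normc (f s - f t) < e.
Proof. by rewrite /ccont -lock. Qed.

Lemma ccontE f t : ccont f t <-> {for t, continuous f}.
Proof.
rewrite ccontP; split => [cf A /nbhs_normcP[e e0 sA]|cf e e0].
  by apply: filterS (cf _ e0) => s /sA.
exact: cf (near_normc _ e0).
Qed.

Lemma ccontD f g t : ccont f t -> ccont g t -> ccont (fun s => f s + g s) t.
Proof.
by move=> /ccontE cf /ccontE cg; apply/ccontE; exact: (@continuousD C C T f g t cf cg).
Qed.

Lemma ccontN f t : ccont f t -> ccont (fun s => - f s) t.
Proof. by move=> /ccontE cf; apply/ccontE; exact: (@continuousN C C T f t cf). Qed.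

Lemma ccontB f g t : ccont f t -> ccont g t -> ccont (fun s => f s - g s) t.
Proof.
by move=> /ccontE cf /ccontE cg; apply/ccontE; exact: (@continuousB C C T f g t cf cg).
Qed.

Lemma ccontM f g t : ccont f t -> ccont g t -> ccont (fun s => f s * g s) t.
Proof.
by move=> /ccontE cf /ccontE cg; apply/ccontE; exact: (@continuousM C T f g t cf cg).
Qed.

Lemma ccontV f t : f t != 0 -> ccont f t -> ccont (fun s => (f s)^-1) t.
Proof.
by move=> f0 /ccontE cf; apply/ccontE; exact: (@continuousV C T f t f0 cf).
Qed.

Lemma ccont_cst (c : C) t : ccont (fun _ : T => c) t.
Proof. by apply/ccontE; exact: (@cst_continuous T C c t). Qed.

Lemma ccont_prod (I : Type) (r : seq I) (P : pred I) (F : I -> T -> C) t :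
  (forall i, P i -> ccont (F i) t) ->
  ccont (fun s => \prod_(i <- r | P i) F i s) t.
Proof.
move=> cF; elim: r => [|i r IH].
  rewrite (_ : (fun _ => _) = fun=> 1); first exact: ccont_cst.
  by apply/funext => s; rewrite big_nil.
have [Pi|Pi] := boolP (P i); last first.
  rewrite (_ : (fun _ => _) = fun s => \prod_(i <- r | P i) F i s)//.
  by apply/funext => s; rewrite big_cons (negbTE Pi).
rewrite (_ : (fun _ => _) = fun s => F i s * \prod_(i <- r | P i) F i s).
  by apply: ccontM => //; exact: cF.
by apply/funext => s; rewrite big_cons Pi.
Qed.

Lemma cont_Re f t : ccont f t -> {for t, continuous (fun s => complex.Re (f s))}.
Proof.
move=> /ccontP cf; apply/cvgrPdist_lt => e /cf; apply: filterS => s.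
by apply: le_lt_trans; rewrite -raddfB (le_trans (le_Re_normc _))// normcB.
Qed.

Lemma cont_normc f t : ccont f t -> {for t, continuous (fun s => normc (f s))}.
Proof.
move=> /ccontP cf; apply/cvgrPdist_lt => e /cf; apply: filterS => s.
apply: le_lt_trans; rewrite ler_norml; apply/andP; split.
  by rewrite lerNl opprB lerBlDl -{1}(subrK (f t) (f s)) addrC le_normcD.
by rewrite lerBlDl -{1}(subrK (f s) (f t)) normcB addrC le_normcD.
Qed.

Lemma ccont_ReIm (u v : T -> R) t : {for t, continuous u} -> {for t, continuous v} ->
  ccont (fun s => Complex (u s) (v s)) t.
Proof.
move=> /cvgrPdist_lt cu /cvgrPdist_lt cv; apply/ccontP => e e0.
have e2 : 0 < e / 2 by rewrite divr_gt0.
near=> s; rewrite (le_lt_trans (normc_le_ReIm _))//= (splitr e) ltrD//.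
  by rewrite distrC; near: s; exact: cu.
by rewrite distrC; near: s; exact: cv.
Unshelve. all: by end_near. Qed.

Lemma ccont_real (u : T -> R) t : {for t, continuous u} ->
  ccont (fun s => ((u s)%:C)%C) t.
Proof. by move=> cu; apply: ccont_ReIm => //; exact: cst_continuous. Qed.

Lemma ccont_conj f t : ccont f t -> ccont (fun s => conjc (f s)) t.
Proof.
move=> /ccontP cf; apply/ccontP => e /cf; apply: filterS => s.
by rewrite -raddfB normc_conj.
Qed.

Lemma ccont_near_neq0 f t : ccont f t -> f t != 0 -> \forall s \near t, f s != 0.
Proof.
move=> /ccontP cf; rewrite -normc_gt0 => f0; apply: filterS (cf _ f0) => s.
by apply: contraTneq => ->; rewrite sub0r normcN ltxx.
Qed.

Lemma ccont_eq_near f g t : (\forall s \near t, f s = g s) -> ccont f t -> ccont g t.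
Proof.
move=> E /ccontP cf; apply/ccontP => e e0.
rewrite -(nbhs_singleton E).
by apply: filterS2 E (cf _ e0) => s ->.
Qed.

End Continuity.

Lemma ccont_precomp {T U : topologicalType} (f : U -> C) (g : T -> U) t :
  {for t, continuous g} -> ccont f (g t) -> ccont (fun s => f (g s)) t.
Proof. by move=> cg /ccontP cf; apply/ccontP => e /cf; exact: cg. Qed.

Lemma ccont_comp {T : topologicalType} (F : C -> C) (f : T -> C) t :
  ccont f t -> ccont F (f t) -> ccont (fun s => F (f s)) t.
Proof. by move=> /ccontE cf; exact: ccont_precomp. Qed.

Lemma ccont_id x : ccont (fun y : C => y) x.
Proof. by apply/ccontP => e; exact: near_normc. Qed.

(* Caratheodory's formulation of complex differentiability. *)
Definition cderiv (f : C -> C) x (a : C) : Prop :=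
  exists phi : C -> C, [/\ ccont phi x, phi x = a &
    forall y, f y - f x = phi y * (y - x)].

Implicit Types (f g : C -> C) (a b : C).

Lemma cderiv_cont f x a : cderiv f x a -> ccont f x.
Proof.
move=> [phi [cphi _ E]].
have -> : f = fun y => phi y * (y - x) + f x by apply/funext => y; rewrite -E subrK.
apply: ccontD; last exact: ccont_cst.
by apply: ccontM => //; apply: ccontB; [exact: ccont_id|exact: ccont_cst].
Qed.

(** Only the germ of the slope function at [x] matters: elsewhere the difference quotient itself
    serves. *)
Lemma cderiv_near f x a (phi : C -> C) : ccont phi x -> phi x = a ->
  (\forall y \near x, f y - f x = phi y * (y - x)) -> cderiv f x a.
Proof.
move=> cphi phia E.
exists (fun y => if y == x then a else (f y - f x) / (y - x)); split.
- apply: ccont_eq_near cphi; apply: filterS E => y E.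
  by case: eqVneq => [->//|yx]; rewrite E mulfK// subr_eq0.
- by rewrite eqxx.
- by move=> y; case: eqVneq => [->|yx]; rewrite ?subrr ?mulr0// mulfVK// subr_eq0.
Qed.

Lemma cderivP f x a : cderiv f x a <-> forall e : R, 0 < e ->
  \forall y \near x, normc (f y - f x - a * (y - x)) <= e * normc (y - x).
Proof.
split=> [[phi [cphi phia E]] e e0|H].
  move/ccontP : cphi => /(_ _ e0); apply: filterS => y.
  by rewrite E phia -mulrBl normcM => /ltW lee; rewrite ler_wpM2r ?normc_ge0.
apply: (@cderiv_near _ _ _ (fun y => if y == x then a else (f y - f x) / (y - x))).
- apply/ccontP => e e0; rewrite eqxx.
  have e2 : 0 < e / 2 by rewrite divr_gt0.
  apply: filterS (H _ e2) => y Hy.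
  case: eqVneq => [_|yx]; first by rewrite subrr normc0.
  have yx0 : y - x != 0 by rewrite subr_eq0.
  rewrite (_ : _ - a = (f y - f x - a * (y - x)) / (y - x)); last by field.
  rewrite normcM normcV ltr_pdivrMr ?normc_gt0//.
  rewrite (le_lt_trans Hy)// ltr_pM2r ?normc_gt0//; lra.
- by rewrite eqxx.
- apply: filterE => y; case: eqVneq => [->|yx]; rewrite ?subrr ?mulr0//.
  by rewrite mulfVK// subr_eq0.
Qed.

Lemma cderiv_unique f x a b : cderiv f x a -> cderiv f x b -> a = b.
Proof.
move=> /cderivP Ha /cderivP Hb; apply/eqP; rewrite -subr_eq0 -normc_eq0.
rewrite eq_le normc_ge0 andbT; apply/ler_addgt0Pr => e e0; rewrite add0r.
have e2 : 0 < e / 2 by rewrite divr_gt0.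
have /nbhs_normcP[d d0 H] : \forall y \near x,
    normc (f y - f x - a * (y - x)) <= e / 2 * normc (y - x) /\
    normc (f y - f x - b * (y - x)) <= e / 2 * normc (y - x).
  by apply: filterS2 (Ha _ e2) (Hb _ e2).
pose y := x + ((d / 2)%:C)%C.
have yx : y - x = ((d / 2)%:C)%C by rewrite /y addrC addKr.
have n0 : 0 < normc (y - x) by rewrite yx normc_real gtr0_norm ?divr_gt0.
have [] := H y; first by rewrite yx normc_real gtr0_norm ?divr_gt0//; lra.
move=> H1 H2; rewrite -(ler_pM2r n0) -normcM.
rewrite (_ : (a - b) * (y - x) =
  (f y - f x - b * (y - x)) - (f y - f x - a * (y - x))); last by ring.
by rewrite (le_trans (le_normcB _ _))// [e]splitr mulrDl lerD.
Qed.

Lemma cderiv_cst (c : C) x : cderiv (fun=> c) x 0.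
Proof. by exists (fun=> 0); split=> [|//|y]; [exact: ccont_cst|rewrite subrr mul0r]. Qed.

Lemma cderiv_id x : cderiv (fun y => y) x 1.
Proof. by exists (fun=> 1); split=> [|//|y]; [exact: ccont_cst|rewrite mul1r]. Qed.

Lemma cderivD f g x a b : cderiv f x a -> cderiv g x b -> cderiv (fun y => f y + g y) x (a + b).
Proof.
move=> [p [cp <- Ep]] [q [cq <- Eq]]; exists (fun y => p y + q y); split=> [|//|y].
  exact: ccontD.
by rewrite mulrDl -Ep -Eq; ring.
Qed.

Lemma cderivN f x a : cderiv f x a -> cderiv (fun y => - f y) x (- a).
Proof.
move=> [p [cp <- Ep]]; exists (fun y => - p y); split=> [|//|y]; first exact: ccontN.
by rewrite mulNr -Ep; ring.
Qed.

Lemma cderivB f g x a b : cderiv f x a -> cderiv g x b -> cderiv (fun y => f y - g y) x (a - b).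
Proof. by move=> Hf Hg; apply: cderivD => //; exact: cderivN. Qed.

Lemma cderivM f g x a b : cderiv f x a -> cderiv g x b ->
  cderiv (fun y => f y * g y) x (a * g x + f x * b).
Proof.
move=> Hf [q [cq <- Eq]]; have cf := cderiv_cont Hf.
case: Hf => [p [cp <- Ep]].
exists (fun y => p y * g x + f y * q y); split=> [|//|y].
  by apply: ccontD; apply: ccontM => //; exact: ccont_cst.
by rewrite mulrDl mulrAC -Ep -mulrA -Eq; ring.
Qed.

Lemma cderivV f x a : f x != 0 -> cderiv f x a ->
  cderiv (fun y => (f y)^-1) x (- a / f x ^+ 2).
Proof.
move=> f0 Hf; have cf := cderiv_cont Hf.
case: Hf => [p [cp <- Ep]].
apply: (@cderiv_near _ _ _ (fun y => - p y / (f y * f x))).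
- apply: ccontM; first exact: ccontN.
  by apply: ccontV; [rewrite mulf_neq0|apply: ccontM => //; exact: ccont_cst].
- by rewrite expr2.
apply: filterS (ccont_near_neq0 cf f0) => y fy.
by rewrite mulrAC mulNr -Ep; field; rewrite fy f0.
Qed.

Lemma cderiv_comp f g x a b : cderiv f x a -> cderiv g (f x) b ->
  cderiv (fun y => g (f y)) x (b * a).
Proof.
move=> Hf [q [cq <- Eq]]; have cf := cderiv_cont Hf.
case: Hf => [p [cp <- Ep]].
exists (fun y => q (f y) * p y); split=> [|//|y].
  by apply: ccontM => //; exact: ccont_comp.
by rewrite Eq Ep mulrA.
Qed.

Lemma cderiv_eq f g x a : (\forall y \near x, f y = g y) -> cderiv f x a -> cderiv g x a.
Proof.
move=> E [p [cp pa Ep]]; apply: (cderiv_near cp pa).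
rewrite -(nbhs_singleton E).
by apply: filterS E => y <-.
Qed.

Lemma cderiv_prod (I : Type) (r : seq I) (P : pred I) (F : I -> C -> C) x :
  (forall i, P i -> exists a, cderiv (F i) x a) ->
  exists a, cderiv (fun y => \prod_(i <- r | P i) F i y) x a.
Proof.
move=> cF; elim: r => [|i r [a IH]].
  exists 0; rewrite (_ : (fun _ => _) = fun=> 1); first exact: cderiv_cst.
  by apply/funext => s; rewrite big_nil.
have [Pi|Pi] := boolP (P i); last first.
  exists a; rewrite (_ : (fun _ => _) = fun s => \prod_(i <- r | P i) F i s)//.
  by apply/funext => s; rewrite big_cons (negbTE Pi).
have [b Hb] := cF _ Pi; eexists.
rewrite (_ : (fun _ => _) = fun s => F i s * \prod_(i <- r | P i) F i s).
  by apply: cderivM IH; exact: Hb.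
by apply/funext => s; rewrite big_cons Pi.
Qed.

(** Factoring [s y ^+ 2 - s x ^+ 2] shows that the slope function of a continuous root is that of
    [f] divided by [s y + s x]. *)
Lemma cderiv_sqrt f (s : C -> C) x a : s x != 0 -> ccont s x ->
  (\forall y \near x, (s y : C) ^+ 2 = f y) -> cderiv f x a ->
  cderiv s x (a / (2 * s x)).
Proof.
move=> s0 cs E [p [cp <- Ep]].
have Ex := nbhs_singleton E.
have ss0 : s x + s x != 0 by rewrite -mulr2n mulrn_eq0.
have css : ccont (fun y => s y + s x) x.
  by apply: ccontD => //; exact: ccont_cst.
apply: (@cderiv_near _ _ _ (fun y => p y / (s y + s x))).
- by apply: ccontM => //; exact: ccontV.
- by rewrite mulr_natl mulr2n.
apply: filterS2 E (ccont_near_neq0 css ss0) => y Ey sy0.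
by rewrite mulrAC -Ep -Ey -Ex; field.
Qed.

End ComplexPlane.

(** * Goursat's theorem *)

Section Goursat.
Context {R : realType}.
Implicit Types (f g : R -> R) (a b c : R).

Definition itvint a b f : R := \int[lebesgue_measure]_(t in `[a, b]) f t.

Lemma itv_integrable a b f : {within `[a, b], continuous f} ->
  lebesgue_measure.-integrable `[a, b] (EFin \o f).
Proof.
move=> cf; apply: continuous_compact_integrable => //; exact: segment_compact.
Qed.

Lemma continuous_within (T : topologicalType) (f : R -> T) a b : (forall x, a <= x <= b -> {for x, continuous f}) ->
  {within `[a, b], continuous f}.
Proof.
move=> cf; apply: continuous_in_subspaceT => x.
by rewrite inE /= in_itv /= => /cf.
Qed.

Lemma itvint_split a b c f : a <= c <= b -> {within `[a, b], continuous f} ->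
  itvint a b f = itvint a c f + itvint c b f.
Proof.
move=> /andP[ac cb] cf; apply/eqP; rewrite addrC -subr_eq; apply/eqP.
have If := itv_integrable cf.
rewrite /itvint Rintegral_itvB ?bnd_simp// Rintegral_itv_obnd_cbnd//.
apply: integrableS If => //; apply: subset_itvr; by rewrite bnd_simp.
Qed.

Lemma itvintB a b f g : {within `[a, b], continuous f} -> {within `[a, b], continuous g} ->
  itvint a b (fun x => f x - g x) = itvint a b f - itvint a b g.
Proof. by move=> cf cg; apply: RintegralB => //; exact: itv_integrable. Qed.

Lemma itvint_cst a b c : a <= b -> itvint a b (fun=> c) = c * (b - a).
Proof.
move=> ab; rewrite /itvint Rintegral_cst//= lebesgue_measure_itv/= lte_fin.
by case: ltP => //= ba; have /eqP -> : a == b; rewrite ?eq_le ?ab// subrr.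
Qed.

Lemma itvint_le a b f g : {within `[a, b], continuous f} -> {within `[a, b], continuous g} ->
  (forall x, a <= x <= b -> f x <= g x) -> itvint a b f <= itvint a b g.
Proof.
move=> cf cg fg; apply: le_Rintegral; [exact: measurable_itv|exact: itv_integrable|exact: itv_integrable|].
by move=> x /=; rewrite in_itv /= => /fg.
Qed.

Lemma within_cst a b c : {within `[a, b], continuous (fun _ : R => c)}.
Proof. by apply: continuous_within => x _; exact: cst_continuous. Qed.

Lemma itvint_dist a b f c M : a <= b -> {within `[a, b], continuous f} ->
  (forall x, a <= x <= b -> `|f x - c| <= M) -> `|itvint a b f - c * (b - a)| <= M * (b - a).
Proof.
move=> ab cf H; rewrite ler_norml; apply/andP; split.
  rewrite lerBrDl -mulrBl -itvint_cst//; apply: itvint_le => //; first exact: within_cst.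
  by move=> x /H; rewrite ler_norml => /andP[]; rewrite lerBrDl.
rewrite lerBlDl -mulrDl -itvint_cst//; apply: itvint_le => //; first exact: within_cst.
by move=> x /H; rewrite ler_norml => /andP[_]; rewrite lerBlDl.
Qed.

Section Rectangles.
Variables (L : R) (u v : R -> R -> R).
(* [u + i v] is holomorphic on the half-plane [x < L]. *)
Hypothesis Duv : forall x y, x < L -> exists al be : R, forall e : R, 0 < e ->
  exists2 d : R, 0 < d & forall X Y, `|X - x| < d -> `|Y - y| < d ->
    `|u X Y - u x y - (al * (X - x) - be * (Y - y))| <= e * (`|X - x| + `|Y - y|) /\
    `|v X Y - v x y - (be * (X - x) + al * (Y - y))| <= e * (`|X - x| + `|Y - y|).

Lemma rect_cont x y : x < L -> forall e : R, 0 < e -> exists2 d : R, 0 < d &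
  forall X Y, `|X - x| < d -> `|Y - y| < d -> `|u X Y - u x y| <= e /\ `|v X Y - v x y| <= e.
Proof.
move=> /(@Duv x y)[al [be /(_ 1 ltr01)[d d0 H]]] e e0.
pose K := 1 + `|al| + `|be|.
have K0 : 0 < K by rewrite /K; have := normr_ge0 al; have := normr_ge0 be; lra.
exists (Num.min d (e / (2 * K))); first by rewrite lt_min d0 divr_gt0// mulr_gt0.
move=> X Y; rewrite !lt_min => /andP[Xd Xe] /andP[Yd Ye].
have [Hu Hv] := H X Y Xd Yd.
have S : K * (`|X - x| + `|Y - y|) <= e.
  rewrite (splitr e) mulrDr; apply: lerD.
    by move: Xe; rewrite ltr_pdivlMr ?mulr_gt0// => /ltW; lra.
  by move: Ye; rewrite ltr_pdivlMr ?mulr_gt0// => /ltW; lra.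
have nX := normr_ge0 (X - x); have nY := normr_ge0 (Y - y).
have na := normr_ge0 al; have nb := normr_ge0 be.
have aX : `|al * (X - x)| = `|al| * `|X - x| by rewrite normrM.
have bX : `|be * (X - x)| = `|be| * `|X - x| by rewrite normrM.
have aY : `|al * (Y - y)| = `|al| * `|Y - y| by rewrite normrM.
have bY : `|be * (Y - y)| = `|be| * `|Y - y| by rewrite normrM.
have p1 := mulr_ge0 na nX; have p2 := mulr_ge0 nb nX.
have p3 := mulr_ge0 na nY; have p4 := mulr_ge0 nb nY.
rewrite /K in S.
split.
  rewrite -(subrK (al * (X - x) - be * (Y - y)) (_ - u x y)).
  rewrite (le_trans (ler_normD _ _))//.
  have := ler_normB (al * (X - x)) (be * (Y - y)); lra.
rewrite -(subrK (be * (X - x) + al * (Y - y)) (_ - v x y)).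
rewrite (le_trans (ler_normD _ _))//.
have := ler_normD (be * (X - x)) (al * (Y - y)); lra.
Qed.

Lemma rect_contu x a b : x < L -> {within `[a, b], continuous (u x)}.
Proof.
move=> xL; apply: continuous_within => y _; apply/cvgrPdist_le => e e0.
have [d d0 H] := rect_cont y xL e0.
apply/nbhs_normP; exists d => // Y /= Yd; rewrite distrC.
by apply: (H x Y _ _).1; rewrite ?subrr ?normr0// distrC.
Qed.

Lemma rect_contv y a b : b < L -> {within `[a, b], continuous (v^~ y)}.
Proof.
move=> bL; apply: continuous_within => x /andP[_ xb]; apply/cvgrPdist_le => e e0.
have [d d0 H] := rect_cont y (le_lt_trans xb bL) e0.
apply/nbhs_normP; exists d => // X /= Xd; rewrite distrC.
by apply: (H X y _ _).2; rewrite ?subrr ?normr0// distrC.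
Qed.

(** This is the imaginary part of the integral of [u + i v] counterclockwise around the
    rectangle. *)
Definition rectint x0 x1 y0 y1 : R :=
  itvint y0 y1 (u x1) - itvint y0 y1 (u x0) - (itvint x0 x1 (v^~ y1) - itvint x0 x1 (v^~ y0)).

Lemma rectint_split x0 x1 y0 y1 x y : x0 <= x <= x1 -> y0 <= y <= y1 -> x1 < L ->
  rectint x0 x1 y0 y1 = rectint x0 x y0 y + rectint x x1 y0 y
                      + rectint x0 x y y1 + rectint x x1 y y1.
Proof.
move=> xx yy xL; have /andP[xx0 xx1] := xx.
have xL' := le_lt_trans xx1 xL; have xL0 := le_lt_trans xx0 xL'.
rewrite /rectint (itvint_split yy (@rect_contu _ _ _ xL)) (itvint_split yy (@rect_contu _ _ _ xL0)).
rewrite (itvint_split xx (@rect_contv _ _ _ xL)) (itvint_split xx (@rect_contv y0 _ _ xL)).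
ring.
Qed.

(** The affine approximation at [(x, y)] contributes [al * w * h] to both differences of opposite
    sides and cancels. What remains is the error of differentiability on the four sides. *)
Lemma rectint_small (x y e : R) : x < L -> 0 < e -> exists2 d : R, 0 < d &
  forall x0 x1 y0 y1, x0 <= x <= x1 -> y0 <= y <= y1 -> x1 < L ->
    x1 - x0 < d -> y1 - y0 < d ->
    `|rectint x0 x1 y0 y1| <= 2 * e * (x1 - x0 + (y1 - y0)) ^+ 2.
Proof.
move=> xL e0; have [al [be /(_ e e0)[d d0 H]]] := Duv y xL.
exists d => // x0 x1 y0 y1 /andP[xx0 xx1] /andP[yy0 yy1] xL1 dx dy.
set w := x1 - x0; set h := y1 - y0.
have w0 : 0 <= w by rewrite /w; lra.
have h0 : 0 <= h by rewrite /h; lra.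
have Hd : forall X Y, x0 <= X <= x1 -> y0 <= Y <= y1 ->
    `|u X Y - u x y - (al * (X - x) - be * (Y - y))| <= e * (w + h) /\
    `|v X Y - v x y - (be * (X - x) + al * (Y - y))| <= e * (w + h).
  move=> X Y /andP[X0 X1] /andP[Y0 Y1].
  have Xw : `|X - x| <= w by rewrite ler_norml /w; apply/andP; split; lra.
  have Yh : `|Y - y| <= h by rewrite ler_norml /h; apply/andP; split; lra.
  have [] := H X Y; [exact: le_lt_trans dx|exact: le_lt_trans dy|].
  have E : e * (`|X - x| + `|Y - y|) <= e * (w + h) by rewrite ler_pM2l// lerD.
  by move=> H1 H2; split; [exact: le_trans H1 E|exact: le_trans H2 E].
have xL0 : x0 < L by lra.
have x0x1 : x0 <= x1 by lra.
have y0y1 : y0 <= y1 by lra.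
have cu : {within `[y0, y1], continuous (fun Y => u x1 Y - u x0 Y)}.
  by move=> t; apply: continuousB; [exact: rect_contu|exact: rect_contu].
have cv : {within `[x0, x1], continuous (fun X => v X y1 - v X y0)}.
  by move=> t; apply: continuousB; [exact: rect_contv|exact: rect_contv].
have B1 : `|itvint y0 y1 (fun Y => u x1 Y - u x0 Y) - al * w * h| <= 2 * e * (w + h) * h.
  apply: itvint_dist => // Y Yy.
  have [|H1 _] := Hd x1 Y _ Yy; first by rewrite x0x1 lexx.
  have [|H0 _] := Hd x0 Y _ Yy; first by rewrite x0x1 lexx.
  rewrite (_ : _ - al * w = (u x1 Y - u x y - (al * (x1 - x) - be * (Y - y)))
    - (u x0 Y - u x y - (al * (x0 - x) - be * (Y - y)))); last by rewrite /w; ring.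
  by rewrite (le_trans (ler_normB _ _))//; lra.
have B2 : `|itvint x0 x1 (fun X => v X y1 - v X y0) - al * h * w| <= 2 * e * (w + h) * w.
  apply: itvint_dist => // X Xx.
  have [|_ H1] := Hd X y1 Xx; first by rewrite y0y1 lexx.
  have [|_ H0] := Hd X y0 Xx; first by rewrite y0y1 lexx.
  rewrite (_ : _ - al * h = (v X y1 - v x y - (be * (X - x) + al * (y1 - y)))
    - (v X y0 - v x y - (be * (X - x) + al * (y0 - y)))); last by rewrite /h; ring.
  by rewrite (le_trans (ler_normB _ _))//; lra.
rewrite /rectint -(itvintB (@rect_contu _ _ _ xL1) (@rect_contu _ _ _ xL0)).
rewrite -(itvintB (@rect_contv _ _ _ xL1) (@rect_contv _ _ _ xL1)).
set I1 := itvint y0 y1 _ in B1 *; set I2 := itvint x0 x1 _ in B2 *.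
rewrite (_ : I1 - I2 = (I1 - al * w * h) - (I2 - al * h * w)); last by ring.
rewrite (le_trans (ler_normB _ _))//.
rewrite (_ : 2 * e * _ = 2 * e * (w + h) * h + 2 * e * (w + h) * w); last by ring.
exact: lerD.
Qed.

(** Nested dyadic rectangles: the two booleans select the quarter that inherits [P], and the common
    point is the supremum of the lower left corners, coordinate by coordinate. *)
Lemma bisect_seq (P : nat -> R -> R -> Prop) w h x0 y0 : 0 <= w -> 0 <= h ->
  P 0%N x0 y0 ->
  (forall n x y, P n x y -> exists b c : bool,
     P n.+1 (x + b%:R * (w / 2 ^+ n.+1)) (y + c%:R * (h / 2 ^+ n.+1))) ->
  exists xs ys : R, forall n, exists x y : R, [/\ P n x y,
    x <= xs <= x + w / 2 ^+ n, y <= ys <= y + h / 2 ^+ n,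
    x0 <= x & x + w / 2 ^+ n <= x0 + w].
Proof.
move=> w0 h0 P0 step.
have nx (np : nat * (R * R)) : exists bc : bool * bool, P np.1 np.2.1 np.2.2 ->
    P np.1.+1 (np.2.1 + bc.1%:R * (w / 2 ^+ np.1.+1)) (np.2.2 + bc.2%:R * (h / 2 ^+ np.1.+1)).
  have [/step[b [c H]]|nP] := pselect (P np.1 np.2.1 np.2.2); first by exists (b, c).
  by exists (false, false).
have [F HF] := choice nx.
pose s := fix s n : R * R := if n is m.+1 then
   let bc := F (m, s m) in
   ((s m).1 + bc.1%:R * (w / 2 ^+ m.+1), (s m).2 + bc.2%:R * (h / 2 ^+ m.+1))
   else (x0, y0).
have Ps n : P n (s n).1 (s n).2.
  by elim: n => [//|n IH]; exact: (HF (n, s n) IH).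
have lim (t : nat -> R) W : 0 <= W ->
    (forall n, exists b : bool, t n.+1 = t n + b%:R * (W / 2 ^+ n.+1)) ->
    exists ts, forall n, [/\ t n <= ts <= t n + W / 2 ^+ n, t 0%N <= t n
                         & t n + W / 2 ^+ n <= t 0%N + W].
  move=> W0 Ht.
  have hp n : 0 <= W / 2 ^+ n by rewrite divr_ge0// exprn_ge0.
  have half n : W / 2 ^+ n = W / 2 ^+ n.+1 + W / 2 ^+ n.+1.
    by rewrite exprS; field; rewrite expf_neq0.
  have inc n k : t n <= t (n + k)%N /\ t (n + k)%N + W / 2 ^+ (n + k) <= t n + W / 2 ^+ n.
    elim: k => [|k [IH1 IH2]]; first by rewrite addn0 !lexx.
    have [b E] := Ht (n + k)%N; rewrite addnS E.
    have := hp (n + k).+1; have := half (n + k)%N.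
    case: b {E} => /=; rewrite ?mul1r ?mul0r => ? ?; split; lra.
  have up n m : t m <= t n + W / 2 ^+ n.
    have [/subnKC <-|/ltnW/subnKC <-] := leqP n m.
      by have [_ H] := inc n (m - n)%N; have := hp (n + (m - n))%N; lra.
    by have [H _] := inc m (n - m)%N; have := hp (m + (n - m))%N; lra.
  exists (sup (range t)) => n; split.
  - apply/andP; split.
      apply: ub_le_sup; last by exists n.
      by exists (t 0%N + W / 2 ^+ 0) => _ [m _ <-]; exact: up.
    apply: ge_sup; first by exists (t 0%N); exists 0%N.
    by move=> _ [m _ <-]; exact: up.
  - by have [] := inc 0%N n; rewrite add0n.
  - by have [_] := inc 0%N n; rewrite add0n expr0 divr1.
have [xs Hx] := lim (fun n => (s n).1) w w0 (fun n => ex_intro _ (F (n, s n)).1 erefl).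
have [ys Hy] := lim (fun n => (s n).2) h h0 (fun n => ex_intro _ (F (n, s n)).2 erefl).
exists xs, ys => n; exists (s n).1, (s n).2.
by have [A B D] := Hx n; have [A' _ _] := Hy n; split.
Qed.

(** Bisection keeps a quarter that carries at least a quarter of the modulus. Near the limit point
    the integral is at most a small constant times the square of the size, so the factors [4 ^+ n]
    cancel and the constant is arbitrary. *)
Theorem goursat x0 x1 y0 y1 : x0 <= x1 -> y0 <= y1 -> x1 < L -> rectint x0 x1 y0 y1 = 0.
Proof.
move=> x01 y01 xL; set w := x1 - x0; set h := y1 - y0.
have w0 : 0 <= w by rewrite /w; lra.
have h0 : 0 <= h by rewrite /h; lra.
set J := `|rectint x0 x1 y0 y1|.
pose P n x y := x + w / 2 ^+ n < L /\
  J <= 4 ^+ n * `|rectint x (x + w / 2 ^+ n) y (y + h / 2 ^+ n)|.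
have P0 : P 0%N x0 y0.
  rewrite /P expr0 !divr1 mul1r /w /h !(addrC _ (_ - _)) !subrK; split => //.
have hp n : 0 <= w / 2 ^+ n by rewrite divr_ge0// exprn_ge0.
have hp' n : 0 <= h / 2 ^+ n by rewrite divr_ge0// exprn_ge0.
have half n (W : R) : W / 2 ^+ n = W / 2 ^+ n.+1 + W / 2 ^+ n.+1.
  by rewrite exprS; field; rewrite expf_neq0.
have step n x y : P n x y -> exists b c : bool,
     P n.+1 (x + b%:R * (w / 2 ^+ n.+1)) (y + c%:R * (h / 2 ^+ n.+1)).
  move=> [xwL HJ]; have w' := hp n.+1; have h' := hp' n.+1.
  rewrite (half n w) in xwL HJ; rewrite (half n h) in HJ.
  rewrite /P; set W := w / 2 ^+ n.+1 in w' xwL HJ *; set H := h / 2 ^+ n.+1 in h' HJ *.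
  have := HJ; rewrite (@rectint_split _ _ _ _ (x + W) (y + H)); [|lra|lra|exact: xwL].
  set A := rectint x _ y _; set B := rectint _ _ y _; set D := rectint x _ _ _.
  set E := rectint _ _ _ _ => H1.
  have H2 : J <= 4 ^+ n * (`|A| + `|B| + `|D| + `|E|).
    apply: (le_trans H1); rewrite ler_pM2l ?exprn_gt0//.
    rewrite (le_trans (ler_normD _ _))// lerD2r (le_trans (ler_normD _ _))// lerD2r.
    exact: ler_normD.
  have [HA|HA] := leP J (4 ^+ n.+1 * `|A|).
    exists false, false; rewrite !mul0r !addr0; split; [lra|exact: HA].
  have [HB|HB] := leP J (4 ^+ n.+1 * `|B|).
    exists true, false; rewrite !mul0r !mul1r !addr0 -!addrA; split; [lra|exact: HB].
  have [HD|HD] := leP J (4 ^+ n.+1 * `|D|).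
    exists false, true; rewrite !mul0r !mul1r !addr0 -(addrA y); split; [lra|exact: HD].
  have [HE|HE] := leP J (4 ^+ n.+1 * `|E|).
    exists true, true; rewrite !mul1r -!addrA; split; [lra|exact: HE].
  exfalso; move: H2 HA HB HD HE; rewrite !exprS.
  have : (0:R) < 4 ^+ n by rewrite exprn_gt0.
  move: (4 ^+ n) => q q0; nra.
have [xs [ys Hs]] := bisect_seq w0 h0 P0 step.
apply/eqP; rewrite -normr_eq0 eq_le normr_ge0 andbT; apply/ler_addgt0Pr => e e0.
rewrite add0r -/J.
(* The final bound will be [e' * (2 * (w + h) ^+ 2)]; the summand 1 keeps the divisor positive for a
   degenerate rectangle. *)
pose e' := e / (2 * (w + h) ^+ 2 + 1).
have k0 : 0 < 2 * (w + h) ^+ 2 + 1 by rewrite ltr_wpDl// mulr_ge0// sqr_ge0.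
have e'0 : 0 < e' by rewrite divr_gt0.
have xsL : xs < L.
  have [x [y [[]]]] := Hs 0%N; rewrite expr0 divr1 => _ _ /andP[_ H1] _ _ H2.
  by apply: le_lt_trans (le_trans H1 H2) _; rewrite /w addrC subrK.
have [d d0 Hd] := rectint_small ys xsL e'0.
have [n Hn] : exists n, w / 2 ^+ n < d /\ h / 2 ^+ n < d.
  pose M := (w + h) / d.
  have M0 : 0 <= M by apply: divr_ge0; [exact: addr_ge0|exact: ltW].
  exists (Num.truncn M).+1.
  have H1 : M < 2 ^+ (Num.truncn M).+1.
    apply: (lt_le_trans (truncnS_gt M)).
    by rewrite -natrX ler_nat ltnW// ltn_expl.
  have H2 : w + h < d * 2 ^+ (Num.truncn M).+1.
    by move: H1; rewrite /M ltr_pdivrMr// mulrC.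
  by split; rewrite ltr_pdivrMr ?exprn_gt0//; lra.
have [x [y [[xwL HJ] xx yy _ _]]] := Hs n.
apply: (le_trans HJ).
have := Hd _ _ _ _ xx yy xwL; rewrite ![_ + _ / _ - _]addrC !addKr => /(_ Hn.1 Hn.2) H3.
apply: (@le_trans _ _ (4 ^+ n * (2 * e' * (w / 2 ^+ n + h / 2 ^+ n) ^+ 2))).
  by rewrite ler_pM2l ?exprn_gt0.
have E4 : 4 ^+ n = (2 ^+ n) ^+ 2 :> R by rewrite -exprM mulnC exprM -[2 ^+ 2]natrX.
have -> : 4 ^+ n * (2 * e' * (w / 2 ^+ n + h / 2 ^+ n) ^+ 2) = e' * (2 * (w + h) ^+ 2).
  by rewrite E4; field; rewrite expf_neq0.
by rewrite /e' mulrAC ler_pdivrMr// ler_pM2l// lerDl.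
Qed.

End Rectangles.
End Goursat.

(** * The maximum principle *)

Section MaximumPrinciple.
Context {R : realType}.
Local Notation C := R[i].

Lemma is_derive_near (f : R -> R) (x a : R) : is_derive x (1 : R) f a ->
  forall e : R, 0 < e -> exists2 d : R, 0 < d &
    forall y : R, `|y - x| < d -> `|f y - f x - a * (y - x)| <= e * `|y - x|.
Proof.
move=> [df <-] e e0.
have /cvgrPdist_le/(_ e e0)/nbhs_normP[d /= d0 H] : (fun h : R => h^-1 *: (f (h *: 1 + x) - f x)) @ 0^' --> 'D_1 f x := df.
exists d => // y yd.
have [->|yx] := eqVneq y x; first by rewrite !subrr mulr0 subrr normr0 mulr0.
have yx0 : y - x != 0 by rewrite subr_eq0.
have := H (y - x); rewrite /= sub0r normrN => /(_ yd yx0).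
rewrite scaler1 subrK => H1.
rewrite (_ : f y - _ - _ = - (('D_1 f x - (y - x)^-1 *: (f y - f x)) * (y - x))); last first.
  by rewrite /GRing.scale /=; field.
by rewrite normrN normrM ler_wpM2r.
Qed.

Lemma Re_complexM (z w : C) : complex.Re (z * w) =
  complex.Re z * complex.Re w - complex.Im z * complex.Im w.
Proof. by case: z w => [? ?] [? ?]. Qed.

Lemma Im_complexM (z w : C) : complex.Im (z * w) =
  complex.Re z * complex.Im w + complex.Im z * complex.Re w.
Proof. by case: z w => [? ?] [? ?]. Qed.

Lemma Re_complexB (z w : C) : complex.Re (z - w) = complex.Re z - complex.Re w.
Proof. by case: z w => [? ?] [? ?]. Qed.

Lemma Im_complexB (z w : C) : complex.Im (z - w) = complex.Im z - complex.Im w.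
Proof. by case: z w => [? ?] [? ?]. Qed.

Lemma Re_affine (z w b : C) (p q : R) : complex.Re (z - w - b * Complex p q) =
  complex.Re z - complex.Re w - (complex.Re b * p - complex.Im b * q).
Proof. by rewrite !Re_complexB Re_complexM. Qed.

Lemma Im_affine (z w b : C) (p q : R) : complex.Im (z - w - b * Complex p q) =
  complex.Im z - complex.Im w - (complex.Im b * p + complex.Re b * q).
Proof. by rewrite !Im_complexB Im_complexM /= (addrC (complex.Re b * q)). Qed.

Definition cexp (x y : R) : C := Complex (expR x * cos y) (expR x * sin y).

Lemma normc_cexp x y : normc (cexp x y) = expR x.
Proof.
rewrite /normc /= !exprMn -mulrDr cos2Dsin2 mulr1 sqrtr_sqr ger0_norm//.
Qed.

Lemma cexp_neq0 x y : cexp x y != 0.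
Proof. by rewrite -normc_eq0 normc_cexp gt_eqF// expR_gt0. Qed.

Lemma cexp_diff (x y e : R) : 0 < e -> exists2 d : R, 0 < d &
  forall X Y : R, `|X - x| < d -> `|Y - y| < d ->
    normc (cexp X Y - cexp x y - cexp x y * Complex (X - x) (Y - y))
      <= e * (`|X - x| + `|Y - y|).
Proof.
move=> e0.
have [d1 d10 H1] := is_derive_near (is_derive_expR x) (divr_gt0 e0 (ltr0Sn R 1)).
(* With this [K], both [e / K * expR x <= e / 8] and [e / K <= 1 / 8] hold. *)
pose K := 8 * (expR x + e).
have K0 : 0 < K by rewrite mulr_gt0// addr_gt0// expR_gt0.
have eK : 0 < e / K by rewrite divr_gt0.
have [d2 d20 H2] := is_derive_near (is_derive_cos y) eK.
have [d3 d30 H3] := is_derive_near (is_derive_sin y) eK.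
exists (Num.min (Num.min d1 d2) (Num.min d3 (e / K))).
  by rewrite !lt_min d10 d20 d30.
move=> X Y; rewrite !lt_min => /andP[/andP[X1 _] /andP[_ X4]] /andP[/andP[_ Y2] /andP[Y3 Y4]].
have {}H1 := H1 X X1; have {}H2 := H2 Y Y2; have {}H3 := H3 Y Y3.
pose T (t : R) : C := Complex (cos t) (sin t).
have nT t : normc (T t) = 1.
  by rewrite /normc /= cos2Dsin2 sqrtr1.
have cE s t : cexp s t = ((expR s)%:C)%C * T t.
  by rewrite /cexp /T /GRing.mul /= !mul0r subr0 addr0.
set r1 := expR X - expR x - _ in H1.
have rT : normc (T Y - T y - 'i%C * T y * ((Y - y)%:C)%C) <= 2 * (e / K) * `|Y - y|.
  rewrite (le_trans (normc_le_ReIm _))//.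
  rewrite (_ : 2 * (e / K) * _ = e / K * `|Y - y| + e / K * `|Y - y|); last by ring.
  rewrite (_ : _ - _ = T Y - T y - ('i%C * T y) * Complex (Y - y) 0)//.
  rewrite Re_affine Im_affine; apply: lerD.
    rewrite (_ : complex.Re _ - _ - _ = cos Y - cos y - - sin y * (Y - y))//.
    by rewrite Re_complexM Im_complexM /=; ring.
  rewrite (_ : complex.Im _ - _ - _ = sin Y - sin y - cos y * (Y - y))//.
  by rewrite Re_complexM Im_complexM /=; ring.
have n0 := normr_ge0 (Y - y).
have nx0 := normr_ge0 (X - x).
have eKe : e / K * (expR x + e) = e / 8.
  by rewrite /K; field; rewrite gt_eqF// addr_gt0// expR_gt0.
have E0 := expR_gt0 x.
have eKx : e / K * expR x <= e / 8 by rewrite -eKe ler_pM2l// lerDl ltW.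
have eK8 : e / K <= 1 / 8.
  by rewrite /K ler_pdivrMr//; lra.
have TY : normc (T Y - T y) <= 2 * `|Y - y|.
  rewrite -(subrK ('i%C * T y * ((Y - y)%:C)%C) (T Y - T y)).
  rewrite (le_trans (le_normcD _ _))// normcM normcM nT normc_real.
  have -> : normc ('i%C : C) = 1 by rewrite /normc /= expr0n expr1n add0r sqrtr1.
  rewrite !mul1r (le_trans (lerD rT (lexx _)))//; nra.
rewrite !cE.
rewrite (_ : _ - _ * Complex _ _ = (r1%:C)%C * T Y
   + ((expR x * (X - x))%:C)%C * (T Y - T y)
   + ((expR x)%:C)%C * (T Y - T y - 'i%C * T y * ((Y - y)%:C)%C)); last first.
  rewrite (_ : Complex (X - x) (Y - y) = ((X - x)%:C)%C + 'i%C * ((Y - y)%:C)%C).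
    by rewrite /r1 !rmorphB !rmorphM !rmorphB /=; ring.
  by rewrite {1}[Complex _ _]complexE.
rewrite (le_trans (le_normcD _ _))//.
have A1 : normc ((r1%:C)%C * T Y) <= e / 2 * `|X - x| by rewrite normcM nT mulr1 normc_real.
have A2 : normc (((expR x * (X - x))%:C)%C * (T Y - T y)) <= e / 4 * `|Y - y|.
  rewrite normcM normc_real normrM (gtr0_norm E0).
  apply: (@le_trans _ _ (expR x * (e / K) * (2 * `|Y - y|))).
    apply: ler_pM; [by apply: mulr_ge0 => //; exact: ltW|exact: normc_ge0| |exact: TY].
    by rewrite ler_pM2l// ltW.
  by have := ler_wpM2r n0 eKx; lra.
have A3 : normc (((expR x)%:C)%C * (T Y - T y - 'i%C * T y * ((Y - y)%:C)%C)) <= e / 4 * `|Y - y|.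
  rewrite normcM normc_real gtr0_norm//.
  apply: (@le_trans _ _ (expR x * (2 * (e / K) * `|Y - y|))); first by rewrite ler_pM2l.
  by have := ler_wpM2r n0 eKx; lra.
rewrite (le_trans (lerD (le_normcD _ _) (lexx _)))//.
have ep := mulr_ge0 (ltW e0) nx0; have ep2 := mulr_ge0 (ltW e0) n0.
lra.
Qed.

Lemma polar_diff (f : C -> C) a x y : cderiv f (cexp x y) a -> forall e : R, 0 < e ->
  exists2 d : R, 0 < d & forall X Y : R, `|X - x| < d -> `|Y - y| < d ->
    normc (f (cexp X Y) - f (cexp x y) - (a * cexp x y) * Complex (X - x) (Y - y))
      <= e * (`|X - x| + `|Y - y|).
Proof.
move=> /cderivP Hf e e0.
pose K := normc a + expR x + 2.
have a0 := normc_ge0 a.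
have E0 := expR_gt0 x.
have K0 : 0 < K by rewrite /K; lra.
have eK : 0 < e / (2 * K) by rewrite divr_gt0// mulr_gt0.
have /nbhs_normcP[d1 d10 H1] := Hf _ eK.
have [d2 d20 H2] := cexp_diff x y eK.
have [d3 d30 H3] := cexp_diff x y ltr01.
exists (Num.min (Num.min d2 d3) (d1 / (2 * K))).
  by rewrite !lt_min d20 d30 divr_gt0// mulr_gt0.
move=> X Y; rewrite !lt_min => /andP[/andP[X2 X3] X1] /andP[/andP[Y2 Y3] Y1].
have {}H2 := H2 X Y X2 Y2; have {}H3 := H3 X Y X3 Y3.
have nx0 := normr_ge0 (X - x); have ny0 := normr_ge0 (Y - y).
have nXY : normc (Complex (X - x) (Y - y)) <= `|X - x| + `|Y - y| := normc_le_ReIm _.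
have S0 : 0 <= `|X - x| + `|Y - y| by rewrite addr_ge0.
have D : normc (cexp X Y - cexp x y) <= K * (`|X - x| + `|Y - y|).
  rewrite -(subrK (cexp x y * Complex (X - x) (Y - y)) (cexp X Y - cexp x y)).
  rewrite (le_trans (le_normcD _ _))// normcM normc_cexp.
  have := ler_wpM2l (ltW E0) nXY; move: H3; rewrite /K !mulrDl mul1r.
  have := mulr_ge0 a0 S0; lra.
have Dd : normc (cexp X Y - cexp x y) < d1.
  apply: (le_lt_trans D); move: X1 Y1; rewrite !ltr_pdivlMr ?mulr_gt0//; lra.
have {}H1 := H1 _ Dd.
rewrite (_ : _ - _ = (f (cexp X Y) - f (cexp x y) - a * (cexp X Y - cexp x y))
   + a * (cexp X Y - cexp x y - cexp x y * Complex (X - x) (Y - y))); last by ring.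
rewrite (le_trans (le_normcD _ _))// normcM.
have A1 : e / (2 * K) * normc (cexp X Y - cexp x y) <= e / 2 * (`|X - x| + `|Y - y|).
  apply: (le_trans (ler_wpM2l (ltW eK) D)).
  by rewrite mulrA ler_wpM2r// -[e / (2 * K) * K]mulrA invfM mulfVK ?gt_eqF.
have A2 : normc a * normc (cexp X Y - cexp x y - cexp x y * Complex (X - x) (Y - y))
    <= e / 2 * (`|X - x| + `|Y - y|).
  apply: (le_trans (ler_wpM2l a0 H2)); rewrite mulrA ler_wpM2r//.
  apply: (@le_trans _ _ (K * (e / (2 * K)))).
    by rewrite ler_pM2r//; rewrite /K; lra.
  by rewrite mulrC -[e / (2 * K) * K]mulrA invfM mulfVK ?gt_eqF.
lra.
Qed.

(** In logarithmic polar coordinates the circles about 0 become vertical segments of length [2 pi].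
    Goursat's theorem makes the mean over a circle independent of its radius, and small circles
    recover the value at 0. Mere continuity at 0 admits quotients such as [f z / z]. *)
Theorem maximum_principle (f : C -> C) (r rho M : R) : 0 < rho -> rho < r ->
  (forall z, normc z < r -> ccont f z) ->
  (forall z, z != 0 -> normc z < r -> exists a, cderiv f z a) ->
  (forall z, normc z = rho -> normc (f z) <= M) -> normc (f 0) <= M.
Proof.
move=> rho0 rhor cf df fM.
have r0 := lt_trans rho0 rhor.
have [->|f0] := eqVneq (f 0) 0.
  rewrite normc0; have := fM (rho%:C)%C; rewrite normc_real gtr0_norm// => /(_ erefl).
  by apply: le_trans; exact: normc_ge0.
have nf0 : 0 < normc (f 0) by rewrite normc_gt0.
(* A rotation making [c * f 0] real and equal to [normc (f 0)], so that bounding a real part is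
   enough. *)
pose c : C := conjc (f 0) / ((normc (f 0))%:C)%C.
have nc : normc c = 1.
  by rewrite normcM normcV normc_conj normc_real gtr0_norm// divff// gt_eqF.
have cf0 : c * f 0 = ((normc (f 0))%:C)%C.
  rewrite /c mulrAC [_ * f 0]mulrC mul_conjc rmorphXn /= expr2 mulfK//.
  by rewrite -normc_eq0 normc_real normr_eq0 gt_eqF.
pose g z := c * f z.
pose u x y := complex.Re (g (cexp x y)).
pose v x y := complex.Im (g (cexp x y)).
have Duv x y : x < ln r -> exists al be : R, forall e : R, 0 < e ->
  exists2 d : R, 0 < d & forall X Y : R, `|X - x| < d -> `|Y - y| < d ->
    `|u X Y - u x y - (al * (X - x) - be * (Y - y))| <= e * (`|X - x| + `|Y - y|) /\
    `|v X Y - v x y - (be * (X - x) + al * (Y - y))| <= e * (`|X - x| + `|Y - y|).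
  move=> xr.
  have [a Ha] : exists a, cderiv f (cexp x y) a.
    apply: df; first exact: cexp_neq0.
    by rewrite normc_cexp -[r]lnK ?posrE// ltr_expR.
  have Hg := cderivM (cderiv_cst c (cexp x y)) Ha.
  have {}Hg := polar_diff Hg.
  set b := (_ * cexp x y) in Hg.
  exists (complex.Re b), (complex.Im b) => e /Hg[d d0 H]; exists d => // X Y Xd Yd.
  have {}H := H X Y Xd Yd; rewrite -/(g _) -/(g _) in H.
  split; apply: le_trans H; rewrite ?/u ?/v -?Re_affine -?Im_affine.
    exact: le_Re_normc.
  exact: le_Im_normc.
have lr : ln rho < ln r by rewrite ltr_ln ?posrE.
have tp0 : 0 < pi *+ 2 :> R by rewrite mulrn_wgt0// pi_gt0.
(* The function [v] has period [2 pi] in its second argument, so the horizontal sides cancel. *)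
have U x : x <= ln rho -> itvint 0 (pi *+ 2) (u (ln rho)) = itvint 0 (pi *+ 2) (u x).
  move=> xr; have := goursat Duv xr (ltW tp0) lr.
  rewrite /rectint.
  rewrite [X in _ - (itvint _ _ X - _)](_ : _ = v^~ 0); last first.
    by apply/funext => t; rewrite /v /cexp cos2pi sin2pi cos0 sin0.
  by rewrite subrr subr0 => /eqP; rewrite subr_eq0 => /eqP.
have E1 : itvint 0 (pi *+ 2) (u (ln rho)) <= M * (pi *+ 2).
  have -> : M * (pi *+ 2) = itvint 0 (pi *+ 2) (fun=> M) by rewrite itvint_cst ?subr0// ltW.
  apply: itvint_le.
  - exact: (@rect_contu _ _ _ _ Duv _ _ _ lr).
  - exact: within_cst.
  move=> y _; rewrite /u /g; apply: (le_trans (ler_norm _)).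
  rewrite (le_trans (le_Re_normc _))// normcM nc mul1r; apply: fM.
  by rewrite normc_cexp lnK.
apply/ler_addgt0Pr => e e0.
have /ccontP/(_ e e0)/nbhs_normcP[d d0 Hd] : ccont f 0 by apply: cf; rewrite normc0.
pose x := ln (Num.min rho (d / 2)).
have m0 : 0 < Num.min rho (d / 2) by rewrite lt_min rho0 divr_gt0.
have xr : x <= ln rho by rewrite ler_ln ?posrE// ge_min lexx.
have xd : expR x < d.
  by rewrite lnK ?posrE// gt_min; apply/orP; right; lra.
have E2 : (normc (f 0) - e) * (pi *+ 2) <= itvint 0 (pi *+ 2) (u x).
  have -> : (normc (f 0) - e) * (pi *+ 2) = itvint 0 (pi *+ 2) (fun=> normc (f 0) - e).
    by rewrite itvint_cst ?subr0// ltW.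
  apply: itvint_le.
  - exact: within_cst.
  - exact: (@rect_contu _ _ _ _ Duv _ _ _ (le_lt_trans xr lr)).
  move=> y _; have /Hd H : normc (cexp x y - 0) < d by rewrite subr0 normc_cexp.
  have -> : u x y = normc (f 0) + complex.Re (c * (f (cexp x y) - f 0)).
    by rewrite /u /g mulrBr raddfB cf0 /= addrC subrK.
  rewrite lerD2l lerNl; apply: (le_trans (ler_norm _)); rewrite normrN.
  by rewrite (le_trans (le_Re_normc _))// normcM nc mul1r ltW.
move: E1; rewrite (U x xr) => /(le_trans E2); rewrite ler_pM2r//; lra.
Qed.

End MaximumPrinciple.

(** * The Bieberbach-Eilenberg inequality *)

Section CauchyDeterminant.

Lemma det_scale (F : comNzRingType) n (a b : 'I_n -> F) (B : 'M[F]_n) :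
  \det (\matrix_(i, j) (a i * B i j * b j)) = (\prod_i a i) * (\prod_j b j) * \det B.
Proof.
rewrite (_ : \matrix_(i, j) _ = diag_mx (\row_i a i) *m B *m diag_mx (\row_j b j)).
  rewrite !det_mulmx !det_diag mulrAC.
  by congr (_ * _ * _); apply: eq_bigr => i _; rewrite mxE.
by apply/matrixP => i j; rewrite mul_mx_diag mul_diag_mx !mxE.
Qed.

Lemma det_schur (F : fieldType) n (a : F) (r : 'rV[F]_n) (c : 'cV[F]_n) (D : 'M[F]_n) :
  a != 0 -> \det (block_mx a%:M r c D : 'M[F]_(1 + n)) = a * \det (D - a^-1 *: (c *m r)).
Proof.
move=> a0.
rewrite (_ : block_mx _ _ _ _ = block_mx 1%:M 0 (a^-1 *: c) 1%:M *m
    block_mx a%:M r 0 (D - a^-1 *: (c *m r))).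
  by rewrite det_mulmx det_lblock det_ublock !det1 !mul1r det_scalar1.
rewrite mulmx_block !mul1mx !mul0mx !addr0; congr block_mx.
  by rewrite mul_mx_scalar scalerA divff// scale1r.
by rewrite -scalemxAl addrC subrK.
Qed.

(** The Schur complement of the top left entry is again a Cauchy matrix in the remaining points,
    with each row and each column multiplied by a factor; induction follows. *)
Lemma cauchy_det (F : fieldType) n (x y : nat -> F) :
  (forall i j, (i < n)%N -> (j < n)%N -> 1 - x i * y j != 0) ->
  \det (\matrix_(i < n, j < n) (1 - x i * y j)^-1) *
    (\prod_(i < n) \prod_(j < n) (1 - x i * y j)) =
  \prod_(j < n) \prod_(i < j) ((x j - x i) * (y j - y i)).
Proof.
elim: n x y => [|n IH] x y nz; first by rewrite det_mx00 !big_ord0 mulr1.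
have nz00 := nz 0%N 0%N isT isT.
have nz0 j : (j < n)%N -> 1 - x 0%N * y j.+1 != 0 by move=> jn; exact: nz.
have nz1 i : (i < n)%N -> 1 - x i.+1 * y 0%N != 0 by move=> jn; exact: nz.
pose x' i := x i.+1; pose y' i := y i.+1.
have nz' i j : (i < n)%N -> (j < n)%N -> 1 - x' i * y' j != 0 by move=> ? ?; exact: nz.
set A := \matrix_(i, j) _.
pose r := \row_(j < n) (1 - x 0%N * y j.+1)^-1.
pose c := \col_(i < n) (1 - x i.+1 * y 0%N)^-1.
pose D := \matrix_(i < n, j < n) (1 - x' i * y' j)^-1.
have -> : A = block_mx (1 - x 0%N * y 0%N)^-1%:M r c D :> 'M[F]_(1 + n).
  apply/matrixP => i j; rewrite -(splitK i) -(splitK j).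
  case: (fintype.split i) => i'; case: (fintype.split j) => j' /=;
    rewrite ?block_mxEul ?block_mxEur ?block_mxEdl ?block_mxEdr !mxE /= ?ord1//=.
rewrite det_schur ?invr_eq0//.
have -> : D - (1 - x 0%N * y 0%N)^-1^-1 *: (c *m r) = \matrix_(i, j)
    (((x' i - x 0%N) / (1 - x' i * y 0%N)) * D i j * ((y' j - y 0%N) / (1 - x 0%N * y' j))).
  apply/matrixP => i j; rewrite !mxE big_ord1 !mxE /x' /y' invrK.
  have a1 := nz0 j (ltn_ord j); have a2 := nz1 i (ltn_ord i).
  have a3 := nz' i j (ltn_ord i) (ltn_ord j); rewrite /x' /y' in a3.
  by field; rewrite a1 a2 a3.
rewrite det_scale.
have E1 : \prod_(i < n.+1) \prod_(j < n.+1) (1 - x i * y j) =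
  (1 - x 0%N * y 0%N) * (\prod_(j < n) (1 - x 0%N * y' j)) *
  (\prod_(i < n) (1 - x' i * y 0%N)) * \prod_(i < n) \prod_(j < n) (1 - x' i * y' j).
  rewrite big_ord_recl /= big_ord_recl /= -!mulrA; congr (_ * (_ * _)).
  rewrite -big_split /=; apply: eq_bigr => i _.
  by rewrite big_ord_recl.
have E2 : \prod_(j < n.+1) \prod_(i < j) ((x j - x i) * (y j - y i)) =
  (\prod_(j < n) ((x' j - x 0%N) * (y' j - y 0%N))) *
  \prod_(j < n) \prod_(i < j) ((x' j - x' i) * (y' j - y' i)).
  rewrite big_ord_recl big_ord0 mul1r -big_split /=; apply: eq_bigr => j _.
  by rewrite big_ord_recl.
rewrite E1 E2 -IH// !big_split /= !prodfV.
have p1 : \prod_(j < n) (1 - x 0%N * y' j) != 0.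
  by apply/prodf_neq0 => j _; exact: nz0.
have p2 : \prod_(i < n) (1 - x' i * y 0%N) != 0.
  by apply/prodf_neq0 => j _; exact: nz1.
by rewrite -/D; field; rewrite p1 p2 nz00.
Qed.

End CauchyDeterminant.

(** * Leja points and the determinant proof of the Bieberbach-Eilenberg inequality *)

Section BieberbachEilenberg.
Context {R : realType}.
Local Notation C := R[i].

Lemma normc_det_le n (A : 'M[C]_n) (K : R) : (forall i j, normc (A i j) <= K) ->
  normc (\det A) <= n`!%:R * K ^+ n.
Proof.
move=> AK; rewrite /determinant (le_trans (le_normc_sum _ _ _))//.
rewrite (@le_trans _ _ (\sum_(s : {perm 'I_n}) K ^+ n))//.
  apply: ler_sum => s _; rewrite normcM normc_prod.
  rewrite (_ : normc ((-1) ^+ s) = 1); last by rewrite normcX normcN normc1 expr1n.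
  rewrite mul1r -[X in K ^+ X]card_ord -prodr_const; apply: ler_prod => i _.
  by rewrite normc_ge0 AK.
by rewrite sumr_const card_Sn mulr_natl.
Qed.

(* Leja points: each new point nearly maximises the product of the distances to
   the previous ones, which exceeds 1 by the maximum principle. *)
Lemma leja_points : exists w : nat -> C, forall k,
  normc (w k) = 1 /\ 1 / 2 <= \prod_(i < k) normc (w k - w i).
Proof.
have step (s : seq C) : exists z : C, (forall a, a \in s -> normc a = 1) ->
    normc z = 1 /\ 1 / 2 <= \prod_(a <- s) normc (z - a).
  have [s1|s1] := pselect (forall a, a \in s -> normc a = 1); last by exists 0.
  apply: contrapT => H.
  have {}H z : normc z = 1 -> \prod_(a <- s) normc (z - a) <= 1 / 2.
    move=> z1; rewrite leNgt; apply/negP => /ltW H1; apply: H; exists z => _; split => //.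
  (* The reversed polynomial: its value at 0 is 1, and on the unit circle its modulus equals that of
     the product of the [z - a], because [normc a = 1]. *)
  pose f (z : C) : C := \prod_(a <- s) (1 - z * conjc a).
  have df z : exists b, cderiv f z b.
    apply: cderiv_prod => a _; eexists.
    apply: cderivB; first exact: cderiv_cst.
    by apply: cderivM; [exact: cderiv_id|exact: cderiv_cst].
  have : normc (f 0) <= 1 / 2.
    apply: (@maximum_principle _ f 2 1) => //; rewrite ?ltr1n//.
      by move=> z _; have [b /cderiv_cont] := df z.
    move=> z z1; apply: le_trans (H z z1).
    rewrite normc_prod le_eqVlt; apply/orP; left; apply/eqP.
    rewrite [LHS]big_seq [RHS]big_seq; apply: eq_bigr => a /s1 a1.
    have aa : a * conjc a = 1 by rewrite mul_conjc a1 expr1n.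
    by rewrite -aa -mulrBl normcM normc_conj a1 mulr1 normcB.
  rewrite /f big1 ?normc1; last by move=> a _; rewrite mul0r subr0.
  by lra.
have [F HF] := choice step.
pose S := fix S n := if n is m.+1 then F (S m) :: S m else [::].
pose w n := F (S n).
have Sw n : \prod_(a <- S n) normc (w n - a) = \prod_(i < n) normc (w n - w i).
  rewrite -(big_mkord xpredT (fun i => normc (w n - w i))).
  elim: {1 3}n => [|k IH]; first by rewrite big_nil big_geq.
  by rewrite /= big_cons big_nat_recr //= IH mulrC.
have S1 n : forall a, a \in S n -> normc a = 1.
  elim: n => [//|n IH] a; rewrite /= in_cons => /orP[/eqP ->|/IH//].
  by have [] := HF (S n) IH.
by exists w => k; have [H1 H2] := HF (S k) (S1 k); rewrite -Sw.
Qed.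

(** Compactness of a product of two circles; it will bound the entries of the Cauchy matrix
    uniformly. *)
Lemma circle_pair_bound (f : C -> C -> R) (rho : R) : 0 < rho ->
  (forall a b, normc a = rho -> normc b = rho ->
     0 < f a b /\ forall e : R, 0 < e -> exists2 d : R, 0 < d & forall a' b',
       normc (a' - a) < d -> normc (b' - b) < d -> `|f a' b' - f a b| < e) ->
  exists2 dl : R, 0 < dl & forall a b, normc a = rho -> normc b = rho -> dl <= f a b.
Proof.
move=> rho0 Hf.
pose Z : set (R * R) := [set p | normc (Complex p.1 p.2) = rho].
have cC (p : R * R) : {for p, continuous (fun q : R * R => normc (Complex q.1 q.2))}.
  apply: (@cont_normc _ _ (fun q : R * R => Complex q.1 q.2)).
  by apply: ccont_ReIm; [exact: cvg_fst|exact: cvg_snd].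
have cZ : compact Z.
  apply: (@subclosed_compact _ _ (`[-rho, rho] `*` `[-rho, rho])).
  - have -> : Z = (fun q : R * R => normc (Complex q.1 q.2)) @^-1` [set rho] by [].
    by apply: preimage_closed => [p _|]; [exact: cC|exact: closed_eq].
  - by apply: compact_setX; exact: segment_compact.
  - move=> [a b]; rewrite /Z /= => ab; split => /=; rewrite in_itv /= -ler_norml -ab.
      exact: (le_Re_normc (Complex a b)).
    exact: (le_Im_normc (Complex a b)).
pose g (q : (R * R) * (R * R)) := f (Complex q.1.1 q.1.2) (Complex q.2.1 q.2.2).
have Z0 : Z (rho, 0) by have := normc_real rho; rewrite gtr0_norm.
have cg : {within Z `*` Z, continuous g}.
  apply: continuous_in_subspaceT => -[p q]; rewrite inE => -[/= Zp Zq].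
  apply/cvgrPdist_lt => e e0.
  have [_ /(_ e e0)[d d0 H]] := Hf _ _ Zp Zq.
  have cont (t : R * R) : ccont (fun q : R * R => Complex q.1 q.2) t.
    by apply: ccont_ReIm; [exact: cvg_fst|exact: cvg_snd].
  have /ccontP/(_ d d0) Np := cont p; have /ccontP/(_ d d0) Nq := cont q.
  exists ([set p' | normc (Complex p'.1 p'.2 - Complex p.1 p.2) < d],
          [set q' | normc (Complex q'.1 q'.2 - Complex q.1 q.2) < d]) => //.
  by move=> [p' q'] /= [? ?]; rewrite distrC; exact: H.
have [[p q]] := compact_EVT_min (ex_intro _ ((rho, 0), (rho, 0)) (conj Z0 Z0))
  (compact_setX cZ cZ) cg.
rewrite inE => -[/= Zp Zq] Hmin.
exists (g (p, q)); first by have [] := Hf _ _ Zp Zq.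
move=> [a1 a2] [b1 b2] na nb; apply: (Hmin ((a1, a2), (b1, b2))).
by rewrite inE.
Qed.

(** If [q > 1], Bernoulli's inequality applied to both factors of [q ^+ n * q ^+ n] yields quadratic
    growth, which beats any linear bound. *)
Lemma linear_power_bound (q K : R) : 0 <= q -> (forall n, q ^+ n <= K * n.+1%:R) -> q <= 1.
Proof.
move=> q0 H; rewrite leNgt; apply/negP => q1.
have d0 : 0 < q - 1 by rewrite subr_gt0.
have B n : n%:R * (q - 1) <= q ^+ n.
  elim: n => [|n IH]; first by rewrite mul0r.
  rewrite exprS -natr1 mulrDl mul1r.
  have q1n : 1 <= q ^+ n by rewrite exprn_ege1// ltW.
  nra.
have K0 : 0 < K by have := H 0%N; rewrite mulr1 expr0; lra.
pose n := (Num.truncn (3 * K / (q - 1) ^+ 2)).+1.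
have n1 : (1 : R) <= n%:R by rewrite ler1n.
have Hn : 3 * K < n%:R * (q - 1) ^+ 2.
  by rewrite -ltr_pdivrMr ?exprn_gt0//; exact: truncnS_gt.
have := H (n + n)%N; rewrite exprD => H1.
have H2 : (n%:R * (q - 1)) * (n%:R * (q - 1)) <= q ^+ n * q ^+ n.
  by apply: ler_pM => //; rewrite mulr_ge0// ltW.
have H3 : (n + n).+1%:R <= 3 * n%:R :> R by rewrite -natr1 natrD; lra.
have H4 : K * (n + n).+1%:R <= K * (3 * n%:R) by rewrite ler_pM2l.
have H5 : 3 * K * n%:R < n%:R * (q - 1) ^+ 2 * n%:R by rewrite ltr_pM2r//; lra.
move: H5; rewrite expr2; lra.
Qed.

(** For Leja points [w k], the Cauchy determinant of the values [m (z * w k)] is divisible by [z] to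
    the power [N (N - 1)]. At 0 the quotient is [A] to that power times a squared Vandermonde
    product, at least [4 ^- N] in modulus. On the circle of radius [rho] the determinant is at most
    [N! / dl ^ N]. The maximum principle compares the two, and the exponent [N (N - 1)] of
    [normc A * rho] outweighs the rest. *)
Theorem bieberbach_eilenberg (m : C -> C) (A : C) (r rho : R) : 0 < rho -> rho < r ->
  (forall z, normc z < r -> exists a, cderiv m z a) -> m 0 = 0 -> cderiv m 0 A ->
  (forall a b, normc a < r -> normc b < r -> m a * m b != 1) ->
  normc A * rho <= 1.
Proof.
move=> rho0 rhor dm m0 [phi [cphi phiA E]] BE.
have r0 := lt_trans rho0 rhor.
have cm z : normc z < r -> ccont m z by move=> /dm[a /cderiv_cont].
have [dl dl0 Hdl] : exists2 dl : R, 0 < dl & forall a b, normc a = rho -> normc b = rho ->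
    dl <= normc (1 - m a * m b).
  apply: (circle_pair_bound rho0) => a b na nb; split.
    by rewrite normc_gt0 subr_eq0 eq_sym BE ?na ?nb.
  move=> e e0.
  have ca : ccont m a by apply: cm; rewrite na.
  have cb : ccont m b by apply: cm; rewrite nb.
  have K0 : 0 < normc (m a) + normc (m b) + 1.
    by rewrite ltr_wpDl// addr_ge0 ?normc_ge0.
  pose e' := Num.min 1 (e / (normc (m a) + normc (m b) + 1)).
  have e'0 : 0 < e' by rewrite lt_min ltr01 divr_gt0.
  have /nbhs_normcP[d1 d10 H1] := (ccontP _ _).1 ca _ e'0.
  have /nbhs_normcP[d2 d20 H2] := (ccontP _ _).1 cb _ e'0.
  exists (Num.min d1 d2); first by rewrite lt_min d10 d20.
  move=> a' b'; rewrite !lt_min => /andP[/H1 Ha _] /andP[_ /H2 Hb].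
  apply: (@le_lt_trans _ _ (normc (m a' * m b' - m a * m b))).
    rewrite ler_norml; apply/andP; split.
      rewrite lerNl opprB lerBlDr.
      rewrite (_ : 1 - m a * m b = (m a' * m b' - m a * m b) + (1 - m a' * m b')); last by ring.
      exact: le_normcD.
    rewrite lerBlDr [normc (m a' * m b' - _)]normcB.
    rewrite (_ : 1 - m a' * m b' = (m a * m b - m a' * m b') + (1 - m a * m b)); last by ring.
    exact: le_normcD.
  rewrite (_ : _ - _ = (m a' - m a) * (m b' - m b) + (m a * (m b' - m b)
     + m b * (m a' - m a))); last by ring.
  rewrite (le_lt_trans (le_normcD _ _))// (le_lt_trans (lerD (lexx _) (le_normcD _ _)))//.
  rewrite !normcM.
  move: Ha Hb; rewrite /e' !lt_min => /andP[Ha1 Ha2] /andP[Hb1 Hb2].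
  move: Ha2 Hb2; rewrite !ltr_pdivlMr//.
  have := normc_ge0 (m a); have := normc_ge0 (m b).
  have := normc_ge0 (m a' - m a); have := normc_ge0 (m b' - m b).
  move: Ha1 Hb1; move: (normc (m a' - m a)) (normc (m b' - m b)) => p q.
  move: (normc (m a)) (normc (m b)) => x y.
  nra.
have phiE z : m z = phi z * z by have := E z; rewrite m0 !subr0.
have dphi z : z != 0 -> normc z < r -> exists a, cderiv phi z a.
  move=> z0 /dm[a Ha]; eexists.
  apply: (@cderiv_eq _ (fun y => m y * y^-1)); last first.
    by apply: cderivM Ha _; apply: cderivV => //; exact: cderiv_id.
  have := ccont_near_neq0 (ccont_id z) z0; apply: filterS => y y0.
  by rewrite phiE mulfK.
have cphi' z : normc z < r -> ccont phi z.
  have [->//|z0] := eqVneq z 0.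
  by move=> /(dphi z z0)[a /cderiv_cont].
have [w Hw] := leja_points.
have w1 k : normc (w k) = 1 by have [] := Hw k.
have nzw (z : C) k : normc (z * w k) = normc z by rewrite normcM w1 mulr1.
(* The divided difference of [m] between [z * w j] and [z * w i], written with the slope [phi] so
   that it makes sense at [z = 0]. *)
pose M i j z := phi (z * w j) * w j - phi (z * w i) * w i.
have ME i j z : z * M i j z = m (z * w j) - m (z * w i).
  by rewrite /M !phiE; ring.
(* The Cauchy determinant with its power of [z] removed, hence continuous at 0. *)
pose Psi N z := (\prod_(j < N) \prod_(i < j) (M i j z * M i j z)) *
  (\prod_(i < N) \prod_(j < N) (1 - m (z * w i) * m (z * w j)))^-1.
have nz z i j : normc z < r -> 1 - m (z * w i) * m (z * w j) != 0.
  by move=> zr; rewrite subr_eq0 eq_sym BE// nzw.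
have nzp N z : normc z < r ->
    \prod_(i < N) \prod_(j < N) (1 - m (z * w i) * m (z * w j)) != 0.
  by move=> zr; apply/prodf_neq0 => i _; apply/prodf_neq0 => j _; exact: nz.
have dlin k z : cderiv (fun z => z * w k) z (w k).
  by have := cderivM (cderiv_id z) (cderiv_cst (w k) z); rewrite mul1r mulr0 addr0.
pose T N := (\sum_(j < N) j)%N.
have bound N : (normc A * rho) ^+ (T N + T N) <= 4 ^+ N * (N`!%:R * dl^-1 ^+ N).
  have PsiM z : normc z = rho ->
      normc (Psi N z) <= (rho ^+ (T N + T N))^-1 * (N`!%:R * dl^-1 ^+ N).
    move=> zr; have zr' : normc z < r by rewrite zr.
    rewrite mulrC ler_pdivlMr ?exprn_gt0//.
    have -> : normc (Psi N z) * rho ^+ (T N + T N) = normc (Psi N z * z ^+ (T N + T N)).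
      by rewrite (normcM (Psi N z)) normcX zr.
    have -> : Psi N z * z ^+ (T N + T N) =
        \det (\matrix_(i < N, j < N) (1 - m (z * w i) * m (z * w j))^-1).
      rewrite -[RHS](mulfK (nzp N z zr')).
      rewrite (@cauchy_det _ N (fun i => m (z * w i)) (fun j => m (z * w j))); last first.
        by move=> i j _ _; exact: nz.
      rewrite /Psi mulrAC; congr (_ / _).
      rewrite exprD /T -!prodrXr -!big_split /=; apply: eq_bigr => j _.
      rewrite -[X in z ^+ X]card_ord -prodr_const -!big_split /=; apply: eq_bigr => i _.
      by rewrite -!ME; ring.
    apply: normc_det_le => i j; rewrite mxE normcV lef_pV2 ?posrE ?Hdl ?nzw//.
    by rewrite normc_gt0 nz.
  have : normc (Psi N 0) <= (rho ^+ (T N + T N))^-1 * (N`!%:R * dl^-1 ^+ N).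
    apply: (maximum_principle rho0 rhor) => // [z zr|z z0 zr].
      apply: ccontM.
        apply: ccont_prod => j _; apply: ccont_prod => i _.
        have cM : ccont (M i j) z.
          by apply: ccontB; apply: ccontM; try exact: ccont_cst;
            apply: (ccont_comp (cderiv_cont (dlin _ _))); apply: cphi'; rewrite nzw.
        exact: ccontM.
      apply: ccontV; first exact: nzp.
      apply: ccont_prod => j _; apply: ccont_prod => i _.
      apply: ccontB; first exact: ccont_cst.
      by apply: ccontM; apply: (ccont_comp (cderiv_cont (dlin _ _))); apply: cm; rewrite nzw.
    have [a Ha] : exists a, cderiv (fun z => \prod_(j < N) \prod_(i < j) (M i j z * M i j z)) z a.
      apply: cderiv_prod => j _; apply: cderiv_prod => i _.
      have zw k : z * w k != 0 by rewrite mulf_neq0// -normc_eq0 w1 oner_eq0.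
      have [b Hb] := dphi (z * w j) (zw j) (eq_ind_r (fun t => t < r) zr (nzw z j)).
      have [b' Hb'] := dphi (z * w i) (zw i) (eq_ind_r (fun t => t < r) zr (nzw z i)).
      have HM := cderivB (cderivM (cderiv_comp (dlin j z) Hb) (cderiv_cst (w j) z))
                         (cderivM (cderiv_comp (dlin i z) Hb') (cderiv_cst (w i) z)).
      by eexists; exact (cderivM HM HM).
    have [a' Ha'] : exists a, cderiv (fun z => \prod_(i < N) \prod_(j < N)
        (1 - m (z * w i) * m (z * w j))) z a.
      apply: cderiv_prod => i _; apply: cderiv_prod => j _.
      have [b Hb] := dm (z * w i) (eq_ind_r (fun t => t < r) zr (nzw z i)).
      have [b' Hb'] := dm (z * w j) (eq_ind_r (fun t => t < r) zr (nzw z j)).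
      eexists; apply: cderivB; first exact: cderiv_cst.
      exact: cderivM (cderiv_comp (dlin i z) Hb) (cderiv_comp (dlin j z) Hb').
    by eexists; exact: cderivM Ha (cderivV (nzp N z zr) Ha').
  rewrite mulrC ler_pdivlMr ?exprn_gt0// => H.
  have P0 : normc A ^+ (T N + T N) <= 4 ^+ N * normc (Psi N 0).
    rewrite /Psi.
    rewrite [X in X^-1]big1 ?invr1 ?mulr1; last first.
      by move=> i _; rewrite big1// => j _; rewrite !mul0r m0 mul0r subr0.
    rewrite normc_prod -[X in 4 ^+ X]card_ord -prodr_const exprD /T -!prodrXr -!big_split /=.
    apply: ler_prod => j _; rewrite mulr_ge0 ?exprn_ge0 ?normc_ge0//= normc_prod.
    have -> : \prod_(i < j) normc (M i j 0 * M i j 0) =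
        normc A ^+ j * normc A ^+ j * ((\prod_(i < j) normc (w j - w i)) ^+ 2).
      rewrite expr2 -{1 2}[X in normc A ^+ X]card_ord -!prodr_const -!big_split /=.
      apply: eq_bigr => i _; rewrite /M !mul0r phiA -mulrBr !normcM; ring.
    have [_ H2] := Hw j.
    rewrite mulrCA -{1}[_ * _]mulr1; apply: ler_wpM2l.
      by rewrite mulr_ge0// exprn_ge0// normc_ge0.
    by have : 1 / 4 <= (\prod_(i < j) normc (w j - w i)) ^+ 2; [nra|lra].
  rewrite exprMn; apply: (le_trans (ler_wpM2r _ P0)); first by rewrite exprn_ge0// ltW.
  by rewrite -mulrA ler_pM2l// exprn_gt0.
apply: (@linear_power_bound _ (4 / dl)); first by rewrite mulr_ge0 ?normc_ge0// ltW.
move=> n; have := bound n.+1.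
(* The exponent for [N = n.+1] is [n * n.+1]. Since [N! <= N ^ N], extracting an [N]-th root leaves
   a bound on the [n]-th power that is linear in [n.+1]. *)
have TE k : (T k.+1 + T k.+1)%N = (k * k.+1)%N.
  elim: k => [|k IH]; first by rewrite /T big_ord1.
  by rewrite /T big_ord_recr /= -/(T k.+1) addnACA IH; lia.
rewrite TE exprM => Hb.
have s1 : 0 <= normc A * rho by rewrite mulr_ge0 ?normc_ge0// ltW.
have s2 : 0 <= 4 / dl * n.+1%:R by rewrite mulr_ge0// divr_ge0// ltW.
rewrite -(@ler_pXn2r _ n.+1) ?nnegrE ?exprn_ge0//.
apply: (le_trans Hb); rewrite !exprMn -mulrA ler_pM2l ?exprn_gt0// mulrC.
rewrite ler_pM2l ?exprn_gt0 ?invr_gt0// -natrX ler_nat.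
elim: (n.+1) => [//|k IH]; rewrite factS expnS leq_mul//; case: k IH => // k IH.
by rewrite (leq_trans IH)// leq_exp2r// .
Qed.

End BieberbachEilenberg.

(** * Square roots on simply connected sets *)

Section SquareRoots.
Context {R : realType}.
Local Notation C := R[i].

(* The square root with positive real part on the right half-plane. *)
Definition psqrt (w : C) : C :=
  (w + ((normc w)%:C)%C) / ((Num.sqrt (2 * (normc w + complex.Re w)))%:C)%C.

Lemma psqrt_sqr (w : C) : 0 < complex.Re w -> psqrt w ^+ 2 = w.
Proof.
move=> w0; have S : 0 < normc w + complex.Re w by rewrite ltr_wpDl// normc_ge0.
have S2 : 0 < 2 * (normc w + complex.Re w) by rewrite mulr_gt0.
rewrite /psqrt expr_div_n -rmorphXn /= sqr_sqrtr ?ltW//.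
have nz : ((2 * (normc w + complex.Re w))%:C)%C != 0 :> C.
  by rewrite -normc_eq0 normc_real normr_eq0 gt_eqF.
apply: (mulIf nz); rewrite divfK// sqrrD -rmorphXn /= -mul_conjc.
have -> : ((2 * (normc w + complex.Re w))%:C)%C =
    2 * (((normc w)%:C)%C + ((complex.Re w)%:C)%C) :> C.
  by rewrite rmorphM (rmorph_nat _ 2) rmorphD.
have -> : ((complex.Re w)%:C)%C = (w + conjc w) / 2 :> C by rewrite ReJ_add.
by field.
Qed.

Lemma psqrt_Re_gt0 (w : C) : 0 < complex.Re w -> 0 < complex.Re (psqrt w).
Proof.
move=> w0; have S : 0 < normc w + complex.Re w by rewrite ltr_wpDl// normc_ge0.
have S2 : 0 < 2 * (normc w + complex.Re w) by rewrite mulr_gt0.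
rewrite /psqrt -fmorphV Re_complexM /= mulr0 subr0 mulr_gt0 ?invr_gt0 ?sqrtr_gt0//.
by rewrite raddfD /= addrC.
Qed.

Lemma psqrt_unique (w x : C) : 0 < complex.Re w -> 0 < complex.Re x -> x ^+ 2 = w ->
  x = psqrt w.
Proof.
move=> w0 x0 xw; have := psqrt_sqr w0; rewrite -{2}xw => /eqP.
rewrite eq_sym eqf_sqr => /orP[/eqP//|/eqP xE].
by have := psqrt_Re_gt0 w0; move: x0; rewrite xE raddfN /= oppr_gt0 => /lt_trans H /H; rewrite ltxx.
Qed.

Lemma psqrt_cont (w : C) : 0 < complex.Re w -> ccont psqrt w.
Proof.
move=> w0; have S : 0 < normc w + complex.Re w by rewrite ltr_wpDl// normc_ge0.
have S2 : 0 < 2 * (normc w + complex.Re w) by rewrite mulr_gt0.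
have cn := cont_normc (ccont_id w); have cr := cont_Re (ccont_id w).
apply: ccontM; first by apply: ccontD; [exact: ccont_id|exact: ccont_real].
apply: ccontV.
  by rewrite -normc_eq0 normc_real normr_eq0 gt_eqF// sqrtr_gt0.
apply: ccont_real; apply: (@continuous_comp _ _ _ (fun w : C => 2 * (normc w + complex.Re w)) Num.sqrt).
  by apply: continuousM; [exact: cst_continuous|exact: continuousD].
exact: sqrt_continuous.
Qed.

Lemma Re_gt0_near1 (w : C) : normc (w - 1) < 1 -> 0 < complex.Re w.
Proof.
move=> w1; have : `|complex.Re (w - 1)| < 1 by apply: le_lt_trans w1; exact: le_Re_normc.
by rewrite raddfB /= ltr_norml => /andP[]; lra.
Qed.

Lemma Re_ratio (x y : C) : normc (x - y) < normc y -> 0 < complex.Re (x / y).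
Proof.
move=> xy; have y0 : 0 < normc y by apply: le_lt_trans xy; exact: normc_ge0.
have y0' : y != 0 by rewrite -normc_gt0.
apply: Re_gt0_near1; rewrite (_ : _ - 1 = (x - y) / y); last by field.
by rewrite normcM normcV ltr_pdivrMr// mul1r.
Qed.

(** Composing with this retraction onto the unit interval turns continuity within the interval into
    continuity on the whole line. *)
Definition clamp (t : R) : R := Num.max 0 (Num.min 1 t).

Lemma clamp_itv t : 0 <= clamp t <= 1.
Proof. by rewrite /clamp le_max lexx /= ge_max ler01 ge_min lexx. Qed.

Lemma clamp_id t : 0 <= t <= 1 -> clamp t = t.
Proof. by move=> /andP[t0 t1]; rewrite /clamp min_r// max_r. Qed.

Lemma clamp_le0 t : t <= 0 -> clamp t = 0.
Proof. by move=> t0; rewrite /clamp max_l// ge_min t0 orbT. Qed.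

Lemma clamp_ge1 t : 1 <= t -> clamp t = 1.
Proof. by move=> t0; rewrite /clamp min_l// max_r. Qed.

Lemma clamp_cont : continuous clamp.
Proof.
move=> t; apply/cvgrPdist_lt => e e0.
have /cvgrPdist_lt/(_ e e0) : (fun x : R => x) @ t --> t by [].
apply: filterS => s; apply: le_lt_trans; rewrite /clamp !maxEle !minEle.
by do ![case: ifPn]; rewrite -?ltNge => *; rewrite ler_norml ?subrr;
  have := ler_norm (t - s); have := ler_norm (s - t); rewrite (distrC s) => *;
  apply/andP; split; lra.
Qed.

Lemma pair_cont (S T U : topologicalType) (f : S -> T) (g : S -> U) x :
  {for x, continuous f} -> {for x, continuous g} -> {for x, continuous (fun y => (f y, g y))}.
Proof. by move=> cf cg; exact: cvg_pair cf cg. Qed.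

Lemma within_comp (S T U : topologicalType) (A : set T) (c : S -> T) (f : T -> U) :
  {within A, continuous f} -> continuous c -> (forall x, A (c x)) ->
  continuous (fun x => f (c x)).
Proof.
move=> /subspace_continuousP cf cc cA x B /= nB.
have H : within A (nbhs (c x)) (f @^-1` B) := cf _ (cA x) B nB.
by apply: (@filterS _ (nbhs x) _ _ _ _ (cc x _ H)) => y; exact.
Qed.

(** Along the segment from the origin to a point, divided into sufficiently many pieces, successive
    values of [H] have ratios in the right half-plane. The principal roots of these ratios multiply
    to a root of the telescoping product. *)
Lemma square_sqrt (H : R * R -> C) :
  (forall p, ccont H p) -> (forall p, H p != 0) ->
  exists s : R * R -> C, (forall p, ccont s p) /\
    forall x y, 0 <= x <= 1 -> 0 <= y <= 1 -> s (x, y) ^+ 2 = H (x, y).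
Proof.
move=> cH H0.
pose Q : set (R * R) := `[0, 1] `*` `[0, 1].
have cQ : compact Q by apply: compact_setX; exact: segment_compact.
have [d d0 Hd] : exists2 d : R, 0 < d & forall p q : R * R, Q p ->
    `|q.1 - p.1| < d -> `|q.2 - p.2| < d -> normc (H q - H p) < normc (H p).
  have /compact_near_coveringP cov := cQ.
  have := cov R (at_right 0) (fun d p => forall q : R * R,
    `|q.1 - p.1| < d -> `|q.2 - p.2| < d -> normc (H q - H p) < normc (H p)).
  case=> [p Qp|e /= e0 He].
    have e0 : 0 < normc (H p) / 4 by rewrite divr_gt0// normc_gt0.
    have /ccontP/(_ _ e0)/nbhs_ballP[r /= r0 Hr] := cH p.
    have r20 : 0 < r / 2 by rewrite divr_gt0.
    exists (ball p (r / 2), [set d | d < r / 2]) => /=.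
      by split; [exact: nbhsx_ballx|exact: nbhs_right_lt].
    move=> [p' d] [/= [p1 p2] dr] q q1 q2.
    have Hp' := Hr p' _; have Hq := Hr q _.
    have {}Hp' : normc (H p' - H p) < normc (H p) / 4.
      by apply: Hp'; split; [apply: le_ball p1|apply: le_ball p2]; lra.
    have {}Hq : normc (H q - H p) < normc (H p) / 4.
      apply: Hq; split; rewrite /ball /=.
        move: p1; rewrite /ball /= => p1.
        rewrite (_ : p.1 - q.1 = (p.1 - p'.1) - (q.1 - p'.1)); last by ring.
        by rewrite (le_lt_trans (ler_normB _ _))//; lra.
      move: p2; rewrite /ball /= => p2.
      rewrite (_ : p.2 - q.2 = (p.2 - p'.2) - (q.2 - p'.2)); last by ring.
      by rewrite (le_lt_trans (ler_normB _ _))//; lra.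
    have E1 : normc (H q - H p') <= normc (H q - H p) + normc (H p' - H p).
      rewrite (_ : H q - H p' = (H q - H p) - (H p' - H p)); last by ring.
      exact: le_normcB.
    have E2 : normc (H p) <= normc (H p' - H p) + normc (H p').
      by rewrite -{1}(subrK (H p') (H p)) (normcB (H p')) le_normcD.
    lra.
  exists (e / 2); first by rewrite divr_gt0.
  move=> p q Qp; apply: (He (e / 2)) => //=.
  - by rewrite sub0r normrN gtr0_norm ?divr_gt0//; lra.
  - by rewrite divr_gt0.
(* Steps of length at most [1 / N < d] in each coordinate are covered by the uniform estimate
   [Hd]. *)
pose N := (Num.truncn d^-1).+1.
have N0 : (0 : R) < N%:R by rewrite ltr0n.
have Nd : N%:R^-1 < d by rewrite invf_plt ?posrE//; exact: truncnS_gt.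
pose pt k (p : R * R) : R * R := (k%:R / N%:R * clamp p.1, k%:R / N%:R * clamp p.2).
have cpt k p : {for p, continuous (pt k)}.
  have c1 (f : R * R -> R) : {for p, continuous f} ->
      {for p, continuous (fun p => k%:R / N%:R * clamp (f p))}.
    move=> cf; apply: continuousM; first exact: cst_continuous.
    by apply: (@continuous_comp _ _ _ f clamp); [exact: cf|exact: clamp_cont].
  by apply: pair_cont; apply: c1; [exact: cvg_fst|exact: cvg_snd].
have Qpt k p : (k <= N)%N -> Q (pt k p).
  move=> kN; have kN1 : 0 <= (k%:R / N%:R : R) <= 1.
    by rewrite divr_ge0//= ler_pdivrMr// mul1r ler_nat.
  have /andP[k0 k1] := kN1.
  have := clamp_itv p.1; have := clamp_itv p.2 => /andP[? ?] /andP[? ?].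
  by split; rewrite /= in_itv /= mulr_ge0//= mulr_ile1.
have ratio k p : (k < N)%N -> 0 < complex.Re (H (pt k.+1 p) / H (pt k p)).
  move=> kN; apply: Re_ratio; apply: Hd; first exact/Qpt/ltnW.
    rewrite /pt /= -mulrBl -mulrBl -natrB// subSnn mul1r normrM.
    rewrite gtr0_norm ?invr_gt0//; have /andP[c0 c1] := clamp_itv p.1.
    by rewrite ger0_norm// (le_lt_trans _ Nd)// ler_piMr ?invr_ge0// ltW.
  rewrite /pt /= -mulrBl -mulrBl -natrB// subSnn mul1r normrM.
  rewrite gtr0_norm ?invr_gt0//; have /andP[c0 c1] := clamp_itv p.2.
  by rewrite ger0_norm// (le_lt_trans _ Nd)// ler_piMr ?invr_ge0// ltW.
exists (fun p => sqrtC (H (0, 0)) * \prod_(k < N) psqrt (H (pt k.+1 p) / H (pt k p))); split.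
  move=> p; apply: ccontM; first exact: ccont_cst.
  apply: ccont_prod => k _.
  apply: (@ccont_comp _ _ psqrt (fun p => H (pt k.+1 p) / H (pt k p))); last first.
    exact/psqrt_cont/ratio.
  apply: ccontM; first exact: (ccont_precomp (cpt _ _)).
  by apply: ccontV => //; exact: (ccont_precomp (cpt _ _)).
move=> x y x01 y01.
rewrite exprMn sqrtCK -prodrXl.
under eq_bigr => k _ do rewrite psqrt_sqr ?ratio//.
have -> : \prod_(k < N) (H (pt k.+1 (x, y)) / H (pt k (x, y))) =
    H (pt N (x, y)) / H (pt 0%N (x, y)).
  elim: (N) => [|k IH]; first by rewrite big_ord0 divff.
  by rewrite big_ord_recr /= IH mulrC mulrA divfK.
rewrite /pt /= !mul0r mulrC divfK// divff ?gt_eqF// !mul1r.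
by rewrite !clamp_id.
Qed.

(** For [c != 0] the quotient [u t / u 0] takes only the values 1 and -1, and the intermediate value
    theorem forbids a change of sign. *)
Lemma const_sqrt (u : R -> C) (c : C) : (forall t, ccont u t) ->
  (forall t, 0 <= t <= 1 -> u t ^+ 2 = c) -> u 0 = u 1.
Proof.
move=> cu uc.
have u0 : u 0 ^+ 2 = c by apply: uc; rewrite lexx ler01.
have [c0|c0] := eqVneq c 0.
  have u1 : u 1 ^+ 2 = c by apply: uc; rewrite lexx ler01.
  by move/eqP: u0; move/eqP: u1; rewrite c0 !sqrf_eq0 => /eqP -> /eqP ->.
have u00 : u 0 != 0 by rewrite -sqrf_eq0 u0.
pose v t := complex.Re (u t / u 0).
have vpm t : 0 <= t <= 1 -> u t = u 0 \/ u t = - u 0.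
  move=> /uc ut; have /eqP : u t ^+ 2 = u 0 ^+ 2 by rewrite ut u0.
  by rewrite eqf_sqr => /orP[/eqP|/eqP]; [left|right].
have [->//|u1] : u 1 = u 0 \/ u 1 = - u 0 by apply: vpm; rewrite lexx ler01.
have v0 : v 0 = 1 by rewrite /v divff.
have v1 : v 1 = -1 by rewrite /v u1 mulNr divff.
have cv : {within `[0, 1], continuous v}.
  apply: continuous_within => t _; apply: cont_Re; apply: ccontM => //.
  exact: ccont_cst.
have [|c' c'01 vc] := @IVT R v 0 1 0 ler01 cv.
  by rewrite v0 v1 ge_min le_max !ler01 oppr_le0 ler01 orbT.
exfalso; move: c'01; rewrite in_itv /= => /vpm[] E; move: vc; rewrite /v E ?mulNr divff//=.
  by move=> /eqP; rewrite oner_eq0.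
by move=> /eqP; rewrite oppr_eq0 oner_eq0.
Qed.

(* Continuation of the square root [al] of [K a] along a path in [A] from [a] to [b]. *)
Definition klift (A : set C) (K : C -> C) (a al b be : C) : Prop :=
  exists g s : R -> C, [/\ (forall t, ccont g t), (forall t, A (g t)), (forall t, ccont s t),
    (forall t, s t ^+ 2 = K (g t)) & [/\ g 0 = a, s 0 = al, g 1 = b & s 1 = be]].

(** * Continuation of square roots along paths, monodromy and dependence on parameters *)

Section Lifts.
Variables (A : set C) (K : C -> C).
Hypothesis cK : forall a, A a -> ccont K a.
Hypothesis K0 : forall a, A a -> K a != 0.

Lemma klift_sym a al b be : klift A K a al b be -> klift A K b be a al.
Proof.
move=> [g [s [cg Ag cs sK [g0 s0 g1 s1]]]].
have c1 t : {for t, continuous (fun t : R => 1 - t)}.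
  by apply: continuousB; [exact: cst_continuous|].
exists (fun t => g (1 - t)), (fun t => s (1 - t)); split => [t|t|t|t|].
- exact: ccont_precomp (c1 t) (cg _).
- exact: Ag.
- exact: ccont_precomp (c1 t) (cs _).
- exact: sK.
- by rewrite subr0 subrr.
Qed.

Lemma klift_trans a al b be c ga :
  klift A K a al b be -> klift A K b be c ga -> klift A K a al c ga.
Proof.
move=> [g [s [cg Ag cs sK [g0 s0 g1 s1]]]] [g' [s' [cg' Ag' cs' sK' [g0' s0' g1' s1']]]].
pose h t := clamp (2 * t); pose h' t := clamp (2 * t - 1).
have ch t : {for t, continuous h}.
  apply: (@continuous_comp _ _ _ (fun t : R => 2 * t) clamp); last exact: clamp_cont.
  by apply: continuousM; [exact: cst_continuous|].
have ch' t : {for t, continuous h'}.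
  apply: (@continuous_comp _ _ _ (fun t : R => 2 * t - 1) clamp); last exact: clamp_cont.
  apply: continuousB; last exact: cst_continuous.
  by apply: continuousM; [exact: cst_continuous|].
(* At each time one of the two clamped runs rests at the common endpoint, so their sum minus that
   endpoint is the concatenation, and its continuity is that of a sum. *)
have cat (p q : R -> C) (x : C) : p 1 = x -> q 0 = x -> forall t,
    p (h t) + q (h' t) - x = if t <= 2^-1 then p (h t) else q (h' t).
  move=> px qx t; case: ifPn => [t2|]; last rewrite -ltNge => t2.
    by rewrite /h' clamp_le0 ?qx ?addrK//; lra.
  by rewrite /h clamp_ge1 ?px; [ring|lra].
exists (fun t => g (h t) + g' (h' t) - b), (fun t => s (h t) + s' (h' t) - be).
have h0 : h 0 = 0 by rewrite /h mulr0 clamp_le0.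
have h1 : h 1 = 1 by rewrite /h mulr1 clamp_ge1//; lra.
have h0' : h' 0 = 0 by rewrite /h' clamp_le0//; lra.
have h1' : h' 1 = 1 by rewrite /h' clamp_ge1//; lra.
split => [t|t|t|t|].
- apply: ccontB; last exact: ccont_cst.
  by apply: ccontD; [exact: ccont_precomp (ch t) (cg _)|exact: ccont_precomp (ch' t) (cg' _)].
- by rewrite cat//; case: ifP.
- apply: ccontB; last exact: ccont_cst.
  by apply: ccontD; [exact: ccont_precomp (ch t) (cs _)|exact: ccont_precomp (ch' t) (cs' _)].
- by rewrite !cat//; case: ifP.
- rewrite h0 h1 h0' h1' g0 s0 g0' s0' g1 s1 g1' s1'; split; ring.
Qed.

Lemma klift_ex (g : R -> C) al : (forall t, ccont g t) -> (forall t, A (g t)) ->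
  al ^+ 2 = K (g 0) -> exists be, klift A K (g 0) al (g 1) be.
Proof.
move=> cg Ag alK.
pose H (p : R * R) := K (g (clamp p.2)).
have cH p : ccont H p.
  have cc : {for p, continuous (fun p : R * R => clamp p.2)}.
    apply: (@continuous_comp _ _ _ (fun p : R * R => p.2) clamp); last exact: clamp_cont.
    exact: cvg_snd.
  apply: (@ccont_comp _ _ K (fun p : R * R => g (clamp p.2))); last exact: cK.
  exact: ccont_precomp cc (cg _).
have [|s [cs sH]] := square_sqrt cH; first by move=> p; exact: K0.
pose s' t := s (0, clamp t).
have s'K t : s' t ^+ 2 = K (g (clamp t)).
  by rewrite sH ?lexx ?ler01 ?clamp_itv// /H /= (clamp_id (clamp_itv t)).
have cs' t : ccont s' t.
  apply: (ccont_precomp (g := fun t => (0, clamp t))); last exact: cs.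
  by apply: pair_cont; [exact: cst_continuous|exact: clamp_cont].
have c0 : clamp 0 = 0 by apply: clamp_le0.
have c1 : clamp 1 = 1 by apply: clamp_ge1.
(* The root found on the square may start at [- al]; the sign [b] corrects this. *)
have [b bE] : exists b : C, b ^+ 2 = 1 /\ b * s' 0 = al.
  have := s'K 0; rewrite c0 -alK => /eqP; rewrite eqf_sqr => /orP[/eqP E|/eqP E].
    by exists 1; rewrite expr1n mul1r.
  by exists (-1); rewrite sqrrN expr1n E mulN1r opprK.
exists (b * s' 1), (fun t => g (clamp t)), (fun t => b * s' t); split => [t|t|t|t|].
- exact: ccont_precomp (@clamp_cont t) (cg _).
- exact: Ag.
- by apply: ccontM => //; exact: ccont_cst.
- by rewrite exprMn bE.1 mul1r s'K.
- by rewrite c0 c1 bE.2.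
Qed.

(** Monodromy: a root [S] of [K] exists on the whole homotopy square. The homotopy is constant on
    three sides, so [S] agrees at the two ends of the fourth, where it differs from [s] by a
    constant sign. *)
Lemma klift_loop a al be : simply_connected R A -> klift A K a al a be -> al = be.
Proof.
move=> [_ sc] [g [s [cg Ag cs sK [g0 s0 g1 s1]]]].
have gp : path_in A g.
  split; last by move=> t _; exact: Ag.
  by apply: continuous_within => t _; apply/ccontE.
have [|H [cH AH H0 H1 Hs]] := sc g gp; first by rewrite g0 g1.
pose cl (p : R * R) := (clamp p.1, clamp p.2).
have ccl p : {for p, continuous cl}.
  apply: pair_cont.
    apply: (@continuous_comp _ _ _ (fun p : R * R => p.1) clamp); last exact: clamp_cont.
    exact: cvg_fst.
  apply: (@continuous_comp _ _ _ (fun p : R * R => p.2) clamp); last exact: clamp_cont.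
  exact: cvg_snd.
have clQ p : (`[0, 1] `*` `[0, 1]) (cl p) by split; rewrite /= in_itv /= clamp_itv.
have cHc := within_comp cH ccl clQ.
have AHc p : A (H (cl p)).
  by have [c1 c2] := clQ p; apply: AH.
have cKH p : ccont (fun p => K (H (cl p))) p.
  by apply: ccont_comp; [apply/ccontE; exact: cHc|exact: cK].
have [|S [cS SH]] := square_sqrt cKH; first by move=> p; exact: K0.
have i0 : 0 <= (0 : R) <= 1 by rewrite lexx ler01.
have i1 : 0 <= (1 : R) <= 1 by rewrite lexx ler01.
have ch x y : {for y, continuous (fun y : R => (x, y) : R * R)}.
  by apply: pair_cont; [exact: cst_continuous|].
have cv x y : {for x, continuous (fun x : R => (x, y) : R * R)}.
  by apply: pair_cont; [|exact: cst_continuous].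
have Sx x y : 0 <= x <= 1 -> 0 <= y <= 1 -> S (x, y) ^+ 2 = K (H (x, y)).
  by move=> x01 y01; rewrite SH// /cl /= !clamp_id.
have E0 : S (0, 0) = S (1, 0).
  apply: (@const_sqrt (fun x => S (x, 0)) (K (g 0))) => t.
    exact: (ccont_precomp (cv t 0) (cS _)).
  by move=> t01; rewrite Sx// (Hs t _).1// in_itv.
have E1 : S (0, 1) = S (1, 1).
  apply: (@const_sqrt (fun x => S (x, 1)) (K (g 0))) => t.
    exact: (ccont_precomp (cv t 1) (cS _)).
  by move=> t01; rewrite Sx// (Hs t _).2// in_itv.
have E2 : S (1, 0) = S (1, 1).
  apply: (@const_sqrt (fun y => S (1, y)) (K (g 0))) => t.
    exact: (ccont_precomp (ch 1 t) (cS _)).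
  by move=> t01; rewrite Sx// H1// in_itv.
have S00 : S (0, 0) = S (0, 1) by rewrite E0 E1.
have S0n y : 0 <= y <= 1 -> S (0, y) != 0.
  by move=> y01; rewrite -sqrf_eq0 Sx// H0 ?in_itv// K0.
have S0t (t : R) : 0 <= t <= 1 -> S (0, t) ^+ 2 = K (g t).
  by move=> t01; rewrite Sx// H0// in_itv.
have : s (clamp 0) / S (0, clamp 0) = s (clamp 1) / S (0, clamp 1).
  apply: (@const_sqrt (fun t => s (clamp t) / S (0, clamp t)) 1) => t.
    apply: ccontM; first exact: ccont_precomp (@clamp_cont t) (cs _).
    apply: ccontV; first exact/S0n/clamp_itv.
    apply: (ccont_precomp (g := clamp) (f := fun y => S (0, y))); first exact: clamp_cont.
    exact: (ccont_precomp (ch 0 _) (cS _)).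
  by move=> _; rewrite expr_div_n S0t ?clamp_itv// sK divff// K0.
rewrite clamp_le0// clamp_ge1// s0 s1 S00 => /(mulIf _); apply.
by rewrite invr_eq0 S0n.
Qed.

Lemma simply_connected_path a b : simply_connected R A -> A a -> A b ->
  exists g : R -> C, [/\ forall t, ccont g t, forall t, A (g t), g 0 = a & g 1 = b].
Proof.
move=> [[_ pc] _] Aa Ab; have [g [[cg Ag] g0 g1]] := pc a b Aa Ab.
exists (fun t => g (clamp t)); split => [t|t||]; last 2 first.
- by rewrite clamp_le0.
- by rewrite clamp_ge1.
- apply/ccontE; apply: (within_comp cg clamp_cont) => x.
  by rewrite /= in_itv /= clamp_itv.
- by apply: Ag; rewrite in_itv /= clamp_itv.
Qed.

End Lifts.

(** Transfers simple connectivity from a slice of a set of row vectors to the set of its complex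
    parameters; [j] is a continuous left inverse of the parametrisation. *)
Lemma simply_connected_retract (T : topologicalType) (i : C -> T) (j : T -> C)
    (A : set C) (B : set T) : continuous i -> continuous j -> (forall u, j (i u) = u) ->
  (forall u, A u -> B (i u)) -> (forall x, B x -> A (j x)) ->
  simply_connected R B -> simply_connected R A.
Proof.
move=> ci cj ji AB BA [[[x0 Bx0] pc] nh]; split; first split.
- by exists (j x0); exact: BA.
- move=> x y Ax Ay; have [g [[cg Bg] g0 g1]] := pc _ _ (AB _ Ax) (AB _ Ay).
  exists (fun t => j (g t)); split; last 2 first.
  + by rewrite g0.
  + by rewrite g1.
  split; last by move=> t /Bg /BA.
  by move=> t; apply: continuous_comp; [exact: cg|exact: cj].
move=> g [cg Ag] g01.
have [||H [cH BH H0 H1 Hs]] := nh (fun t => i (g t)); last 1 first.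
- exists (fun p => j (H p)); split.
  + by move=> p; apply: continuous_comp; [exact: cH|exact: cj].
  + by move=> s t s01 t01; apply: BA; exact: BH.
  + by move=> t /H0 ->.
  + by move=> t /H1 ->.
  + by move=> s /Hs[-> ->].
- split; last by move=> t /Ag /AB.
  by move=> t; apply: continuous_comp; [exact: cg|exact: ci].
- by rewrite g01.
Qed.

(** Serves lines with zero direction, whose parameter set is the whole plane. Loops are contracted
    by the straight-line homotopy. *)
Lemma simply_connectedT : simply_connected R [set: C].
Proof.
split; first split; first by exists 0.
  move=> x y _ _; exists (fun t => x + (t%:C)%C * (y - x)); split; last 2 first.
  - by rewrite mul0r addr0.
  - by rewrite mul1r addrC subrK.
  split => // ; apply: continuous_within => t _; apply/ccontE.
  apply: ccontD; first exact: ccont_cst.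
  by apply: ccontM; [exact: ccont_real|exact: ccont_cst].
move=> g [cg _] g01.
have clA (t : R) : `[0, 1]%classic (clamp t) by rewrite /= in_itv /= clamp_itv.
have cg' := within_comp cg clamp_cont clA.
exists (fun p => g (clamp p.2) + (p.1%:C)%C * (g 0 - g (clamp p.2))); split.
- move=> p; apply: continuous_subspaceT => {}p; apply/ccontE.
  have cgp : ccont (fun p : R * R => g (clamp p.2)) p.
    apply: (@ccont_precomp _ _ _ (fun t => g (clamp t)) (fun p : R * R => p.2)).
      exact: cvg_snd.
    by apply/ccontE; exact: cg'.
  apply: ccontD => //; apply: ccontM; first by apply: ccont_real; exact: cvg_fst.
  by apply: ccontB => //; exact: ccont_cst.
- by [].
- by move=> t; rewrite in_itv /= => t01; rewrite mul0r addr0 clamp_id.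
- by move=> t _; rewrite mul1r addrC subrK.
- by move=> s _; rewrite /= clamp_le0// clamp_ge1// -g01 subrr mulr0 addr0.
Qed.

(* Analytic continuation of a square root from [a p] to [b p] inside the fibre [A p],
   depending continuously on the parameter [p]. *)
Lemma family_sqrt (P : topologicalType) (U : set P) (A : P -> set C) (K : P -> C -> C)
    (a b rt : P -> C) :
  (forall p, U p -> \forall q \near p, U q) ->
  (forall p, U p -> simply_connected R (A p)) ->
  (forall p u, U p -> A p u -> \forall q \near (p, u), A q.1 q.2) ->
  (forall p u, U p -> A p u -> ccont (fun q : P * C => K q.1 q.2) (p, u)) ->
  (forall p u, U p -> A p u -> K p u != 0) ->
  (forall p, U p -> [/\ ccont a p, ccont b p, ccont rt p, A p (a p) & A p (b p)]) ->
  (forall p, U p -> rt p ^+ 2 = K p (a p)) ->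
  exists S : P -> C, forall p, U p -> ccont S p /\ S p ^+ 2 = K p (b p).
Proof.
move=> oU scA oA cK K0 Hab rtK.
have cKp p u : U p -> A p u -> ccont (K p) u.
  move=> Up Apu; apply: (ccont_precomp (g := fun u => (p, u)) (f := fun q => K q.1 q.2)).
    by apply: pair_cont; [exact: cst_continuous|].
  exact: cK.
have ex p : exists s, U p -> klift (A p) (K p) (a p) (rt p) (b p) s.
  have [Up|nU] := pselect (U p); last by exists 0.
  have [_ _ _ Aa Ab] := Hab p Up.
  have [g [cg Ag g0 g1]] := simply_connected_path (scA p Up) Aa Ab.
  have [|||be Hbe] := @klift_ex (A p) (K p) _ _ g (rt p) cg Ag.
  - by move=> u; exact: cKp.
  - by move=> u; exact: K0.
  - by rewrite g0 rtK.
  by exists be => _; rewrite -g0 -g1.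
have [S HS] := choice ex.
exists S => p Up.
have [g [s [cg Ag cs sK [g0 s0 g1 s1]]]] := HS p Up.
split; last by rewrite -s1 sK g1.
have [ca cb crt Aa Ab] := Hab p Up.
(* The path [g] in the fibre of [p], corrected linearly in time so that for the parameter [q] it
   runs from [a q] to [b q]. *)
pose G (q : P) (t : R) : C := g (clamp t) + ((1 - clamp t)%:C)%C * (a q - a p)
   + ((clamp t)%:C)%C * (b q - b p).
have Gp t : G p t = g (clamp t) by rewrite /G !subrr !mulr0 !addr0.
have cG t : ccont (fun x : R * P => G x.2 x.1) (t, p).
  have c1 (x : R * P) : {for x, continuous (fun x : R * P => clamp x.1)}.
    by apply: (@continuous_comp _ _ _ (fun x : R * P => x.1) clamp); [exact: cvg_fst|exact: clamp_cont].
  have c2 (f : P -> C) : ccont f p -> ccont (fun x : R * P => f x.2) (t, p).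
    by move=> cf; apply: (ccont_precomp (g := fun x : R * P => x.2)) => //; exact: cvg_snd.
  apply: ccontD; last first.
    apply: ccontM; first by apply: ccont_real; exact: c1.
    by apply: ccontB; [exact: c2|exact: ccont_cst].
  apply: ccontD; first by apply: (ccont_precomp (c1 _)); exact: cg.
  apply: ccontM; last by apply: ccontB; [exact: c2|exact: ccont_cst].
  by apply: ccont_real; apply: continuousB; [exact: cst_continuous|exact: c1].
have cGq t : {for (t, p), continuous (fun x : R * P => (x.2, G x.2 x.1))}.
  by apply: pair_cont; [exact: cvg_snd|apply/ccontE; exact: cG].
(* Near 1 this ratio has a principal root, which transports the root [s] along [g] to a root along
   [G q]. *)
pose rat (x : R * P) := K x.2 (G x.2 x.1) / K p (g (clamp x.1)).
have crat t : ccont rat (t, p).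
  apply: ccontM.
    apply: (ccont_precomp (cGq t) (f := fun q => K q.1 q.2)) => /=.
    by apply: cK => //; rewrite Gp.
  apply: ccontV; first exact: K0.
  apply: (@ccont_precomp _ _ _ (fun t => K p (g (clamp t))) (fun x : R * P => x.1)).
    exact: cvg_fst.
  apply: ccont_comp; last exact: cKp.
  exact: ccont_precomp (@clamp_cont t) (cg _).
have rat1 t : rat (t, p) = 1 by rewrite /rat /= Gp divff// K0.
have /compact_near_coveringP cov : compact `[0, 1 : R] by exact: segment_compact.
(* Compactness of the unit interval: for [q] near [p] the whole corrected path stays in the fibre of
   [q] and the ratio stays close to 1. *)
have tube : \forall q \near p, forall t, 0 <= t <= 1 ->
    A q (G q t) /\ normc (rat (t, q) - 1) < 1.
  have := cov P (nbhs p) (fun q t => A q (G q t) /\ normc (rat (t, q) - 1) < 1) _.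
  move=> H; have {}H := H _; suff : \forall q \near p,
     (`[0, 1 : R] `<=` [set t | A q (G q t) /\ normc (rat (t, q) - 1) < 1]).
    by apply: filterS => q H' t t01; apply: H'; rewrite /= in_itv.
  apply: H => t _.
  have n1 : \forall x \near (t, p), A x.2 (G x.2 x.1).
    have AG : A p (G p t) by rewrite Gp.
    exact: (cGq t _ (oA _ _ Up AG)).
  have n2 : \forall x \near (t, p), normc (rat x - 1) < 1.
    by have /ccontP/(_ 1 ltr01) := crat t; rewrite rat1.
  have : \forall x \near (t, p), A x.2 (G x.2 x.1) /\ normc (rat x - 1) < 1.
    by apply: filterS2 n1 n2.
  by move=> [[V W] [/= nV nW] VW]; exists (V, W) => // -[t' q] [/= ? ?]; exact: (VW (t', q)).
have rt0 : rt p != 0 by rewrite -sqrf_eq0 rtK// K0.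
have rtn : \forall q \near p, 0 < complex.Re (rt q / rt p).
  have : 0 < normc (rt p) by rewrite normc_gt0.
  by move=> /((ccontP _ _).1 crt); apply: filterS => q; exact: Re_ratio.
have cl0 : clamp 0 = 0 by apply: clamp_le0.
have cl1 : clamp 1 = 1 by apply: clamp_ge1.
have G0 q : G q 0 = a q by rewrite /G cl0 subr0 mul0r mul1r addr0 g0; ring.
have G1 q : G q 1 = b q by rewrite /G cl1 subrr mul0r mul1r addr0 g1; ring.
have i0 : 0 <= (0 : R) <= 1 by rewrite lexx ler01.
have i1 : 0 <= (1 : R) <= 1 by rewrite lexx ler01.
apply: (@ccont_eq_near _ _ (fun q => S p * psqrt (rat (1, q)))); last first.
  apply: ccontM; first exact: ccont_cst.
  apply: (@ccont_comp _ _ psqrt (fun q => rat (1, q))).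
    apply: (ccont_precomp (g := fun q => (1, q) : R * P)); last exact: crat.
    by apply: pair_cont; [exact: cst_continuous|].
  by apply: psqrt_cont; rewrite rat1 ltr01.
near=> q.
have Uq : U q by near: q; exact: oU.
have tq : forall t, 0 <= t <= 1 -> A q (G q t) /\ normc (rat (t, q) - 1) < 1 by near: q.
have rq : 0 < complex.Re (rt q / rt p) by near: q.
have ratRe t : 0 <= t <= 1 -> 0 < complex.Re (rat (t, q)).
  by move=> /tq[_ /Re_gt0_near1].
(* Continuing [rt q] along the corrected path ends at a value depending continuously on [q].
   Monodromy in the fibre of [q] identifies it with [S q], although [S q] came from an arbitrary
   choice of path. *)
have L1 : klift (A q) (K q) (a q) (rt q) (b q) (S p * psqrt (rat (1, q))).
  have Gc t : G q (clamp t) = G q t by rewrite /G (clamp_id (clamp_itv t)).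
  exists (G q), (fun t => s (clamp t) * psqrt (rat (clamp t, q))); split => [t|t|t|t|].
  - apply: ccontD.
      apply: ccontD; first exact: ccont_precomp (@clamp_cont t) (cg _).
      apply: ccontM; last exact: ccont_cst.
      by apply: ccont_real; apply: continuousB; [exact: cst_continuous|exact: clamp_cont].
    by apply: ccontM; [apply: ccont_real; exact: clamp_cont|exact: ccont_cst].
  - by rewrite -Gc; have [] := tq _ (clamp_itv t).
  - apply: ccontM; first exact: ccont_precomp (@clamp_cont t) (cs _).
    apply: (@ccont_comp _ _ psqrt (fun t => rat (clamp t, q))).
      rewrite /rat /=; apply: ccontM.
        apply: ccont_comp; last by apply: cKp => //; have [] := tq _ (clamp_itv t).
        apply: (ccont_precomp (@clamp_cont t)).
        apply: ccontD.
          apply: ccontD; first exact: ccont_precomp (@clamp_cont _) (cg _).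
          apply: ccontM; last exact: ccont_cst.
          by apply: ccont_real; apply: continuousB; [exact: cst_continuous|exact: clamp_cont].
        by apply: ccontM; [apply: ccont_real; exact: clamp_cont|exact: ccont_cst].
      apply: ccontV; first exact: K0.
      apply: ccont_comp; last exact: cKp.
      apply: (ccont_precomp (@clamp_cont t) (f := fun t => g (clamp t))).
      exact: ccont_precomp (@clamp_cont _) (cg _).
    exact/psqrt_cont/ratRe/clamp_itv.
  - rewrite exprMn sK psqrt_sqr ?ratRe ?clamp_itv// /rat /= Gc (clamp_id (clamp_itv t)).
    by rewrite mulrC divfK// K0.
  - rewrite G0 G1 cl0 cl1 s0 s1; split => //.
    rewrite -(@psqrt_unique _ (rt q / rt p)) ?ratRe//; first by rewrite mulrC divfK.
    by rewrite expr_div_n !rtK// /rat /= G0 cl0 g0.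
have L2 := klift_trans (klift_sym L1) (HS q Uq).
have Loop := @klift_loop (A q) (K q) _ _ _ _ _ (scA q Uq) L2.
by apply: Loop => u ?; [exact: cKp|exact: K0].
Unshelve. all: by end_near. Qed.

End SquareRoots.

(** * The Koebe constant of a planar domain with square roots *)

Section Mobius.
Context {R : realType}.
Local Notation C := R[i].
Implicit Types (c w : C).

Definition mobius c w : C := (w - c) / (1 - conjc c * w).

Lemma mobius_den c w : normc c < 1 -> normc w < 1 -> 1 - conjc c * w != 0.
Proof.
move=> c1 w1; rewrite subr_eq0; apply/eqP => E.
have : normc (1 : C) < 1.
  rewrite E normcM normc_conj; have := normc_ge0 c; have := normc_ge0 w; nra.
by rewrite normc1 ltxx.
Qed.

Lemma normc_sqrB c w : normc (1 - conjc c * w) ^+ 2 - normc (w - c) ^+ 2 =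
  (1 - normc c ^+ 2) * (1 - normc w ^+ 2).
Proof.
by case: c w => a b [x y]; rewrite !sqr_normc_ReIm /=; ring.
Qed.

Lemma mobius_lt1 c w : normc c < 1 -> normc w < 1 -> normc (mobius c w) < 1.
Proof.
move=> c1 w1; rewrite /mobius normcM normcV ltr_pdivrMr ?normc_gt0 ?mobius_den// mul1r.
rewrite -(@ltr_pXn2r _ 2%N) ?nnegrE ?normc_ge0// -subr_gt0 normc_sqrB.
by rewrite mulr_gt0// subr_gt0 expr_lt1// normc_ge0.
Qed.

Lemma mobiusK c w : normc c < 1 -> normc w < 1 -> mobius (- c) (mobius c w) = w.
Proof.
move=> c1 w1; have d := mobius_den c1 w1.
have d2 : 1 - conjc c * c != 0 by exact: mobius_den.
rewrite /mobius rmorphN /=; field; rewrite d /=.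
by rewrite (_ : _ + _ = 1 - conjc c * c)//; ring.
Qed.

Lemma mobius_deriv c w : 1 - conjc c * w != 0 ->
  cderiv (mobius c) w ((1 - conjc c * c) / (1 - conjc c * w) ^+ 2).
Proof.
move=> d; rewrite (_ : _ / _ = (1 - 0) * (1 - conjc c * w)^-1 +
  (w - c) * (- (0 - (0 * w + conjc c * 1)) / (1 - conjc c * w) ^+ 2)); last by field.
apply: cderivM; first by apply: cderivB; [exact: cderiv_id|exact: cderiv_cst].
apply: cderivV => //; apply: cderivB; first exact: cderiv_cst.
by apply: cderivM; [exact: cderiv_cst|exact: cderiv_id].
Qed.

Lemma mobius_deriv_neq0 c w : normc c < 1 -> normc w < 1 ->
  (1 - conjc c * c) / (1 - conjc c * w) ^+ 2 != 0.
Proof.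
by move=> c1 w1; rewrite mulf_neq0 ?invr_eq0 ?expf_neq0 ?mobius_den.
Qed.

Lemma mobius_eq0 c w : normc c < 1 -> normc w < 1 -> mobius c w = 0 -> w = c.
Proof.
move=> c1 w1 /eqP; rewrite mulf_eq0 invr_eq0 (negbTE (mobius_den c1 w1)) orbF subr_eq0.
by move/eqP.
Qed.

Lemma normc_subr_conj c : normc c < 1 -> normc (1 - conjc c * c) = 1 - normc c ^+ 2.
Proof.
move=> c1; rewrite mulrC mul_conjc -(rmorph1 (real_complex R)) -rmorphB normc_real ger0_norm//.
by rewrite subr_ge0 expr_le1 ?normc_ge0// ltW.
Qed.

End Mobius.

Section Koebe.
Context {R : realType}.
Local Notation C := R[i].
Variable G : set C.
Hypothesis oG : forall u, G u -> \forall v \near u, G v.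
Hypothesis G1 : G 1.
Hypothesis G0 : ~ G 0.
Hypothesis sqG : forall K : C -> C, (forall u, G u -> ccont K u /\ K u != 0) ->
  exists k : C -> C, forall u, G u -> ccont k u /\ k u ^+ 2 = K u.

(* [F] is a biholomorphism of [G] onto an open set, with inverse [Th]. *)
Definition univalent (F Th : C -> C) : Prop := forall u, G u ->
  [/\ exists a, cderiv F u a,
      forall e : R, 0 < e -> \forall v \near F u, exists u', [/\ G u', normc (u' - u) < e & F u' = v],
      Th (F u) = u & exists b, cderiv Th (F u) b].

(** A continuous local lift of a differentiable [F] through [q] is differentiable: its slope
    function is that of [F] divided by that of [q] along the lift. *)
Lemma cderiv_inverse (F S q : C -> C) u a b : ccont S u -> (\forall v \near u, q (S v) = F v) ->
  cderiv F u a -> cderiv q (S u) b -> b != 0 -> cderiv S u (a / b).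
Proof.
move=> cS E [p [cp <- Ep]] [t [ct tb Et]] b0.
have ctS : ccont (fun v => t (S v)) u by exact: ccont_comp.
have tb0 : t (S u) != 0 by rewrite tb.
apply: (@cderiv_near _ _ _ _ (fun v => p v / t (S v))).
- by apply: ccontM => //; exact: ccontV.
- by rewrite tb.
have Eu := nbhs_singleton E.
apply: filterS2 E (ccont_near_neq0 ctS tb0) => v Ev tv.
by rewrite mulrAC -Ep -Ev -Eu Et mulrAC divff// mul1r.
Qed.

(** Univalence passes from [F = q \o S] to [S]. Openness of [F] gives [u'] near [u] with
    [F u' = q v], and local injectivity of [q] turns this into [S u' = v]; the inverse is
    [Th \o q]. *)
Lemma univalent_lift (F Th S q : C -> C) : univalent F Th ->
  (forall u, G u -> [/\ ccont S u, q (S u) = F u, exists2 b, b != 0 & cderiv q (S u) b &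
     exists2 e : R, 0 < e & forall s t, normc (s - S u) < e -> normc (t - S u) < e ->
       q s = q t -> s = t]) ->
  univalent S (fun w => Th (q w)) /\
  (forall u a b, G u -> cderiv F u a -> cderiv q (S u) b -> b != 0 -> cderiv S u (a / b)).
Proof.
move=> UF HS.
have D u a b : G u -> cderiv F u a -> cderiv q (S u) b -> b != 0 -> cderiv S u (a / b).
  move=> Gu Fa qb b0; have [cS _ _ _] := HS u Gu.
  apply: cderiv_inverse Fa qb b0 => //.
  by apply: filterS (oG Gu) => v /HS[].
split=> // u Gu; have [[a Fa] oF ThF [b Thb]] := UF u Gu.
have [cS qS [b' b'0 qb'] [e e0 inj]] := HS u Gu.
split; [by exists (a / b'); exact: D Fa qb' b'0| |by rewrite qS|].
- move=> d d0.
  have /nbhs_normcP[r r0 Hr] := (ccontP _ _).1 cS _ e0.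
  have m0 : 0 < Num.min r d by rewrite lt_min r0 d0.
  have /nbhs_normcP[t t0 Ht] := oF _ m0.
  have cq := cderiv_cont qb'.
  have := (ccontP _ _).1 cq _ t0; move=> near1.
  apply: filterS2 near1 (near_normc (S u) e0) => v; rewrite qS => /Ht[u' [Gu' u'u Fu']] ve.
  move: u'u; rewrite lt_min => /andP[u'r u'd].
  exists u'; split => //; apply: inj => //; first exact: Hr.
  by have [_ -> _ _] := HS u' Gu'.
- by exists (b * b'); apply: cderiv_comp qb' _; rewrite qS.
Qed.

Lemma univalent_id : univalent (fun u => u) (fun u => u).
Proof.
move=> u Gu; split => //; [by exists 1; exact: cderiv_id| |by exists 1; exact: cderiv_id].
move=> e e0; apply: filterS2 (oG Gu) (near_normc u e0) => v Gv vu.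
by exists v.
Qed.

Lemma sqr_loc_inj (x : C) : x != 0 -> exists2 e : R, 0 < e &
  forall s t, normc (s - x) < e -> normc (t - x) < e -> s ^+ 2 = t ^+ 2 -> s = t.
Proof.
move=> x0; exists (normc x); first by rewrite normc_gt0.
move=> s t sx tx /eqP; rewrite eqf_sqr => /orP[/eqP//|/eqP sE].
exfalso; have : normc (2 * x) < normc x + normc x.
  rewrite (_ : 2 * x = - ((s - x) + (t - x))); last by rewrite sE; ring.
  by rewrite normcN (le_lt_trans (le_normcD _ _))// ltrD.
by rewrite mulr_natl mulr2n -mulr2n normcMn mulr2n ltxx.
Qed.

Lemma cderiv_sqr (x : C) : cderiv (fun s => s ^+ 2) x (2 * x).
Proof.
have H := cderivM (cderiv_id x) (cderiv_id x).
by rewrite mul1r mulr1 -mulr2n -mulr_natl in H; exact: H.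
Qed.

Lemma sqrt_id_exists : exists s : C -> C, s 1 = 1 /\
  forall u, G u -> [/\ ccont s u, s u ^+ 2 = u & s u != 0].
Proof.
have [|s Hs] := sqG (K := fun u => u).
  by move=> u Gu; split; [exact: ccont_id|apply: contra_notN G0 => /eqP <-].
have s11 : s 1 ^+ 2 = 1 by have [] := Hs 1 G1.
exists (fun u => s 1 * s u); split; first by rewrite -expr2.
move=> u Gu; have [cs su] := Hs u Gu; split.
- by apply: ccontM => //; exact: ccont_cst.
- by rewrite exprMn s11 mul1r.
- by rewrite -sqrf_eq0 exprMn s11 mul1r su; apply: contra_notN G0 => /eqP <-.
Qed.

(** The root [s] of the identity covers a disc about 1. It therefore omits the opposite disc about
    -1, since [s u' = - s u] would force [u' = u] and [s u = 0]. Inverting about -1 makes it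
    bounded. *)
Lemma univalent_bounded_exists : exists F Th, univalent F Th /\ forall u, G u -> normc (F u) < 1.
Proof.
have [s [s1 Hs]] := sqrt_id_exists.
have [|Us _] := @univalent_lift _ _ s (fun w : C => w ^+ 2) univalent_id.
  move=> u Gu; have [cs su su0] := Hs u Gu; split => //; last exact: sqr_loc_inj.
  by exists (2 * s u); [rewrite mulf_neq0|exact: cderiv_sqr].
have [_ /(_ _ ltr01) os _ _] := Us 1 G1.
move: os; rewrite s1 => /nbhs_normcP[d d0 Hd].
have far u : G u -> d <= normc (s u + 1).
  move=> Gu; rewrite leNgt; apply/negP => lt_d.
  have [u' [Gu' _ E]] : exists u', [/\ G u', normc (u' - 1) < 1 & s u' = - s u].
    by apply: Hd; rewrite -normcN opprB opprK addrC.
  have [_ su su0] := Hs u Gu; have [_ su' _] := Hs u' Gu'.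
  have uu : u' = u by rewrite -su' -su E sqrrN.
  by move: E; rewrite uu => /eqP; rewrite -addr_eq0 -mulr2n mulrn_eq0 (negbTE su0).
have nz u : G u -> s u + 1 != 0.
  by move=> Gu; rewrite -normc_gt0; exact: lt_le_trans (far u Gu).
pose k : C := ((d / 2)%:C)%C.
have k0 : k != 0 by rewrite -normc_eq0 normc_real normr_eq0 gt_eqF// divr_gt0.
pose F u := k / (s u + 1); pose q w := k / w - 1.
have F0 u : G u -> F u != 0 by move=> Gu; rewrite mulf_neq0// invr_eq0 nz.
have [|UF _] := @univalent_lift s _ F q Us.
  move=> u Gu; have [cs _ _] := Hs u Gu; split.
  - apply: ccontM; first exact: ccont_cst.
    by apply: ccontV; [exact: nz|apply: ccontD => //; exact: ccont_cst].
  - by rewrite /q /F invfM mulrA divff// mul1r invrK addrK.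
  - exists (0 * (F u)^-1 + k * (- 1 / F u ^+ 2) - 0); last first.
      apply: cderivB; last exact: cderiv_cst.
      apply: cderivM; first exact: cderiv_cst.
      by apply: cderivV; [exact: F0|exact: cderiv_id].
    by rewrite mul0r add0r subr0 !mulf_neq0 ?oppr_eq0 ?oner_eq0 ?invr_eq0 ?expf_neq0 ?F0.
  - exists 1 => // x y _ _ /eqP; rewrite /q (inj_eq (addIr _)) (inj_eq (mulfI k0)).
    by move=> /eqP /invr_inj.
eexists; eexists; split; first exact: UF.
move=> u Gu; rewrite /F normcM normcV normc_real gtr0_norm ?divr_gt0//.
by rewrite ltr_pdivrMr ?normc_gt0 ?nz// mul1r (lt_le_trans _ (far u Gu))//; lra.
Qed.

Lemma mobius_loc_inj c w : normc c < 1 -> normc w < 1 -> exists2 e : R, 0 < e &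
  forall s t, normc (s - w) < e -> normc (t - w) < e ->
    [/\ normc s < 1, normc t < 1 & mobius c s = mobius c t -> s = t].
Proof.
move=> c1 w1; exists (1 - normc w); first by rewrite subr_gt0.
have B s : normc (s - w) < 1 - normc w -> normc s < 1.
  by rewrite ltrBrDr => H; rewrite -(subrK w s) (le_lt_trans (le_normcD _ _)).
move=> s t /B s1 /B t1; split => // E.
by rewrite -(mobiusK c1 s1) -(mobiusK c1 t1) E.
Qed.

Definition koebe_class F Th l := [/\ univalent F Th, forall u, G u -> normc (F u) < 1,
  F 1 = 0 & cderiv F 1 l].

Lemma univalent_normalize F Th l : univalent F Th -> (forall u, G u -> normc (F u) < 1) ->
  cderiv F 1 l -> exists F' Th' l', koebe_class F' Th' l' /\
    normc l' = normc l / (1 - normc (F 1) ^+ 2).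
Proof.
move=> UF F1 Fl; set c := F 1; have c1 : normc c < 1 by exact: F1.
have c1' : normc (- c) < 1 by rewrite normcN.
have [|UM DM] := @univalent_lift F Th (fun u => mobius c (F u)) (mobius (- c)) UF.
  move=> u Gu; have [[a Fa] _ _ _] := UF u Gu; have Fu := F1 u Gu.
  have Mu := mobius_lt1 c1 Fu.
  split.
  - apply: ccont_comp; first exact: cderiv_cont Fa.
    exact: cderiv_cont (mobius_deriv (mobius_den c1 Fu)).
  - exact: mobiusK.
  - eexists; last exact: mobius_deriv (mobius_den c1' Mu).
    exact: mobius_deriv_neq0.
  - have [e e0 H] := mobius_loc_inj c1' Mu; exists e => // s t sw tw.
    by have [_ _] := H s t sw tw.
have c0 : mobius c c = 0 by rewrite /mobius subrr mul0r.
exists (fun u => mobius c (F u)), (fun w => Th (mobius (- c) w)),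
  ((1 - conjc c * c) / (1 - conjc c * c) ^+ 2 * l); split; first split => //.
- by move=> u Gu; apply: mobius_lt1 => //; exact: F1.
- by apply: cderiv_comp Fl _; apply: mobius_deriv; exact: mobius_den.
rewrite normcM normcM normcV normcX normc_subr_conj//.
have : 1 - normc c ^+ 2 != 0 by rewrite gt_eqF// subr_gt0 expr_lt1// normc_ge0.
by move=> nz; field.
Qed.

(* If [F] omits [c], then a square root of the Moebius transform of [F] exchanging [c]
   and [0], moved back to [F 1 = 0], has a larger derivative at [1]. *)
Lemma koebe_improve F Th l c : koebe_class F Th l -> normc c < 1 ->
  (forall u, G u -> F u != c) -> exists F' Th' l' (t : R), [/\ koebe_class F' Th' l',
    0 < t, t ^+ 2 = normc c & normc l' = normc l * ((1 + t ^+ 2) / (2 * t))].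
Proof.
move=> [UF F1 F10 Fl] c1 cF.
have c0 : c != 0 by have := cF 1 G1; rewrite F10 eq_sym.
pose Q u := mobius c (F u).
have Q0 u : G u -> Q u != 0.
  move=> Gu; apply/eqP => /(mobius_eq0 c1 (F1 u Gu)) E.
  by have := cF u Gu; rewrite E eqxx.
have dQ u a : G u -> cderiv F u a ->
    cderiv Q u ((1 - conjc c * c) / (1 - conjc c * F u) ^+ 2 * a).
  move=> Gu Fa; apply: cderiv_comp Fa _; apply: mobius_deriv; apply: mobius_den => //.
  exact: F1.
have [|S HS] := sqG (K := Q).
  move=> u Gu; split; last exact: Q0.
  by have [[a Fa] _ _ _] := UF u Gu; exact: cderiv_cont (dQ u a Gu Fa).
have S0 u : G u -> S u != 0.
  by move=> Gu; rewrite -sqrf_eq0 (HS u Gu).2 Q0.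
have S1 u : G u -> normc (S u) < 1.
  move=> Gu; rewrite -(@ltr_pXn2r _ 2%N) ?nnegrE ?normc_ge0// expr1n -normcX (HS u Gu).2.
  by apply: mobius_lt1 => //; exact: F1.
have c1' : normc (- c) < 1 by rewrite normcN.
pose q (w : C) := mobius (- c) (w ^+ 2).
have sq1 (w : C) : normc w < 1 -> normc (w ^+ 2) < 1.
  by move=> w1; rewrite normcX expr_lt1 ?normc_ge0.
have qS u : G u -> q (S u) = F u.
  by move=> Gu; rewrite /q (HS u Gu).2 mobiusK//; exact: F1.
have dq w : normc w < 1 -> cderiv q w
    ((1 - conjc (- c) * (- c)) / (1 - conjc (- c) * w ^+ 2) ^+ 2 * (2 * w)).
  move=> w1; apply: cderiv_comp (cderiv_sqr w) _; apply: mobius_deriv.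
  by apply: mobius_den => //; exact: sq1.
have dq0 w : normc w < 1 -> w != 0 ->
    (1 - conjc (- c) * (- c)) / (1 - conjc (- c) * w ^+ 2) ^+ 2 * (2 * w) != 0.
  by move=> w1 w0; rewrite mulf_neq0 ?mobius_deriv_neq0 ?sq1// mulf_neq0.
have [|US DS] := @univalent_lift F Th S q UF.
  move=> u Gu; split; [exact: (HS u Gu).1|exact: qS| |].
    by eexists; [exact: dq0 (S1 u Gu) (S0 u Gu)|exact: dq (S1 u Gu)].
  have [e e0 H] := sqr_loc_inj (S0 u Gu).
  exists (Num.min e (1 - normc (S u))); first by rewrite lt_min e0 subr_gt0 S1.
  move=> s t; rewrite !lt_min => /andP[se s1] /andP[te t1] E.
  have B x : normc (x - S u) < 1 - normc (S u) -> normc x < 1.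
    by rewrite ltrBrDr => Hx; rewrite -(subrK (S u) x) (le_lt_trans (le_normcD _ _)).
  apply: H => //; rewrite -(mobiusK c1' (sq1 _ (B _ s1))) -(mobiusK c1' (sq1 _ (B _ t1))).
  by rewrite -/(q s) -/(q t) E.
have nS : \forall v \near (1 : C), S v ^+ 2 = Q v by apply: filterS (oG G1) => v /HS[].
have Sl := cderiv_sqrt (S0 1 G1) (HS 1 G1).1 nS (dQ 1 l G1 Fl).
have [F' [Th' [l' [K' nl']]]] := univalent_normalize US S1 Sl.
have t2 : normc (S 1) ^+ 2 = normc c.
  by rewrite -normcX (HS 1 G1).2 /Q F10 /mobius mulr0 subr0 divr1 sub0r normcN.
have t0 : 0 < normc (S 1) by rewrite normc_gt0 S0.
exists F', Th', l', (normc (S 1)); split => //.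
(* With [t ^+ 2 = normc c] the factor is [(1 - t^4) / (2 t (1 - t^2))]: Moebius map, square root,
   then renormalisation at 1. *)
rewrite nl' F10 mulr0 subr0 expr1n divr1 !normcM normcV normcM normc_subr_conj// -t2.
rewrite normc_nat.
have := S1 1 G1; move: t0; set t := normc (S 1) => t0 t1.
have tn : 1 - t ^+ 2 != 0 by rewrite gt_eqF// subr_gt0 expr_lt1// ltW.
by field; rewrite tn gt_eqF.
Qed.

(* With [q] a square root of [Th], the function [m = (1 - q) / (1 + q)] satisfies
   [m a * m b != 1], since [q b = - q a] would force [Th a = Th b]. *)
Lemma koebe_onto F Th l r : koebe_class F Th l -> 0 < r -> r < 1 ->
  (forall c, normc c < r -> exists2 u, G u & F u = c) ->
  forall rho, 0 < rho -> rho < r -> rho / 4 <= normc l.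
Proof.
move=> [UF F1 F10 Fl] r0 r1 onto rho rho0 rhor.
have [s [s1 Hs]] := sqrt_id_exists.
have l0 : l != 0 /\ cderiv Th 0 l^-1.
  have [_ _ ThF [b]] := UF 1 G1; rewrite F10 => Thb.
  have : cderiv (fun u => Th (F u)) 1 (b * l) by apply: cderiv_comp Fl _; rewrite F10.
  move=> H1; have H2 : cderiv (fun u => Th (F u)) 1 1.
    apply: cderiv_eq (cderiv_id 1); apply: filterS (oG G1) => u Gu.
    by have [_ _ -> _] := UF u Gu.
  have bl := cderiv_unique H1 H2.
  have l0 : l != 0 by apply/eqP => l0; move/eqP: bl; rewrite l0 mulr0 eq_sym oner_eq0.
  by split => //; rewrite -[l^-1]mul1r -bl mulfK.
case: l0 => l0 dTh.
have Th0 : Th 0 = 1 by have [_ _ E _] := UF 1 G1; rewrite -F10.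
have GTh w : normc w < r -> G (Th w) /\ exists b, cderiv Th w b.
  by move=> /onto[u Gu <-]; have [_ _ -> ?] := UF u Gu.
have dq w b : normc w < r -> cderiv Th w b ->
    cderiv (fun w => s (Th w)) w (1 / (2 * s (Th w)) * b).
  move=> wr Thb; apply: cderiv_comp Thb _; have [GT _] := GTh w wr.
  have [cs _ sn0] := Hs _ GT; apply: cderiv_sqrt (cderiv_id _) => //.
  by apply: filterS (oG GT) => v /Hs[].
have qq a b : normc a < r -> normc b < r -> s (Th a) + s (Th b) != 0.
  move=> ar br; have [Ga _] := GTh a ar; have [Gb _] := GTh b br.
  have [_ sa sa0] := Hs _ Ga; have [_ sb _] := Hs _ Gb.
  apply/eqP => /eqP; rewrite addr_eq0 => /eqP E.
  have TE : Th a = Th b by rewrite -sa -sb E sqrrN.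
  by move: E; rewrite TE => /eqP; rewrite -addr_eq0 -TE -mulr2n mulrn_eq0 (negbTE sa0).
have n0r : normc (0 : C) < r by rewrite normc0.
have q1 w : normc w < r -> 1 + s (Th w) != 0.
  by move=> wr; have := qq 0 w n0r wr; rewrite Th0 s1.
pose m w := (1 - s (Th w)) * (1 + s (Th w))^-1.
have dm w b : normc w < r -> cderiv (fun w => s (Th w)) w b -> cderiv m w
    ((0 - b) * (1 + s (Th w))^-1 + (1 - s (Th w)) * (- (0 + b) / (1 + s (Th w)) ^+ 2)).
  move=> wr db; apply: cderivM.
    by apply: cderivB => //; exact: cderiv_cst.
  by apply: cderivV; [exact: q1|apply: cderivD => //; exact: cderiv_cst].
have H := @bieberbach_eilenberg _ m _ r rho rho0 rhor _ _ (dm _ _ n0r (dq _ _ n0r dTh)) _.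
(* The origin of the constant 1/4: at 1 the root [s] has derivative 1/2 and [(1 - q) / (1 + q)] has
   derivative -1/2, while [Th] has derivative [l^-1] at 0. *)
have {H} : normc (- l^-1 / 4) * rho <= 1.
  have <- : (0 - 1 / (2 * s (Th 0)) * l^-1) / (1 + s (Th 0)) + (1 - s (Th 0)) *
      (- (0 + 1 / (2 * s (Th 0)) * l^-1) / (1 + s (Th 0)) ^+ 2) = - l^-1 / 4.
    by rewrite Th0 s1; field.
  apply: H.
  - by move=> w wr; have [_ [b Thb]] := GTh w wr; eexists; exact: dm (dq _ _ wr Thb).
  - by rewrite /m Th0 s1 subrr mul0r.
  - move=> a b ar br; apply/eqP => E; have := qq a b ar br; apply/negP; rewrite negbK.
    have qa := q1 a ar; have qb := q1 b br.
    have E' : (1 - s (Th a)) * (1 - s (Th b)) = (1 + s (Th a)) * (1 + s (Th b)).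
      have := congr1 (fun x => x * ((1 + s (Th a)) * (1 + s (Th b)))) E.
      by rewrite /m mul1r => <-; field; rewrite qa qb.
    have : 2 * (s (Th a) + s (Th b)) = 0.
      rewrite (_ : 2 * _ = (1 + s (Th a)) * (1 + s (Th b)) - (1 - s (Th a)) * (1 - s (Th b))).
        by rewrite E' subrr.
      by ring.
    by move=> /eqP; rewrite mulf_eq0 pnatr_eq0.
have l0' : 0 < normc l by rewrite normc_gt0.
rewrite normcM normcN !normcV normc_nat.
rewrite -mulrA mulrC ler_pdivrMr// mul1r; lra.
Qed.

(** A map whose derivative nearly attains the supremum cannot be improved by the square root trick,
    so its image contains the disc of radius [r] close to 1. The estimate for such maps then exceeds
    the assumed upper bound [1 / 4 - eta]. *)
Theorem koebe_quarter (eta : R) : 0 < eta -> exists F l,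
  [/\ forall u, G u -> normc (F u) < 1 /\ exists a, cderiv F u a, F 1 = 0, cderiv F 1 l &
      1 / 4 - eta < normc l].
Proof.
move=> eta0; apply: contrapT => none.
have bound F Th l : koebe_class F Th l -> normc l <= 1 / 4 - eta.
  move=> [UF F1 F10 Fl]; rewrite leNgt; apply/negP => ltl; apply: none.
  exists F, l; split => // u Gu; split; first exact: F1.
  by have [] := UF u Gu.
pose V := [set x | exists F Th l, koebe_class F Th l /\ x = normc l].
have V0 : V !=set0.
  have [F [Th [UF F1]]] := univalent_bounded_exists.
  have [[l Fl] _ _ _] := UF 1 G1.
  have [F' [Th' [l' [K _]]]] := univalent_normalize UF F1 Fl.
  by exists (normc l'), F', Th', l'.
have Vub : has_ubound V by exists (1 / 4 - eta) => _ [F [Th [l [/bound ? ->]]]].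
have Vpos F Th l : koebe_class F Th l -> 0 < normc l.
  move=> [UF F1 F10 Fl]; rewrite normc_gt0; apply/eqP => l0.
  have [_ _ _ [b]] := UF 1 G1; rewrite F10 => Thb.
  have : cderiv (fun u => Th (F u)) 1 (b * l) by apply: cderiv_comp Fl _; rewrite F10.
  move=> H1; have H2 : cderiv (fun u => Th (F u)) 1 1.
    apply: cderiv_eq (cderiv_id 1); apply: filterS (oG G1) => u Gu.
    by have [_ _ -> _] := UF u Gu.
  by move/eqP: (cderiv_unique H1 H2); rewrite l0 mulr0 eq_sym oner_eq0.
have a0 : 0 < sup V.
  have [x [F [Th [l [K xE]]]]] := V0.
  have := Vpos _ _ _ K; rewrite -xE => x0; apply: (lt_le_trans x0).
  by apply: ub_le_sup => //; exists F, Th, l.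
have eta4 : eta < 1 / 4.
  have [x [F [Th [l [K _]]]]] := V0; have := bound _ _ _ K; have := Vpos _ _ _ K; lra.
pose r := (1 - eta) ^+ 2.
have r0 : 0 < r by rewrite exprn_gt0//; lra.
have r1 : r < 1 by rewrite expr_lt1//; lra.
(* The improvement factor [(1 + t ^+ 2) / (2 * t)] at [t = 1 - eta]. It decreases on [(0, 1)], so an
   omitted point of modulus below [r] would improve the derivative by at least [k], beyond the
   supremum. *)
pose k := (1 + r) / (2 * (1 - eta)).
have k1 : 1 < k.
  rewrite ltr_pdivlMr ?mul1r; last by lra.
  have := exprn_gt0 2 eta0; rewrite /r; lra.
have [x [F [Th [l [K xE]]]] lx] : exists2 x, V x & sup V / k < x.
  apply: sup_gt => //; rewrite ltr_pdivrMr; last by lra.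
  by rewrite -{1}[sup V]mulr1 ltr_pM2l.
have onto c : normc c < r -> exists2 u, G u & F u = c.
  move=> cr; apply: contrapT => nc.
  have cF u : G u -> F u != c by move=> Gu; apply/eqP => E; apply: nc; exists u.
  have [F' [Th' [l' [t [K' t0 t2 nl']]]]] := koebe_improve K (lt_trans cr r1) cF.
  have tr : t < 1 - eta.
    by rewrite -(@ltr_pXn2r _ 2%N) ?nnegrE ?t2//; [exact: ltW|lra].
  have kt : k <= (1 + t ^+ 2) / (2 * t).
    rewrite /k ler_pdivrMr; last by lra.
    rewrite mulrAC ler_pdivlMr; last by lra.
    rewrite -subr_ge0 /r.
    rewrite (_ : _ - _ = 2 * ((1 - eta - t) * (1 - t * (1 - eta)))); last by ring.
    rewrite mulr_ge0// mulr_ge0//; first lra.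
    nra.
  have : normc l' <= sup V by apply: ub_le_sup => //; exists F', Th', l'.
  rewrite nl' leNgt => /negP; apply.
  move: lx; rewrite xE ltr_pdivrMr; last by lra.
  move/lt_le_trans; apply; rewrite ler_pM2l//; exact: Vpos K.
have := koebe_onto K r0 r1 onto.
(* The radius [1 - 3 * eta] lies below [r = (1 - eta) ^+ 2], and a quarter of it exceeds
   [1 / 4 - eta]. *)
move=> /(_ (1 - 3 * eta)); have := bound _ _ _ K => B H.
have : (1 - 3 * eta) / 4 <= normc l.
  apply: H; first lra.
  by rewrite /r; have := exprn_gt0 2 eta0; lra.
lra.
Qed.

End Koebe.

(** * Supporting hyperplanes of C-convex sets *)

Section RowVectors.
Context {R : realType} {n : nat}.
Local Notation C := R[i].
Local Notation Cn := 'rV[R[i]]_n.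
Implicit Types (x y z u v w : Cn).

Lemma nbhs_rowP x (A : set Cn) : nbhs x A <->
  exists2 e : R, 0 < e & forall y, (forall j, normc (y 0 j - x 0 j) < e) -> A y.
Proof.
split.
  move=> /nbhs_ballP[e /= e0 sA]; move: e0 sA; case: e => a b.
  rewrite ltcE /= => /andP[/eqP b0 a0]; rewrite b0 => sA; exists a => [//|y xy].
  apply: sA; split; first by rewrite ltcE /= eqxx.
  move=> i j; rewrite ord1 -ball_normE /= normr_normc normcB complexr0 ltcR.
  exact: xy.
move=> [e e0 sA]; apply/nbhs_ballP; exists (e%:C)%C => /=; first by rewrite ltcR.
move=> y [_ xy]; apply: sA => j; have := xy 0 j.
by rewrite -ball_normE /= normr_normc normcB ltcR.
Qed.

Definition rcont {T : topologicalType} (f : T -> Cn) (t : T) : Prop :=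
  forall j, ccont (fun s => f s 0 j) t.

Lemma rcontP {T : topologicalType} (f : T -> Cn) (t : T) : rcont f t <-> {for t, continuous f}.
Proof.
split => [cf A /nbhs_rowP[e e0 sA]|cf j].
  have : \forall s \near t, forall j, normc (f s 0 j - f t 0 j) < e.
    by apply: filter_forall => j; exact: (ccontP _ _).1 (cf j) _ e0.
  by apply: filterS => s /sA.
apply/ccontP => e e0.
have : nbhs (f t) [set y | normc (y 0 j - f t 0 j) < e].
  by apply/nbhs_rowP; exists e => // y; exact.
by move=> /cf.
Qed.

Section Continuity.
Context {T : topologicalType}.
Implicit Types (f g : T -> Cn) (t : T).

Lemma rcont_cst (c : Cn) t : rcont (fun _ : T => c) t.
Proof. by move=> j; exact: ccont_cst. Qed.

Lemma rcontD f g t : rcont f t -> rcont g t -> rcont (fun s => f s + g s) t.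
Proof.
move=> cf cg j; rewrite (_ : (fun s => _) = fun s => f s 0 j + g s 0 j).
  exact: ccontD.
by apply/funext => s; rewrite mxE.
Qed.

Lemma rcontB f g t : rcont f t -> rcont g t -> rcont (fun s => f s - g s) t.
Proof.
move=> cf cg j; rewrite (_ : (fun s => _) = fun s => f s 0 j - g s 0 j).
  exact: ccontB.
by apply/funext => s; rewrite !mxE.
Qed.

Lemma rcontZ (a : T -> C) f t : ccont a t -> rcont f t -> rcont (fun s => a s *: f s) t.
Proof.
move=> ca cf j; rewrite (_ : (fun s => _) = fun s => a s * f s 0 j).
  exact: ccontM.
by apply/funext => s; rewrite mxE.
Qed.

Lemma ccont_sum (I : Type) (r : seq I) (F : I -> T -> C) t :
  (forall i, ccont (F i) t) -> ccont (fun s => \sum_(i <- r) F i s) t.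
Proof.
move=> cF; elim: r => [|i r IH].
  rewrite (_ : (fun _ => _) = fun=> 0); first exact: ccont_cst.
  by apply/funext => s; rewrite big_nil.
rewrite (_ : (fun _ => _) = fun s => F i s + \sum_(i <- r) F i s).
  exact: ccontD.
by apply/funext => s; rewrite big_cons.
Qed.

End Continuity.

Lemma rcont_id x : rcont (fun y : Cn => y) x.
Proof. by apply/rcontP => A. Qed.

Definition cdot u v : C := \sum_j u 0 j * conjc (v 0 j).

Lemma dotmx_cdot u v : dotmx u v = cdot u v.
Proof.
have conjE (a : C) : a^* = conjc a.
  have [->|a0] := eqVneq a 0; first by rewrite !rmorph0.
  by apply: (mulfI a0); rewrite -normCK sqr_normc.
rewrite dotmxE !mxE; apply: eq_bigr => j _.
by rewrite !mxE conjE.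
Qed.

Lemma cdotDl u v w : cdot (u + v) w = cdot u w + cdot v w.
Proof. by rewrite -big_split; apply: eq_bigr => j _; rewrite mxE mulrDl. Qed.

Lemma cdotZl (a : C) u w : cdot (a *: u) w = a * cdot u w.
Proof. by rewrite mulr_sumr; apply: eq_bigr => j _; rewrite mxE mulrA. Qed.

Lemma cdotBl u v w : cdot (u - v) w = cdot u w - cdot v w.
Proof. by rewrite cdotDl -scaleN1r cdotZl mulN1r. Qed.

Lemma cdot0l w : cdot 0 w = 0.
Proof. by rewrite /cdot big1// => j _; rewrite mxE mul0r. Qed.

Lemma cdot_conj u v : conjc (cdot u v) = cdot v u.
Proof.
rewrite /cdot rmorph_sum; apply: eq_bigr => j _.
by rewrite rmorphM /= conjcK mulrC.
Qed.

Lemma enorm_sqr v : enorm v ^+ 2 = \sum_j normc (v 0 j) ^+ 2.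
Proof. by rewrite /enorm sqr_sqrtr// sumr_ge0// => j _; rewrite sqr_ge0. Qed.

Lemma cdotvv v : cdot v v = ((enorm v ^+ 2)%:C)%C.
Proof.
rewrite enorm_sqr rmorph_sum; apply: eq_bigr => j _.
by rewrite mul_conjc.
Qed.

Lemma enorm_ge0 v : 0 <= enorm v.
Proof. exact: sqrtr_ge0. Qed.

Lemma le_coord_enorm v j : normc (v 0 j) <= enorm v.
Proof.
rewrite -(@ler_pXn2r _ 2%N) ?nnegrE ?normc_ge0 ?enorm_ge0// enorm_sqr (bigD1 j)//= lerDl.
by rewrite sumr_ge0// => i _; rewrite sqr_ge0.
Qed.

Lemma enorm_eq0 v : (enorm v == 0) = (v == 0).
Proof.
apply/eqP/eqP => [v0|->]; last first.
  rewrite /enorm big1 ?sqrtr0// => j _; rewrite mxE normc0 expr0n//.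
apply/rowP => j; rewrite mxE; apply/eqP.
by rewrite -normc_eq0 eq_le normc_ge0 andbT -v0 le_coord_enorm.
Qed.

Lemma enorm_gt0 v : (0 < enorm v) = (v != 0).
Proof. by rewrite lt_def enorm_ge0 andbT enorm_eq0. Qed.

Lemma enorm0 : enorm (0 : Cn) = 0.
Proof. by apply/eqP; rewrite enorm_eq0. Qed.

Lemma enormZ (a : C) v : enorm (a *: v) = normc a * enorm v.
Proof.
apply/eqP; rewrite -(@eqrXn2 _ 2%N) ?mulr_ge0 ?enorm_ge0 ?normc_ge0//.
rewrite exprMn !enorm_sqr mulr_sumr; apply/eqP/eq_bigr => j _.
by rewrite mxE normcM exprMn.
Qed.

Lemma enormB u v : enorm (u - v) = enorm (v - u).
Proof. by rewrite -opprB -scaleN1r enormZ normcN normc1 mul1r. Qed.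

Lemma pythagoras (a b : C) u v : cdot u v = 0 ->
  enorm (a *: u + b *: v) ^+ 2 = normc a ^+ 2 * enorm u ^+ 2 + normc b ^+ 2 * enorm v ^+ 2.
Proof.
move=> uv; apply: (@complexI R).
have -> : ((normc a ^+ 2 * enorm u ^+ 2 + normc b ^+ 2 * enorm v ^+ 2)%:C)%C =
    a * conjc a * cdot u u + b * conjc b * cdot v v :> C.
  by rewrite !mul_conjc !cdotvv -!rmorphM -rmorphD.
rewrite -cdotvv.
have vu : cdot v u = 0 by rewrite -cdot_conj uv rmorph0.
have dr (x y w : Cn) (c d : C) : cdot w (c *: x + d *: y) = conjc c * cdot w x + conjc d * cdot w y.
  by rewrite -cdot_conj cdotDl !cdotZl rmorphD !rmorphM /= !cdot_conj.
by rewrite dr !cdotDl !cdotZl uv vu /=; ring.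
Qed.

Lemma ccont_cdot {T : topologicalType} (f g : T -> Cn) t : rcont f t -> rcont g t ->
  ccont (fun s => cdot (f s) (g s)) t.
Proof.
move=> cf cg; apply: ccont_sum => j; apply: ccontM; first exact: cf.
by apply: ccont_conj; exact: cg.
Qed.

Lemma cont_enorm {T : topologicalType} (f : T -> Cn) t : rcont f t ->
  {for t, continuous (fun s => enorm (f s))}.
Proof.
move=> cf; rewrite (_ : (fun s => _) = fun s => Num.sqrt (complex.Re (cdot (f s) (f s)))).
  apply: (@continuous_comp _ _ _ (fun s => complex.Re (cdot (f s) (f s))) Num.sqrt).
    by apply: cont_Re; exact: ccont_cdot.
  exact: sqrt_continuous.
by apply/funext => s; rewrite cdotvv /= sqrtr_sqr ger0_norm// enorm_ge0.
Qed.

Lemma rcont_line {T : topologicalType} (a : Cn) (u : T -> C) (d : T -> Cn) t :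
  ccont u t -> rcont d t -> rcont (fun s => a + u s *: d s) t.
Proof.
by move=> cu cd; apply: rcontD; [exact: rcont_cst|exact: rcontZ].
Qed.

(** * Boundary points, nearest points and hyperplanes missing the domain *)

Lemma boundary_notin (D : set Cn) x : open D -> boundary D x -> ~ D x.
Proof. by move=> oD [_ nx] Dx; apply: nx; exact: (open_nbhs_nbhs (conj oD Dx)). Qed.

Lemma open_near (D : set Cn) x : open D -> D x -> \forall y \near x, D y.
Proof. by move=> oD Dx; exact: (open_nbhs_nbhs (conj oD Dx)). Qed.

Lemma compact_disc (c : C) (r : R) : compact [set w : C | normc (w - c) <= r].
Proof.
pose f (w : R * R) : C := c + Complex w.1 w.2.
have cf (w : R * R) : {for w, continuous f}.
  apply/ccontE; apply: ccontD; first exact: ccont_cst.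
  by apply: ccont_ReIm; [exact: cvg_fst|exact: cvg_snd].
have cn (w : R * R) : {for w, continuous (fun w' : R * R => normc (f w' - c))}.
  apply: (@cont_normc _ _ (fun w' : R * R => f w' - c)); apply: ccontB; last exact: ccont_cst.
  by apply/ccontE; exact: cf.
pose box : set (R * R) := `[(- r)%R, r]%classic `*` `[(- r)%R, r]%classic.
pose Z := box `&` (fun w : R * R => normc (f w - c)) @^-1` [set t : R | t <= r].
have cZ : compact Z.
  apply: compact_closedI; first by apply: compact_setX; exact: segment_compact.
  by apply: preimage_closed => [w _|]; [exact: cn|exact: closed_le].
rewrite (_ : [set w | _] = f @` Z).
  by apply: continuous_compact => //; apply: continuous_subspaceT => w; exact: cf.
apply/seteqP; split => w /=.
  move=> wr; exists (complex.Re (w - c), complex.Im (w - c)); last first.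
    by rewrite /f /=; case: (w - c) (subrK c w) => a b /= <-; rewrite addrC.
  split; last first.
    by rewrite /f /= addrC addKr; case: (w - c) wr.
  by split => /=; rewrite in_itv /= -ler_norml (le_trans _ wr)// ?le_Re_normc ?le_Im_normc.
by move=> [w' [_ H] <-].
Qed.

(** The least parameter whose point lies outside [D]: the points just before it are in [D], so it is
    in the closure. *)
Lemma segment_exit (D : set Cn) q y : open D -> D q -> ~ D y ->
  exists2 t : R, 0 <= t <= 1 & boundary D (q + (t%:C)%C *: (y - q)).
Proof.
move=> oD Dq nDy; pose g (t : R) := q + (t%:C)%C *: (y - q).
have cg : continuous g.
  move=> t; apply/rcontP; apply: rcont_line; last exact: rcont_cst.
  by apply: ccont_real.
pose Z := `[0, 1]%classic `&` (g @^-1` (~` D)).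
have cZ : compact Z.
  apply: compact_closedI; first exact: segment_compact.
  by apply: preimage_closed => [t _|]; [exact: cg|exact: open_closedC].
have g0 : g 0 = q by rewrite /g scale0r addr0.
have g1 : g 1 = y by rewrite /g scale1r addrC subrK.
have Z1 : Z 1 by split; rewrite /= ?in_itv /= ?ler01 ?lexx// g1.
have cid : {within Z, continuous (fun t : R => t)}.
  by apply: continuous_subspaceT => t; exact: cvg_id.
have [t] := compact_EVT_min (ex_intro _ 1 Z1) cZ cid.
rewrite inE => -[/=]; rewrite in_itv /= => /andP[t0 t1] nDt tmin.
have {}t0 : 0 < t.
  by rewrite lt_def t0 andbT; apply/eqP => tE; apply: nDt; rewrite tE g0.
exists t; first by rewrite (ltW t0).
split; last by move=> /interior_subset.
move=> B /= nB.
have /nbhs_normP[e /= e0 He] := cg t _ nB.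
pose s := Num.max 0 (t - e / 2).
have st : s < t by rewrite gt_max t0 /=; lra.
have s0 : 0 <= s by rewrite le_max lexx.
exists (g s); split; last first.
  apply: He; rewrite /= ger0_norm ?subr_ge0 ?ltW//.
  have : t - e / 2 <= s by rewrite le_max lexx orbT.
  lra.
apply: contrapT => nDs.
have : t <= s by apply: tmin; rewrite inE; split => //=; rewrite in_itv /= s0 (le_trans (ltW st)).
by rewrite leNgt st.
Qed.

(** Leaving [D] along the segment from [q] to [y] would produce a boundary point in [L] closer to
    [q] than [r]. The set [L] is either the whole space or a member of the flag. *)
Lemma ball_subset (D L : set Cn) q r y : open D -> D q ->
  (forall x, boundary D x -> L x -> r <= enorm (x - q)) ->
  (forall t : R, L (q + (t%:C)%C *: (y - q))) -> enorm (y - q) < r -> D y.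
Proof.
move=> oD Dq Hr Ly yr; apply: contrapT => nDy.
have [t /andP[t0 t1] bt] := segment_exit oD Dq nDy.
have := Hr _ bt (Ly t); rewrite addrC addKr enormZ normc_real ger0_norm// leNgt.
by rewrite (le_lt_trans _ yr)// ler_piMl// enorm_ge0.
Qed.

(** A coordinate in which [d] does not vanish recovers the parameter continuously. Zero direction is
    allowed because slices through a base point [z] and a variable point [w] degenerate at
    [w = z]. *)
Lemma line_fibre_sc (D : set Cn) (a d : Cn) : C_convex D -> (exists u : C, D (a + u *: d)) ->
  simply_connected R [set u : C | D (a + u *: d)].
Proof.
move=> cvx [u Du]; have [d0|d0] := eqVneq d 0.
  rewrite (_ : [set _ | _] = setT); first exact: simply_connectedT.
  by apply/seteqP; split => // v _ /=; rewrite d0 scaler0 -(scaler0 _ u) -d0.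
have [k dk] : exists k, d 0 k != 0.
  apply: contrapT => H; move/eqP: d0; apply; apply/rowP => k; rewrite mxE.
  by apply/eqP; apply: contrapT => /negP dk; apply: H; exists k.
pose l := [set a + t *: d | t in [set: C]].
apply: (@simply_connected_retract R Cn (fun u : C => a + u *: d)
  (fun x : Cn => (x 0 k - a 0 k) / d 0 k) _ (D `&` l)).
- move=> v; apply/rcontP; apply: rcont_line; [exact: ccont_id|exact: rcont_cst].
- move=> v; apply/ccontE; apply: ccontM; last exact: ccont_cst.
  by apply: ccontB; [exact: rcont_id|exact: ccont_cst].
- by move=> v; rewrite !mxE (addrC (a 0 k)) addrK mulfK.
- by move=> v Dv; split => //; exists v.
- by move=> x [Dx [t _ tE]]; move: Dx; rewrite -tE /= !mxE (addrC (a 0 k)) addrK mulfK.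
- apply: cvx; first by exists a, d.
  by exists (a + u *: d); split => //; exists u.
Qed.

(** For [c != 0], the ratio [S (- e) / S e] has square -1 and is thus constant along the half circle
    from [e] to [- e]. But its values at the two ends are inverse to each other, so their product is
    1 rather than -1. *)
Lemma circle_no_sqrt (S : C -> C) (c : C) (rho : R) : 0 < rho ->
  (forall e, normc e = rho -> ccont S e /\ S e ^+ 2 = c * conjc e) -> c = 0.
Proof.
move=> rho0 HS; apply/eqP; apply: contrapT => /negP c0.
pose e (t : R) : C := cexp (ln rho) (pi * t).
have ne t : normc (e t) = rho by rewrite normc_cexp lnK.
have e0 t : e t != 0 by exact: cexp_neq0.
have ce t : ccont e t.
  have cp : {for t, continuous (fun t : R => pi * t)}.
    by apply: continuousM; [exact: cst_continuous|].
  apply: ccont_ReIm; apply: continuousM; try exact: cst_continuous.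
    by apply: (@continuous_comp _ _ _ (fun t => pi * t) cos); [exact: cp|exact: continuous_cos].
  by apply: (@continuous_comp _ _ _ (fun t => pi * t) sin); [exact: cp|exact: continuous_sin].
have nNe t : normc (- e t) = rho by rewrite normcN.
have S0 (x : C) : normc x = rho -> S x != 0.
  move=> nx; rewrite -sqrf_eq0 (HS x nx).2 mulf_neq0// conjc_eq0 -normc_eq0 nx.
  by rewrite gt_eqF.
pose kap t := S (- e t) / S (e t).
have kap2 t : kap t ^+ 2 = -1.
  rewrite expr_div_n (HS _ (ne t)).2 (HS _ (nNe t)).2 rmorphN mulrN mulNr divff//.
  by rewrite mulf_neq0// conjc_eq0.
have ck t : ccont kap t.
  apply: ccontM.
    by apply: (@ccont_comp _ _ S (fun t => - e t)); [exact: ccontN|exact: (HS _ (nNe t)).1].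
  by apply: ccontV; [exact: S0|apply: ccont_comp => //; exact: (HS _ (ne t)).1].
have k01 := const_sqrt ck (fun t _ => kap2 t).
have e1 : e 1 = - e 0.
  by rewrite /e /cexp mulr1 mulr0 cospi sinpi cos0 sin0 !mulr0 mulrN1 mulr1;
    apply/eqP; rewrite eq_complex /= oppr0 !eqxx.
have : kap 0 * kap 1 = 1.
  rewrite /kap e1 opprK mulrA divfK ?divff ?S0//.
by rewrite -k01 -expr2 kap2 => /eqP; rewrite -subr_eq0 -opprD oppr_eq0 -mulr2n pnatr_eq0.
Qed.

(* If the complex tangent plane at [p] of the ball of centre [p + e] met [D] at
   [p + v], then [1] and a multiple of [conj eps] would lie in every fibre
   [{u | p + u (v + eps e) \in D}], which avoids [0]; continuing the square root of
   [u] between them would yield a continuous square root of [conj eps] on a circle. *)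
Lemma tangent_plane (D : set Cn) (p e v : Cn) : open D -> C_convex D -> ~ D p -> e != 0 ->
  (forall y, enorm (y - (p + e)) < enorm e -> D y) -> cdot v e = 0 -> ~ D (p + v).
Proof.
move=> oD cvx nDp e0 ball ve Dv.
have v0 : v != 0 by apply/eqP => v0; apply: nDp; rewrite -[p]addr0 -v0.
have ne0 : 0 < enorm e by rewrite enorm_gt0.
have nv0 : 0 < enorm v by rewrite enorm_gt0.
(* Chosen so that for [0 < normc eps < 1] the point with parameter [s * conjc eps] falls in the ball
   of centre [p + e] and radius [enorm e]: the component along [v] has order [eps], the gain along
   [e] order [eps] squared. *)
pose s : R := enorm e ^+ 2 / (enorm v ^+ 2 + enorm e ^+ 2).
have den0 : 0 < enorm v ^+ 2 + enorm e ^+ 2 by rewrite addr_gt0// exprn_gt0.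
have s0 : 0 < s by rewrite divr_gt0// exprn_gt0.
have [d [d0 d1 Hd]] : exists d : R, [/\ 0 < d, d <= 1 &
    forall eps : C, normc eps < d -> D (p + 1 *: (v + eps *: e))].
  have cl : rcont (fun eps : C => p + (1 : C) *: (v + eps *: e)) 0.
    apply: rcont_line; first exact: ccont_cst.
    by apply: rcont_line; [exact: ccont_id|exact: rcont_cst].
  have /rcontP cl' := cl.
  have : nbhs (p + (1 : C) *: (v + (0 : C) *: e)) D.
    by rewrite scale0r addr0 scale1r; exact: open_near.
  move=> /cl'/nbhs_normcP[d d0 Hd]; exists (Num.min d 1); split.
  - by rewrite lt_min d0 ltr01.
  - by rewrite ge_min lexx orbT.
  - by move=> eps; rewrite lt_min => /andP[epsd _]; apply: Hd; rewrite subr0.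
have [] := @family_sqrt R C [set eps : C | eps != 0 /\ normc eps < d]
  (fun eps : C => [set u : C | D (p + u *: (v + eps *: e))]) (fun _ (u : C) => u)
  (fun=> 1) (fun eps : C => (s%:C)%C * conjc eps) (fun=> 1).
- move=> eps [eps0 epsd].
  have n1 := ccont_near_neq0 (ccont_id eps) eps0.
  have dd : 0 < d - normc eps by rewrite subr_gt0.
  apply: filterS2 n1 (near_normc eps dd) => x x0 xe; split => //.
  by rewrite -(subrK eps x) (le_lt_trans (le_normcD _ _))// -ltrBrDr.
- by move=> eps [_ epsd]; apply: line_fibre_sc => //; exists 1; exact: Hd.
- move=> eps u _ Du.
  have cl : {for (eps, u), continuous (fun q : C * C => p + q.2 *: (v + q.1 *: e))}.
    apply/rcontP; apply: rcont_line; first by apply/ccontE; exact: cvg_snd.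
    by apply: rcont_line; [apply/ccontE; exact: cvg_fst|exact: rcont_cst].
  exact: cl _ (open_near oD Du).
- by move=> eps u _ _; apply/ccontE; exact: cvg_snd.
- by move=> eps u _ Du; apply/eqP => u0; apply: nDp; move: Du; rewrite /= u0 scale0r addr0.
- move=> eps [eps0 epsd]; split.
  + exact: ccont_cst.
  + by apply: ccontM; [exact: ccont_cst|apply: ccont_conj; exact: ccont_id].
  + exact: ccont_cst.
  + exact: Hd.
  + apply: ball; rewrite -(@ltr_pXn2r _ 2%N) ?nnegrE ?enorm_ge0//.
    set a := (s%:C)%C * conjc eps.
    have ae : a * eps = ((s * normc eps ^+ 2)%:C)%C.
      by rewrite /a -mulrA [conjc eps * eps]mulrC mul_conjc -rmorphM.
    rewrite (_ : _ - _ = a *: v + ((s * normc eps ^+ 2 - 1)%:C)%C *: e); last first.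
      have -> : ((s * normc eps ^+ 2 - 1)%:C)%C = a * eps - 1 by rewrite ae; exact: rmorphB.
      by apply/rowP => j; rewrite !mxE; ring.
    rewrite pythagoras// normcM normc_conj !normc_real gtr0_norm//.
    rewrite real_normK ?num_real//.
    have E0 : 0 < normc eps ^+ 2 by rewrite exprn_gt0// normc_gt0.
    have E1 : normc eps ^+ 2 < 1 by rewrite expr_lt1 ?normc_ge0//; exact: lt_le_trans epsd d1.
    have sE : s * (enorm v ^+ 2 + enorm e ^+ 2) = enorm e ^+ 2 by rewrite divfK// gt_eqF.
    have V0 : 0 < enorm v ^+ 2 by rewrite exprn_gt0.
    have F0 : 0 < enorm e ^+ 2 by rewrite exprn_gt0.
    move: E0 E1 sE V0 F0; rewrite exprMn.
    move: (normc eps ^+ 2) (enorm v ^+ 2) (enorm e ^+ 2) => t V F t0 t1 sE V0 F0.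
    have -> : s ^+ 2 * t * V + (s * t - 1) ^+ 2 * F =
       F + s * t * (s * V + s * t * F - 2 * F) by ring.
    rewrite -ltrBrDl subrr (pmulr_rlt0 _ (mulr_gt0 s0 t0)).
    have : s * t * F < s * F by rewrite ltr_pM2r// gtr_pMr.
    lra.
- by move=> eps _; rewrite expr1n.
move=> S HS.
have d20 : 0 < d / 2 by rewrite divr_gt0.
have := @circle_no_sqrt S ((s%:C)%C) (d / 2) d20 _.
have sC0 : (s%:C)%C != 0 :> C by rewrite -normc_eq0 normc_real normr_eq0 gt_eqF.
move=> H; move/eqP: sC0; apply; apply: H => x nx.
apply: HS; split; last by rewrite nx; lra.
by rewrite -normc_gt0 nx.
Qed.

Lemma nearest_boundary (D : set Cn) q y : open D -> D q -> ~ D y ->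
  exists p, [/\ boundary D p, enorm (p - q) <= enorm (y - q) &
    forall x, boundary D x -> enorm (p - q) <= enorm (x - q)].
Proof.
move=> oD Dq nDy; have [t /andP[t0 t1] bt] := segment_exit oD Dq nDy.
set x0 := q + _ in bt.
have x0y : enorm (x0 - q) <= enorm (y - q).
  by rewrite /x0 addrC addKr enormZ normc_real ger0_norm// ler_piMl// enorm_ge0.
pose r := enorm (x0 - q).
pose Q := [set x : Cn | forall j, normc (x 0 j - q 0 j) <= r].
have cQ : compact Q.
  apply: (@rV_compact C n (fun j => [set w : C | normc (w - q 0 j) <= r])) => j.
  exact: compact_disc.
pose Z := Q `&` boundary D.
have cZ : compact Z.
  apply: compact_closedI; first exact: cQ.
  apply: closedI; first exact: closed_closure.
  by apply: open_closedC; exact: open_interior.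
have QZ x : enorm (x - q) <= r -> Q x.
  move=> xr j; have := le_coord_enorm (x - q) j; rewrite !mxE => /le_trans; exact.
have Zx0 : Z x0 by split => //; apply: QZ.
have ce (x : Cn) : {for x, continuous (fun x : Cn => enorm (x - q))}.
  apply: (@cont_enorm Cn (fun x : Cn => x - q)).
  by apply: rcontB; [exact: rcont_id|exact: rcont_cst].
have cen : {within Z, continuous (fun x : Cn => enorm (x - q))}.
  apply: continuous_subspaceT => x; exact: ce.
have [p] := compact_EVT_min (ex_intro _ x0 Zx0) cZ cen.
move=> /set_mem[Qp bp] pmin; exists p.
have {}pmin x : Z x -> enorm (p - q) <= enorm (x - q) by move=> Zx; apply: pmin; exact/mem_set.
have pr : enorm (p - q) <= r by apply: pmin.
split => // [|x bx]; first exact: le_trans pr x0y.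
have [xr|rx] := leP (enorm (x - q)) r; last exact: le_trans pr (ltW rx).
by apply: pmin; split => //; exact: QZ.
Qed.

(* The boundary points that are nearest to a point of [D] are dense in the boundary, so
   the tangent planes there accumulate at a supporting plane at [p]. *)
Theorem supporting_hyperplane (D : set Cn) p : open D -> C_convex D -> boundary D p ->
  exists b, forall w, D w -> cdot (w - p) b != 0.
Proof.
move=> oD cvx bp; apply: contrapT => none.
have {}none b : exists w, D w /\ cdot (w - p) b = 0.
  apply: contrapT => H; apply: none; exists b => w Dw; apply/eqP => E.
  by apply: H; exists w.
pose Sp := [set b : Cn | enorm b = 1].
have cS : compact Sp.
  rewrite (_ : Sp = [set x : Cn | forall j, normc (x 0 j - 0) <= 1] `&` Sp); last first.
    apply/seteqP; split => [x nx|x []//]; split => //= j.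
    by rewrite subr0 -nx; exact: le_coord_enorm.
  apply: compact_closedI.
    by apply: (@rV_compact C n (fun=> [set w : C | normc (w - 0) <= 1])) => j; exact: compact_disc.
  have -> : Sp = (@enorm R n) @^-1` [set 1] by [].
  apply: preimage_closed => [x _|]; last exact: closed_eq.
  by apply: (@cont_enorm _ (fun x => x)); exact: rcont_id.
have /compact_near_coveringP cov := cS.
(* If every plane through [p] meets [D], compactness of the sphere of unit normals makes every plane
   through any nearby [p'] meet [D]. A nearest boundary point close to [p] will contradict this. *)
have : \forall p' \near p, Sp `<=` (fun b => exists w, D w /\ cdot (w - p') b = 0).
  apply: (cov Cn (nbhs p) (fun p' b => exists w, D w /\ cdot (w - p') b = 0)) => b /= nb.
  have [w [Dw wb]] := none b.
  (* The orthogonal projection of [w] onto the plane through [x.2] with normal [x.1]; it equals [w]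
     at [(b, p)] and stays in [D] nearby. *)
  pose W (x : Cn * Cn) := w + (- (cdot (w - x.2) x.1 / cdot x.1 x.1)) *: x.1.
  have bb : cdot b b != 0 by rewrite cdotvv nb expr1n oner_eq0.
  have c1 : rcont (fun x : Cn * Cn => x.1) (b, p) by apply/rcontP; exact: cvg_fst.
  have c2 : rcont (fun x : Cn * Cn => x.2) (b, p) by apply/rcontP; exact: cvg_snd.
  have cbb : ccont (fun x : Cn * Cn => cdot x.1 x.1) (b, p) by exact: ccont_cdot.
  have cW : rcont W (b, p).
    apply: rcont_line => //; apply: ccontN; apply: ccontM.
      by apply: ccont_cdot => //; apply: rcontB => //; exact: rcont_cst.
    exact: ccontV.
  have Wp : W (b, p) = w by rewrite /W /= wb mul0r oppr0 scale0r addr0.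
  have : \forall x \near (b, p), D (W x) /\ cdot x.1 x.1 != 0.
    apply: filterI; last exact: (ccont_near_neq0 cbb).
    have /rcontP cW' := cW.
    by apply: (cW' D); rewrite Wp; exact: open_near.
  move=> [[V1 V2] [/= n1 n2] H]; exists (V1, V2) => // -[b' p'] [/= V1b V2p].
  have [/= DW bb'] := H (b', p') (conj V1b V2p).
  exists (W (b', p')); split => //.
  rewrite (_ : W (b', p') - p' = (w - p') + (- (cdot (w - p') b' / cdot b' b')) *: b').
    by rewrite cdotDl cdotZl mulNr divfK// subrr.
  by rewrite /W addrAC.
move=> /nbhs_rowP[e e0 He].
have [clp _] := bp.
have e2 : 0 < e / 2 by rewrite divr_gt0.
(* Converts coordinatewise closeness to Euclidean closeness, with a strict inequality. *)
pose k : R := Num.sqrt n%:R + 1.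
have k0 : 0 < k by rewrite ltr_wpDl// sqrtr_ge0.
have ek : 0 < e / (2 * k) by rewrite divr_gt0// mulr_gt0.
have nB : nbhs p [set y : Cn | forall j, normc (y 0 j - p 0 j) < e / (2 * k)].
  by apply/nbhs_rowP; exists (e / (2 * k)).
have [q [Dq qp]] := clp _ nB.
have qpe : enorm (p - q) < e / 2.
  have : enorm (p - q) ^+ 2 <= n%:R * (e / (2 * k)) ^+ 2.
    rewrite enorm_sqr -[X in X%:R * _]card_ord mulr_natl -sumr_const.
    apply: ler_sum => j _; rewrite ler_pXn2r ?nnegrE ?normc_ge0 ?(ltW ek)//.
    by rewrite !mxE normcB ltW// qp.
  have -> : n%:R * (e / (2 * k)) ^+ 2 = (Num.sqrt n%:R * (e / (2 * k))) ^+ 2.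
    by rewrite [RHS]exprMn sqr_sqrtr.
  rewrite ler_pXn2r ?nnegrE ?enorm_ge0 ?(mulr_ge0 (sqrtr_ge0 _) (ltW ek))// => /le_lt_trans; apply.
  have -> : e / 2 = k * (e / (2 * k)) by field; rewrite gt_eqF.
  by rewrite ltr_pM2r// /k ltrDl.
have [p' [bp' p'q p'min]] := nearest_boundary oD Dq (boundary_notin oD bp).
have nDp' := boundary_notin oD bp'.
pose b := q - p'.
have b0 : b != 0 by rewrite subr_eq0; apply/eqP => E; apply: nDp'; rewrite -E.
have nb0 : 0 < enorm b by rewrite enorm_gt0.
have Hp' : forall j, normc (p' 0 j - p 0 j) < e.
  move=> j; rewrite (_ : _ - _ = (p' - q) 0 j - (p - q) 0 j); last by rewrite !mxE; ring.
  rewrite (le_lt_trans (le_normcB _ _))// [e]splitr.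
  have h1 := le_coord_enorm (p' - q) j; have h2 := le_coord_enorm (p - q) j.
  apply: ltrD.
    exact: le_lt_trans h1 (le_lt_trans p'q qpe).
  exact: le_lt_trans h2 qpe.
have nbC : (((enorm b)^-1)%:C)%C != 0 :> C.
  by rewrite -normc_eq0 normc_real normr_eq0 invr_eq0 gt_eqF.
have Sb : Sp ((((enorm b)^-1)%:C)%C *: b).
  by rewrite /Sp /= enormZ normc_real ger0_norm ?invr_ge0 ?enorm_ge0// mulVf// gt_eqF.
have [w [Dw wb]] := He p' Hp' _ Sb.
have wb0 : cdot (w - p') b = 0.
  rewrite -cdot_conj in wb; move/(congr1 conjc): wb; rewrite conjcK rmorph0 cdotZl => /eqP.
  rewrite mulf_eq0 (negbTE nbC) => /eqP E.
  by rewrite -cdot_conj E rmorph0.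
apply: (@tangent_plane D p' b (w - p') oD cvx nDp' b0 _ wb0); last by rewrite addrC subrK.
move=> y; rewrite /b [p' + _]addrC subrK => yq.
apply: (@ball_subset D setT q (enorm (q - p'))) => // x bx _.
by rewrite (enormB q); exact: p'min.
Qed.

End RowVectors.

(** * Holomorphic maps of the ball *)

Section Differentiability.
Context {R : realType}.
Local Notation C := R[i].

Lemma cderiv_differentiable (f : C -> C) x a : cderiv f x a -> differentiable f x.
Proof.
move=> [phi [cphi phia E]]; apply/derivable1_diffP/cvg_ex; exists a.
have H : (fun h : C => phi (h + x)) @ (0 : C)^' --> a.
  apply: cvg_within_filter.
  have c1 : ccont (fun h : C => h + x) 0 by apply: ccontD; [exact: ccont_id|exact: ccont_cst].
  have c2 : ccont (fun h : C => phi (h + x)) 0 by apply: (ccont_comp c1); rewrite add0r.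
  have -> : a = (fun h : C => phi (h + x)) 0 by rewrite /= add0r phia.
  exact: (ccontE _ _).1 c2.
apply: cvg_trans H; apply: near_eq_cvg.
apply: filterS (nbhs_dnbhs_neq (0 : C)) => h h0.
rewrite /= -[h *: 1]/(h * 1) mulr1 E addrK -[_ *: _]/(_ * _).
by rewrite mulrCA mulVf ?mulr1.
Qed.

Lemma cderiv_line m n (f : 'rV[C]_m -> 'rV[C]_n) (a v : 'rV[C]_m) (t : C) j :
  differentiable f (a + t *: v) ->
  cderiv (fun s => f (a + s *: v) 0 j) t ((v *m 'J f (a + t *: v)) 0 j).
Proof.
move=> df; have := diff_derivable (v := v) df; have := deriveEjacobian v df.
set b := a + t *: v; set A := v *m _ => <- db.
have {}db : (fun h : C => h^-1 *: ((f \o shift b) (h *: v) - f b)) @ (0 : C)^' --> 'D_v f b by [].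
apply/cderivP => e e0.
have : nbhs ('D_v f b) [set y : 'rV[C]_n | forall i, normc (y 0 i - ('D_v f b) 0 i) < e].
  by apply/nbhs_rowP; exists e.
move=> /db/nbhs_normcP[d d0 Hd].
apply/nbhs_normcP; exists d => // s sd.
have [->|st] := eqVneq s t; first by rewrite !subrr mulr0 subr0 normc0 mulr0.
have st0 : s - t != 0 by rewrite subr_eq0.
have := Hd (s - t); rewrite subr0 => /(_ sd st0 j).
rewrite !mxE /shift /=.
have -> : (s - t) *: v + b = a + s *: v by rewrite /b scalerBl addrCA subrK.
move=> H; rewrite -ler_pdivrMr ?normc_gt0// -normcV -normcM ltW//.
by rewrite mulrBl mulfK// [(_ - _) / _]mulrC.
Qed.

Lemma jacobian_comp m n k (f : 'rV[C]_m -> 'rV[C]_n) (g : 'rV[C]_n -> 'rV[C]_k) x :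
  differentiable f x -> differentiable g (f x) -> 'J (g \o f) x = 'J f x *m 'J g (f x).
Proof.
move=> df dg; apply/row_matrixP => i; rewrite !rowE mulmxA /jacobian !mul_rV_lin1.
by rewrite diff_comp.
Qed.

(** The Schwarz lemma: the maximum principle for [f z / z] on the circle of radius [rho], with [rho]
    tending to 1. *)
Lemma schwarz_deriv (f : C -> C) a : f 0 = 0 ->
  (forall z, normc z < 1 -> normc (f z) < 1 /\ exists b, cderiv f z b) ->
  cderiv f 0 a -> normc a <= 1.
Proof.
move=> f0 Hf [phi [cphi phia E]].
have {}E z : f z = phi z * z by have := E z; rewrite f0 !subr0.
suff H (rho : R) : 0 < rho -> rho < 1 -> normc a <= rho^-1.
  apply/ler_addgt0Pr => e e0.
  have e1 : 0 < 1 + e by rewrite addr_gt0.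
  rewrite -[1 + e]invrK; apply: H; first by rewrite invr_gt0.
  by rewrite invf_lt1// ltrDl.
move=> rho0 rho1; rewrite -phia; apply: (maximum_principle rho0 rho1).
- move=> z z1; have [->//|z0] := eqVneq z 0.
  have [_ [b /cderiv_cont cf]] := Hf z z1.
  apply: (@ccont_eq_near _ _ (fun z => f z / z)).
    by apply: filterS (ccont_near_neq0 (ccont_id z) z0) => w w0; rewrite E mulfK.
  by apply: ccontM => //; apply: ccontV => //; exact: ccont_id.
- move=> z z0 z1; have [_ [b df]] := Hf z z1; eexists.
  apply: (@cderiv_eq _ (fun z => f z / z)).
    by apply: filterS (ccont_near_neq0 (ccont_id z) z0) => w w0; rewrite E mulfK.
  by apply: cderivM df _; apply: cderivV => //; exact: cderiv_id.
- move=> z zr; have := (Hf z _).1; rewrite zr => /(_ rho1)/ltW.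
  by rewrite E normcM zr -ler_pdivlMr// mul1r.
Qed.

Section Ball.
Context {n : nat}.
Local Notation Cn := 'rV[C]_n.
Local Notation ball := (@unit_ball R n).
Implicit Types (D : set Cn).

Lemma holomorphic_comp D1 D2 D3 (f g : Cn -> Cn) :
  holomorphic D1 D2 f -> holomorphic D2 D3 g -> holomorphic D1 D3 (g \o f).
Proof.
move=> [df Df] [dg Dg]; split => x Dx; last by apply: Dg; exact: Df.
by apply: differentiable_comp; [exact: df|apply: dg; exact: Df].
Qed.

Lemma unit_ball0 : ball (0 : Cn).
Proof. by rewrite /unit_ball /= enorm0 ltr01. Qed.

(** The one-variable Schwarz lemma, applied to coordinate [j] of [G] on the disc along axis [i]. *)
Lemma jacobian_entry_le1 (G : Cn -> Cn) i j : holomorphic ball ball G -> G 0 = 0 ->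
  normc ('J G 0 i j) <= 1.
Proof.
move=> [dG BG] G0; pose v : Cn := delta_mx 0 i.
have nv : enorm v = 1.
  apply/eqP; rewrite -(@eqrXn2 _ 2%N) ?enorm_ge0// enorm_sqr expr1n (bigD1 i)//=.
  rewrite mxE !eqxx normc1 expr1n big1 ?addr0// => k /negbTE ki.
  by rewrite mxE ki andbF normc0 expr0n.
have inB (t : C) : normc t < 1 -> ball (0 + t *: v).
  by rewrite /unit_ball /= add0r enormZ nv mulr1.
have der (t : C) : normc t < 1 ->
    cderiv (fun s => G (0 + s *: v) 0 j) t ((v *m 'J G (0 + t *: v)) 0 j).
  by move=> t1; apply: cderiv_line; exact: dG (inB t t1).
apply: (@schwarz_deriv (fun s => G (0 + s *: v) 0 j)).
- by rewrite scale0r addr0 G0 mxE.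
- move=> t t1; split; last by eexists; exact: der.
  exact: le_lt_trans (le_coord_enorm _ j) (BG _ (inB t t1)).
- have := der 0; rewrite normc0 ltr01 scale0r addr0 => /(_ isT).
  by rewrite -rowE mxE.
Qed.

(* The Jacobians of the iterates of [G] are the powers of ['J G 0] and have bounded
   entries. *)
Lemma schwarz_det (G : Cn -> Cn) : holomorphic ball ball G -> G 0 = 0 ->
  normc (\det ('J G 0)) <= 1.
Proof.
move=> hG G0.
have it k : [/\ holomorphic ball ball (iter k G), iter k G 0 = 0 &
    \det ('J (iter k G) 0) = \det ('J G 0) ^+ k].
  elim: k => [|k [hk k0 dk]].
    split => //; last first.
      rewrite expr0 -(det1 _ n); congr (\det _); apply/row_matrixP => i.
      rewrite !rowE /jacobian mul_rV_lin1 mulmx1.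
      by rewrite (_ : iter 0 G = id)// diff_val.
  split.
  - exact: (holomorphic_comp hk hG).
  - by rewrite /= k0.
  - rewrite exprSr -dk -det_mulmx -[X in 'J G X]k0 -jacobian_comp//.
      by have [dd _] := hk; exact: dd unit_ball0.
    by rewrite k0; have [dd _] := hG; exact: dd unit_ball0.
apply: (@linear_power_bound _ _ n`!%:R); first exact: normc_ge0.
move=> k; have [hk k0 dk] := it k.
rewrite -normcX -dk (le_trans (normc_det_le (fun i j => jacobian_entry_le1 i j hk k0)))//.
by rewrite expr1n mulr1 ler_peMr// ler1n.
Qed.

(** The composite is a self-map of the ball fixing 0. One explicit map in either direction therefore
    bounds all competitors in the other. *)
Lemma jac2_mul_le1 D (f g : Cn -> Cn) z : D z ->
  holomorphic D ball f -> f z = 0 -> holomorphic ball D g -> g 0 = z ->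
  jac2 f z * jac2 g 0 <= 1.
Proof.
move=> Dz hf fz hg g0.
rewrite /jac2 -exprMn -normcM mulrC -det_mulmx -[X in 'J f X]g0 -jacobian_comp.
- rewrite exprn_ile1 ?normc_ge0//; apply: schwarz_det; first exact: holomorphic_comp hg hf.
  by rewrite /= g0.
- by have [dd _] := hg; exact: dd unit_ball0.
- by rewrite g0; have [dd _] := hf; exact: dd.
Qed.

End Ball.
End Differentiability.

(** * Square roots on a C-convex domain and their descent along an affine form *)

Section Functional.
Context {R : realType} {n : nat}.
Local Notation C := R[i].
Local Notation Cn := 'rV[C]_n.
Context (D : set Cn) (z : Cn).
Hypotheses (oD : open D) (cvx : C_convex D) (Dz : D z).

(** The root is continued from [z] to [w] inside the slice of [D] by the line through these two
    points. *)
Lemma C_convex_sqrt (K : Cn -> C) : (forall w, D w -> ccont K w /\ K w != 0) ->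
  exists k : Cn -> C, forall w, D w -> ccont k w /\ k w ^+ 2 = K w.
Proof.
move=> HK.
pose L (q : Cn * C) : Cn := z + q.2 *: (q.1 - z).
have L1 w : L (w, 1) = w by rewrite /L /= scale1r addrC subrK.
have L0 w : L (w, 0) = z by rewrite /L /= scale0r addr0.
have cL (q : Cn * C) : {for q, continuous L}.
  apply/rcontP; apply: rcont_line; first by apply/ccontE; exact: cvg_snd.
  by apply: rcontB; [apply/rcontP; exact: cvg_fst|exact: rcont_cst].
have [] := @family_sqrt R Cn D (fun w => [set u : C | D (L (w, u))]) (fun w u => K (L (w, u)))
  (fun=> 0) (fun=> 1) (fun=> sqrtC (K z)).
- by move=> w; exact: open_near.
- move=> w Dw; apply: (@line_fibre_sc R n D z (w - z)) => //.
  by exists 1; move: Dw; rewrite -{1}(L1 w).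
- by move=> w u Dw Du; have := cL (w, u) _ (open_near oD Du); apply: filterS => -[].
- move=> w u Dw Du.
  rewrite (_ : (fun q : Cn * C => _) = fun q => K (L q)); last by apply/funext => -[].
  by apply: (@ccont_precomp _ _ _ K L); [exact: cL|exact: (HK _ Du).1].
- by move=> w u Dw Du; exact: (HK _ Du).2.
- move=> w Dw; split; try exact: ccont_cst; first by rewrite /= L0.
  by rewrite /= L1.
- by move=> w Dw; rewrite L0 sqrtCK.
by move=> k Hk; exists k => w Dw; have := Hk w Dw; rewrite L1.
Qed.

Context (p b : Cn).
Hypothesis (Hb : forall w, D w -> cdot (w - p) b != 0).
Let h (w : Cn) : C := cdot (w - p) b / cdot (z - p) b.
Let G : set C := [set h w | w in D].

Lemma cdot_base : cdot (z - p) b != 0.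
Proof. exact: Hb. Qed.

Lemma form_line (w v : Cn) (t : C) : h (w + t *: v) = h w + t * (cdot v b / cdot (z - p) b).
Proof. rewrite /h (_ : w + t *: v - p = (w - p) + t *: v); last by rewrite addrAC.
by rewrite cdotDl cdotZl mulrDl mulrA. Qed.

(** The direction along which [h] grows at unit speed; translations along it are local sections of
    [h]. *)
Let d : Cn := (cdot (z - p) b / cdot b b) *: b.

Lemma form_section (w : Cn) (t : C) : h (w + t *: d) = h w + t.
Proof.
have bb : cdot b b != 0.
  rewrite cdotvv -normc_eq0 normc_real normr_eq0 expf_neq0// enorm_eq0.
  by apply: contraNneq cdot_base => ->; rewrite -cdot_conj cdot0l rmorph0.
by rewrite form_line /d cdotZl divfK// divff ?mulr1// cdot_base.
Qed.

Lemma ccont_form w : ccont h w.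
Proof.
apply: ccontM; last exact: ccont_cst.
by apply: ccont_cdot; [apply: rcontB; [exact: rcont_id|exact: rcont_cst]|exact: rcont_cst].
Qed.

Lemma near_section w : D w -> \forall u \near h w, D (w + (u - h w) *: d).
Proof.
move=> Dw.
have : {for h w, continuous (fun u : C => w + (u - h w) *: d)}.
  apply/rcontP; apply: rcont_line; last exact: rcont_cst.
  by apply: ccontB; [exact: ccont_id|exact: ccont_cst].
by apply; rewrite subrr scale0r addr0; exact: open_near.
Qed.

(** The line through [w1] and [w2] lies in a level set of [h], so on a path joining them in its
    slice of [D] the function [k] is a continuous root of a constant. *)
Lemma fibre_sqrt (K : C -> C) (k : Cn -> C) :
  (forall w, D w -> ccont k w /\ k w ^+ 2 = K (h w)) ->
  forall w1 w2, D w1 -> D w2 -> h w1 = h w2 -> k w1 = k w2.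
Proof.
move=> Hk w1 w2 D1 D2 h12.
pose l (u : C) : Cn := w1 + u *: (w2 - w1).
have l0 : l 0 = w1 by rewrite /l scale0r addr0.
have l1 : l 1 = w2 by rewrite /l scale1r addrC subrK.
have hl u : h (l u) = h w1.
  rewrite form_line; have := form_line w1 (w2 - w1) 1; rewrite scale1r [w1 + _]addrC subrK -h12.
  by rewrite mul1r => /eqP; rewrite -subr_eq0 opprD addNKr oppr_eq0 => /eqP ->; rewrite mulr0 addr0.
have sc : simply_connected R [set u : C | D (l u)].
  by apply: line_fibre_sc => //; exists 0; move: D1; rewrite -{1}l0.
have A0 : [set u : C | D (l u)] 0 by rewrite /= l0.
have A1 : [set u : C | D (l u)] 1 by rewrite /= l1.
have [g [cg Ag g0 g1]] := simply_connected_path sc A0 A1.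
have := @const_sqrt R (fun t => k (l (g t))) (K (h w1)).
rewrite g0 g1 l0 l1; apply => [t|t _]; last by rewrite (Hk _ (Ag t)).2 hl.
apply: (@ccont_precomp _ _ _ k (fun t : R => l (g t))); last exact: (Hk _ (Ag t)).1.
by apply/rcontP; apply: rcont_line; [exact: cg|exact: rcont_cst].
Qed.

(* [h] maps [D] onto a planar domain that inherits square roots from [D], because the
   fibres of [h] in [D] are path connected. *)
Lemma koebe_functional (eta : R) : 0 < eta -> exists F l,
  [/\ forall w, D w -> normc (F (h w)) < 1 /\ exists a, cderiv F (h w) a, F 1 = 0,
      cderiv F 1 l & 1 / 4 - eta < normc l].
Proof.
move=> eta0.
have oG u : G u -> \forall v \near u, G v.
  move=> [w Dw <-]; apply: filterS (near_section Dw) => v Dv.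
  by exists (w + (v - h w) *: d) => //; rewrite form_section addrC subrK.
have G1 : G 1 by exists z => //; rewrite /h divff// cdot_base.
have G0 : ~ G 0.
  by move=> [w Dw /eqP]; rewrite /h mulf_eq0 invr_eq0 (negbTE cdot_base) orbF (negbTE (Hb Dw)).
have [K HK|F [l [HF F1 Fl nl]]] := @koebe_quarter R G oG G1 G0 _ eta eta0; last first.
- by exists F, l; split => // w Dw; apply: HF; exists w.
have [k Hk] : exists k : Cn -> C, forall w, D w -> ccont k w /\ k w ^+ 2 = K (h w).
  apply: C_convex_sqrt => w Dw; have Gw : G (h w) by exists w.
  split; last exact: (HK _ Gw).2.
  by apply: ccont_precomp; [apply/ccontE; exact: ccont_form|exact: (HK _ Gw).1].
have ex u : exists x : C, forall w, D w -> h w = u -> x = k w.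
  have [[w Dw hw]|nG] := pselect (G u); last first.
    by exists 0 => w Dw hw; exfalso; apply: nG; exists w.
  by exists (k w) => w' Dw' hw'; apply: (fibre_sqrt Hk) => //; rewrite hw'.
have [kG HkG] := choice ex.
exists kG => u [w Dw <-]; rewrite (HkG _ w)//; split; last exact: (Hk w Dw).2.
apply: (@ccont_eq_near _ _ (fun v => k (w + (v - h w) *: d))).
  apply: filterS (near_section Dw) => v Dv.
  by rewrite (HkG v _ Dv)// form_section addrC subrK.
apply: (@ccont_precomp _ _ _ k (fun v : C => w + (v - h w) *: d)).
  apply/rcontP; apply: rcont_line; last exact: rcont_cst.
  by apply: ccontB; [exact: ccont_id|exact: ccont_cst].
by rewrite subrr scale0r addr0; exact: (Hk w Dw).1.
Qed.

End Functional.

(** * Minimal flags *)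

Section Flag.
Context {R : realType} {n : nat}.
Local Notation C := R[i].
Local Notation Cn := 'rV[C]_n.
Local Notation ball := (@unit_ball R n).
Implicit Types (w v b : Cn).

Lemma differentiable_cdot b w : differentiable (fun v : Cn => cdot v b : C) w.
Proof.
rewrite (_ : (fun v : Cn => _) = \sum_(k < n) (fun v : Cn => v 0 k *: (conjc (b 0 k) : C))).
  by apply: differentiable_sum => k; apply: differentiableZl; exact: differentiable_coord.
by apply/funext => v; rewrite fct_sumE.
Qed.

Lemma differentiable_row (f : 'I_n -> Cn -> C) w : (forall j, differentiable (f j) w) ->
  differentiable (fun v : Cn => \row_j f j v : Cn) w.
Proof.
move=> df; rewrite (_ : (fun v : Cn => _) = \sum_(j < n) (fun v : Cn => f j v *: (delta_mx 0 j : Cn))).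
  by apply: differentiable_sum => j; exact: differentiableZl.
apply/funext => v; rewrite fct_sumE; apply/rowP => j; rewrite summxE mxE (bigD1 j)//=.
rewrite !mxE !eqxx mulr1 big1 ?addr0// => k /negbTE kj.
by rewrite !mxE eq_sym kj mulr0.
Qed.

Lemma minimal_flagP (z : Cn) p j w : minimal_flag z p j w <->
  forall i, (i < j)%N -> cdot (w - z) (p i - z) = 0.
Proof.
elim: j => [|j IH]; first by split.
rewrite /= /setI /= dotmx_cdot; split.
  by move=> [/IH H jw] i; rewrite ltnS leq_eqVlt => /orP[/eqP ->//|/H].
by move=> H; split; [apply/IH => i ij; apply: H; exact: ltnW|exact: H].
Qed.

Context (n0 : (0 < n)%N) (D : set Cn) (z : Cn) (p : nat -> Cn).
Hypotheses (oD : open D) (cvx : C_convex D) (Dz : D z) (hp : minimal_points D z p).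
Implicit Types (i j k : 'I_n).

Lemma minimal_boundary j : boundary D (p j).
Proof. by have [[]] := hp (ltn_ord j). Qed.

Lemma minimal_gt0 j : 0 < enorm (p j - z).
Proof.
rewrite enorm_gt0 subr_eq0; apply/eqP => E.
by apply: (boundary_notin oD (minimal_boundary j)); rewrite E.
Qed.

Lemma minimal_orthogonal i j : i != j -> cdot (p i - z) (p j - z) = 0.
Proof.
wlog ji : i j / (j < i)%N => [H ij|_].
  have [/H|/H|/val_inj E] := ltngtP j i; [exact| |by rewrite E eqxx in ij].
  by move=> E; rewrite -cdot_conj E ?rmorph0// eq_sym.
by have [[_ /minimal_flagP H] _] := hp (ltn_ord i); exact: H.
Qed.

Lemma minimal_ball j w : (forall i, (i < j)%N -> cdot w (p i - z) = 0) ->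
  enorm w < enorm (p j - z) -> D (z + w).
Proof.
move=> fw wj.
apply: (@ball_subset R n D (minimal_flag z p j) z (enorm (p j - z))) => //.
- by move=> x bx fx; have [_] := hp (ltn_ord j); apply.
- move=> t; apply/minimal_flagP => i ij.
  by rewrite !(addrC z) !addrK cdotZl (fw (Ordinal (ltn_trans ij (ltn_ord j))) ij) mulr0.
- by rewrite addrC addKr.
Qed.

(* A hyperplane through [p j] missing [D] is parallel to [p k - z] for [k > j]: otherwise
   it would meet the span of [p j - z] and [p k - z] closer to [z] than [p j]. *)
Lemma support_orthogonal j k b : (j < k)%N -> (forall w, D w -> cdot (w - p j) b != 0) ->
  cdot (p k - z) b = 0.
Proof.
move=> jk Hb; apply/eqP; apply: contrapT => /negP c0.
set c := cdot (p k - z) b in c0; pose be := cdot (p j - z) b.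
pose A : R := enorm (p j - z) ^+ 2.
pose M : R := normc (be / c) ^+ 2 * enorm (p k - z) ^+ 2.
have A0 : 0 < A by rewrite exprn_gt0// minimal_gt0.
have M0 : 0 <= M by rewrite mulr_ge0 ?sqr_ge0.
have AM : 0 < A + M by rewrite ltr_wpDr.
(* For every real [s] the form takes the same value at [u] as at [p j - z]. This [s] minimises the
   norm of [u], whose square becomes [A * M / (A + M) < A]. *)
pose s := A / (A + M).
pose u := ((1 - s)%:C)%C *: (p j - z) + ((s%:C)%C * (be / c)) *: (p k - z).
have kj : k != j by rewrite -val_eqE /= gtn_eqF.
have : D (z + u).
  apply: (@minimal_ball j) => [i ij|].
    rewrite /u cdotDl !cdotZl !minimal_orthogonal ?mulr0 ?addr0// -val_eqE /= gtn_eqF//.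
    exact: ltn_trans jk.
  rewrite -(@ltr_pXn2r _ 2%N) ?nnegrE ?enorm_ge0//.
  rewrite /u pythagoras; last by rewrite minimal_orthogonal// eq_sym.
  rewrite normcM !normc_real exprMn !real_normK ?num_real// -/A.
  rewrite [X in X < _](_ : _ = (1 - s) ^+ 2 * A + s ^+ 2 * M); last first.
    by congr (_ + _); rewrite /M; exact: esym (mulrA _ _ _).
  rewrite (_ : _ + _ = A * (M / (A + M))); last by rewrite /s; field; rewrite gt_eqF.
  by rewrite gtr_pMr// ltr_pdivrMr// mul1r ltrDr.
move=> /Hb /negP; apply.
rewrite (_ : z + u - p j = u - (p j - z)); last by rewrite opprB [RHS]addrCA addrA.
have -> : cdot (u - (p j - z)) b =
    ((1 - s)%:C)%C * be + (s%:C)%C * (be / c) * c - be.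
  by rewrite (cdotBl u) /u (cdotDl (_ *: _)) !cdotZl.
rewrite -mulrA divfK//.
have -> : ((1 - s)%:C)%C = 1 - (s%:C)%C :> C by exact: rmorphB.
by apply/eqP; ring.
Qed.

Definition flag_mx : 'M[C]_n := \matrix_(k, j) (p k - z) 0 j.

Lemma row_flag_mx k : row k flag_mx = p k - z.
Proof. by apply/rowP => j; rewrite !mxE. Qed.

(** The rows are mutually orthogonal, so the product with the conjugate transpose is diagonal with
    the squared lengths as entries. *)
Lemma normc_det_flag_mx : normc (\det flag_mx) = minimal_product z p.
Proof.
have pos : 0 <= minimal_product z p.
  by apply: prodr_ge0 => k _; exact: enorm_ge0.
apply/eqP; rewrite -(@eqrXn2 _ 2%N) ?normc_ge0//; apply/eqP.
apply: (@complexI R); rewrite -mul_conjc.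
rewrite -det_map_mx -[\det (map_mx _ _)]det_tr -det_mulmx.
have -> : flag_mx *m (map_mx conjc flag_mx)^T =
    diag_mx (\row_k ((enorm (p k - z) ^+ 2)%:C)%C).
  apply/matrixP => i k; rewrite !mxE.
  rewrite (_ : \sum__ _ = cdot (p i - z) (p k - z)); last first.
    by apply: eq_bigr => j _; rewrite !mxE.
  have [->|ik] := eqVneq i k; first by rewrite cdotvv mulr1n.
  by rewrite minimal_orthogonal// mulr0n.
rewrite det_diag /minimal_product -prodrXl rmorph_prod.
by apply: eq_bigr => k _; rewrite mxE.
Qed.

Let r : R := (Num.sqrt n%:R)^-1.

Lemma sqr_invsqrt : r ^+ 2 = n%:R^-1.
Proof. by rewrite exprVn sqr_sqrtr. Qed.

Lemma sum_sqr_invsqrt : \sum_(j < n) r ^+ 2 = 1.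
Proof.
by rewrite sumr_const card_ord sqr_invsqrt -[LHS]mulr_natl divff// pnatr_eq0 -lt0n.
Qed.

Lemma invsqrt_gt0 : 0 < r.
Proof. by rewrite invr_gt0 sqrtr_gt0 ltr0n. Qed.

Lemma exists_caratheodory_map (s : R) : 0 < s -> s < 1 / 4 -> exists F : Cn -> Cn,
  [/\ holomorphic D ball F, F z = 0 &
      (s ^+ 2 / n%:R) ^+ n <= jac2 F z * minimal_product z p ^+ 2].
Proof.
move=> s0 s4.
pose h b j w : C := cdot (w - p j) b / cdot (z - p j) b.
pose P j (t : Cn * (C -> C) * C) :=
  [/\ forall w, D w -> cdot (w - p j) t.1.1 != 0,
      forall w, D w -> normc (t.1.2 (h t.1.1 j w)) < 1 /\ exists a, cderiv t.1.2 (h t.1.1 j w) a,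
      t.1.2 1 = 0, cderiv t.1.2 1 t.2 & s < normc t.2].
have [T HT] : exists T : 'I_n -> Cn * (C -> C) * C, forall j, P j (T j).
  suff /choice[T HT] : forall j, exists t, P j t by exists T.
  move=> j.
  have [b Hb] := supporting_hyperplane oD cvx (minimal_boundary j).
  have e0 : 0 < 1 / 4 - s by rewrite subr_gt0.
  have [F [l [HF F1 Fl nl]]] := koebe_functional oD cvx Dz Hb e0.
  by exists (b, F, l); split => //=; move: nl; rewrite subKr.
pose b j := (T j).1.1; pose F j := (T j).1.2; pose l j := (T j).2.
pose c j := cdot (z - p j) (b j).
have c0 j : c j != 0 by have [Hb _ _ _ _] := HT j; exact: Hb.
have hz j : h (b j) j z = 1 by rewrite /h divff//; exact: c0.
(* Each coordinate factors through a linear form, which reduces differentiability in [n] variables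
   to that of a function of one variable. *)
pose g j (u : C) : C := (r%:C)%C * F j ((u - cdot (p j) (b j)) / c j).
pose G w : Cn := \row_j g j (cdot w (b j)).
have gE j w : g j (cdot w (b j)) = (r%:C)%C * F j (h (b j) j w).
  by rewrite /g /h cdotBl.
have dlin j (u : C) : cderiv (fun u => (u - cdot (p j) (b j)) / c j) u (1 / c j).
  have := cderivM (cderivB (cderiv_id u) (cderiv_cst (cdot (p j) (b j)) u)) (cderiv_cst (c j)^-1 u).
  by rewrite subr0 mulr0 addr0.
have dg j w a : cderiv (F j) (h (b j) j w) a ->
    cderiv (g j) (cdot w (b j)) ((r%:C)%C * (a * (1 / c j))).
  move=> Fa; have dF : cderiv (fun u => F j ((u - cdot (p j) (b j)) / c j)) (cdot w (b j)) (a * (1 / c j)).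
    by apply: (cderiv_comp (dlin j _)); rewrite -cdotBl.
  by have := cderivM (cderiv_cst (r%:C)%C _) dF; rewrite mul0r add0r.
have dG w : D w -> differentiable G w.
  move=> Dw; apply: differentiable_row => j.
  have [_ /(_ w Dw)[_ [a Fa]] _ _ _] := HT j.
  apply: (@differentiable_comp _ _ _ _ (fun v => cdot v (b j)) (g j)).
    exact: differentiable_cdot.
  exact: cderiv_differentiable (dg j w a Fa).
exists G; split; first split => //.
- move=> w Dw; rewrite /unit_ball /= -(@ltr_pXn2r _ 2%N) ?nnegrE ?enorm_ge0// expr1n enorm_sqr.
  rewrite -sum_sqr_invsqrt.
  apply: ltr_sum.
    by apply/hasP; exists (Ordinal n0); rewrite ?mem_index_enum.
  move=> j _; rewrite mxE gE normcM normc_real gtr0_norm ?invsqrt_gt0//.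
  have [_ /(_ w Dw)[F1 _] _ _ _] := HT j.
  by rewrite exprMn gtr_pMr ?exprn_gt0 ?invsqrt_gt0// expr_lt1// normc_ge0.
- apply/rowP => j; rewrite !mxE gE hz.
  by have [_ _ F1 _ _] := HT j; rewrite [F j 1]F1 mulr0.
have JG v j : (v *m 'J G z) 0 j = (r%:C)%C * (l j * (cdot v (b j) / c j)).
  have := @cderiv_line R n n G z v 0 j; rewrite scale0r addr0 => /(_ (dG z Dz)) H1.
  apply: (cderiv_unique H1).
  rewrite (_ : (fun t => _) = fun t => g j (cdot z (b j) + t * cdot v (b j))); last first.
    by apply/funext => t; rewrite mxE cdotDl cdotZl.
  have [_ _ _ Fl _] := HT j; rewrite -[1](hz j) in Fl.
  have gl := dg j z (l j) Fl.
  have dl : cderiv (fun t : C => cdot z (b j) + t * cdot v (b j)) 0 (cdot v (b j)).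
    have := cderivD (cderiv_cst (cdot z (b j)) 0) (cderivM (cderiv_id 0) (cderiv_cst (cdot v (b j)) 0)).
    by rewrite mul1r mulr0 addr0 add0r.
  rewrite (_ : (r%:C)%C * _ = ((r%:C)%C * (l j * (1 / c j))) * cdot v (b j)); last by ring.
  by apply: (cderiv_comp dl); rewrite mul0r addr0.
rewrite /jac2 -normc_det_flag_mx -exprMn -normcM [\det _ * \det _]mulrC -det_mulmx -det_tr.
have EJ i j : (flag_mx *m 'J G z)^T i j = (r%:C)%C * (l i * (cdot (p j - z) (b i) / c i)).
  by rewrite mxE -JG -row_flag_mx -row_mul [RHS]mxE.
rewrite det_trig; last first.
  apply/is_trig_mxP => i j ij; rewrite EJ.
  have [Hb _ _ _ _] := HT i.
  by rewrite (support_orthogonal ij Hb) mul0r !mulr0.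
rewrite normc_prod.
(* Each diagonal entry has modulus [r * normc (l i)], hence at least [r * s], where [r ^+ 2] is the
   inverse of [n]. *)
have -> : (s ^+ 2 / n%:R) ^+ n = (\prod_(i < n) (r * s)) ^+ 2.
  by rewrite prodr_const card_ord [RHS]exprAC [(r * s) ^+ 2]exprMn sqr_invsqrt [in RHS]mulrC.
rewrite ler_pXn2r ?nnegrE ?prodr_ge0//; last 2 first.
- by move=> i _; rewrite mulr_ge0// ltW// invsqrt_gt0.
- by move=> i _; exact: normc_ge0.
apply: ler_prod => i _; rewrite mulr_ge0 ?(ltW s0) ?(ltW invsqrt_gt0)//=.
rewrite EJ.
rewrite (_ : cdot (p i - z) (b i) = - c i); last first.
  by rewrite /c -opprB -scaleN1r cdotZl mulN1r.
rewrite mulNr divff// !normcM normcN normc1 mulr1 normc_real gtr0_norm ?invsqrt_gt0//.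
by rewrite ler_pM2l ?invsqrt_gt0//; have [_ _ _ _ /ltW] := HT i.
Qed.

(** If the image of [w] were outside [D], the segment from [z] would exit at some [x] with a
    supporting form. In absolute value that form is at most [normc be] on every [p k - z], so on
    [x - z], a combination with coefficients [t * r * w 0 k], it would be strictly below [normc be],
    its own modulus there. *)
Lemma exists_kobayashi_map : exists psi : Cn -> Cn,
  [/\ holomorphic ball D psi, psi 0 = z & jac2 psi 0 = minimal_product z p ^+ 2 / n%:R ^+ n].
Proof.
pose q j : Cn := \row_k conjc ((r%:C)%C * (p k - z) 0 j).
pose psi w : Cn := \row_j (z 0 j + cdot w (q j)).
have dpsi w : differentiable psi w.
  apply: differentiable_row => j; apply: differentiableD; first exact: differentiable_cst.
  exact: differentiable_cdot.
have qE w j : cdot w (q j) = ((r%:C)%C *: (w *m flag_mx)) 0 j.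
  rewrite !mxE mulr_sumr; apply: eq_bigr => k _.
  by rewrite !mxE conjcK mulrCA.
have psiE w : psi w = z + (r%:C)%C *: (w *m flag_mx).
  by apply/rowP => j; rewrite mxE qE [in RHS]mxE.
have psi0 : psi 0 = z by rewrite psiE mul0mx scaler0 addr0.
exists psi; split => //; first split => //.
- move=> w w1; apply: contrapT => nD.
  have [t /andP[t0 t1] bx] := segment_exit oD Dz nD.
  have [b Hb] := supporting_hyperplane oD cvx bx.
  set x := z + _ in bx Hb.
  pose be := cdot (x - z) b.
  have be0 : be != 0.
    by have := Hb z Dz; rewrite /be -opprB -scaleN1r cdotZl mulN1r oppr_eq0.
  have le_be k : normc (cdot (p k - z) b) <= normc be.
    rewrite leNgt; apply/negP => ltk.
    have ck0 : cdot (p k - z) b != 0 by rewrite -normc_gt0 (le_lt_trans _ ltk)// normc_ge0.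
    (* Otherwise the supporting plane would cross the line in direction [p k - z] at distance less
       than [enorm (p k - z)] from [z], where that line is still inside [D]. *)
    have : D (z + (be / cdot (p k - z) b) *: (p k - z)).
      apply: (@minimal_ball k) => [i ik|].
        by rewrite cdotZl minimal_orthogonal ?mulr0// -val_eqE /= gtn_eqF.
      rewrite enormZ gtr_pMl ?minimal_gt0// normcM normcV ltr_pdivrMr ?mul1r//.
      by rewrite normc_gt0.
    move=> /Hb/negP; apply; rewrite (_ : z + _ - x = (be / cdot (p k - z) b) *: (p k - z) - (x - z)).
      by rewrite (cdotBl (_ *: _)) cdotZl divfK// subrr.
    by rewrite opprB addrCA addrA.
  have beE : be = \sum_k ((t * r)%:C)%C * (w 0 k * cdot (p k - z) b).
    rewrite /be /x addrC addKr psiE addrC addKr !cdotZl mulrA -rmorphM -mulr_sumr; congr (_ * _).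
    rewrite mulmx_sum_row (big_morph (cdot^~ b) (fun u v => cdotDl u v b) (cdot0l b)).
    by apply: eq_bigr => k _; rewrite row_flag_mx cdotZl.
  have : normc be < normc be.
    rewrite {1}beE (le_lt_trans (le_normc_sum _ _ _))//.
    (* The arithmetic-geometric mean inequality for [r] and [normc (w 0 k)]: the squares [r ^+ 2]
       add up to 1 and those of the coordinates to less than 1. *)
    apply: (@le_lt_trans _ _ (\sum_(k < n) (r ^+ 2 + normc (w 0 k) ^+ 2) / 2 * normc be)).
      apply: ler_sum => k _; rewrite !normcM normc_real ger0_norm; last first.
        by rewrite mulr_ge0// ltW// invsqrt_gt0.
      rewrite mulrA ler_pM ?normc_ge0// ?mulr_ge0 ?normc_ge0 ?(ltW invsqrt_gt0)//.
      have := invsqrt_gt0; have := normc_ge0 (w 0 k); move: (normc (w 0 k)) r => a r' a0 r0.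
      have := sqr_ge0 (r' - a); have : t * (r' * a) <= r' * a by rewrite ler_piMl// mulr_ge0// ltW.
      by rewrite mulrA; lra.
    rewrite -mulr_suml -mulr_suml gtr_pMl ?normc_gt0// big_split /= -enorm_sqr.
    rewrite sum_sqr_invsqrt.
    have : enorm w ^+ 2 < 1 by rewrite expr_lt1// enorm_ge0.
    lra.
  by rewrite ltxx.
have J0 : 'J psi 0 = (r%:C)%C *: flag_mx.
  apply/matrixP => k j; rewrite [RHS]mxE.
  have := @cderiv_line R n n psi 0 (delta_mx 0 k) 0 j; rewrite scale0r addr0 => /(_ (dpsi 0)).
  rewrite -rowE [row _ _ _ _]mxE => H; apply: (cderiv_unique H).
  rewrite (_ : (fun t => _) = fun t => z 0 j + t * ((r%:C)%C * flag_mx k j)).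
    have := cderivD (cderiv_cst (z 0 j) 0)
      (cderivM (cderiv_id 0) (cderiv_cst ((r%:C)%C * flag_mx k j) 0)).
    by rewrite mul1r mulr0 addr0 add0r.
  apply/funext => t; rewrite mxE add0r cdotZl qE mxE -rowE mxE.
  by [].
rewrite /jac2 J0 detZ normcM normcX normc_real gtr0_norm ?invsqrt_gt0// normc_det_flag_mx.
by rewrite exprMn mulrC exprAC sqr_invsqrt exprVn.
Qed.

End Flag.

(** * The numerical constants and the two-sided estimates *)

Lemma natr_le_pow4 (R : realType) n : n%:R <= (4 ^+ n - 1) / 3 :> R.
Proof.
have H : 3 * n%:R + 1 <= 4 ^+ n :> R.
  elim: n => [|n IH]; first by rewrite mulr0 add0r.
  have : 0 <= n%:R :> R by [].
  by rewrite exprS -natr1; lra.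
by rewrite ler_pdivlMr//; lra.
Qed.

Lemma bernoulli_le (R : realFieldType) (d : R) m : 0 <= d <= 1 -> 1 - m%:R * d <= (1 - d) ^+ m.
Proof.
move=> /andP[d0 d1]; elim: m => [|m IH]; first by rewrite mul0r subr0.
have m0 : 0 <= m%:R * d ^+ 2 by rewrite mulr_ge0// sqr_ge0.
have d10 : 0 <= 1 - d by rewrite subr_ge0.
by have := ler_wpM2l d10 IH; rewrite exprS -natr1; lra.
Qed.

(** Absorbs the defect of the Koebe constant. With [s = (1 - d) / 4] the relative loss is at most
    [2 n d <= e] by Bernoulli's inequality, and division by [(16 n) ^ n >= 1] does not increase
    it. *)
Lemma lower_constant_approx (R : realFieldType) n (e : R) : (0 < n)%N -> 0 < e ->
  exists s : R, [/\ 0 < s, s < 1 / 4 & 1 / (16 * n%:R) ^+ n - e <= (s ^+ 2 / n%:R) ^+ n].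
Proof.
move=> n0 e0; have n1 : 1 <= n%:R :> R by rewrite ler1n.
have n0' : 0 < n%:R :> R by rewrite ltr0n.
pose d := Num.min (1 / 2) (e / (2 * n%:R)).
have d0 : 0 < d by rewrite lt_min divr_gt0//= divr_gt0// mulr_gt0.
have d2 : d <= 1 / 2 by rewrite ge_min lexx.
have de : (n * 2)%N%:R * d <= e.
  rewrite natrM mulrC [n%:R * 2]mulrC -ler_pdivlMr ?mulr_gt0//.
  by rewrite ge_min lexx orbT.
exists (1 / 4 * (1 - d)); split; [by lra|by lra|].
have -> : (1 / 4 * (1 - d)) ^+ 2 / n%:R = (1 - d) ^+ 2 / (16 * n%:R).
  by field; rewrite gt_eqF.
rewrite expr_div_n -exprM mulnC.
set L := (16 * n%:R) ^+ n.
have L1 : 1 <= L by rewrite exprn_ege1//; lra.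
have L0 : 0 < L by exact: lt_le_trans L1.
have B : 1 - (n * 2)%N%:R * d <= (1 - d) ^+ (n * 2) by apply: bernoulli_le; rewrite ltW//=; lra.
rewrite ler_pdivlMr// mulrBl divfK ?gt_eqF//.
have : e <= e * L by rewrite ler_peMr// ltW.
by rewrite mulnC in B *; lra.
Qed.

Theorem theorem1p2 (R : realType) (n : nat) (hn : (2 <= n)%N)
    (D : set 'rV[R[i]]_n) (z : 'rV[R[i]]_n)
    (hD : is_domain D) (hconv : C_convex D) (hnd : non_degenerate D)
    (hz : D z)
    (p : nat -> 'rV[R[i]]_n) (hp : minimal_points D z p) :
  let pD := minimal_product z p in
  let lower : R := 1 / (16 * n%:R) ^+ n in
  let upper : R := ((4 ^+ n - 1) / 3) ^+ n in
  ((lower%:E <= caratheodory_volume D z * (pD ^+ 2)%:E)%E /\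
   (caratheodory_volume D z * (pD ^+ 2)%:E <= upper%:E)%E) /\
  ((lower%:E <= kobayashi_volume D z * (pD ^+ 2)%:E)%E /\
   (kobayashi_volume D z * (pD ^+ 2)%:E <= upper%:E)%E).
Proof.
move=> pD lower upper.
have [_ oD _] := hD.
have n0 : (0 < n)%N by exact: ltnW.
have pD0 : 0 < pD by apply: prodr_gt0 => j _; exact: (minimal_gt0 oD hz hp).
have P0 : 0 < pD ^+ 2 by rewrite exprn_gt0.
have P0' : pD ^+ 2 != 0 by rewrite gt_eqF.
have PE : (0 <= (pD ^+ 2)%:E)%E by rewrite lee_fin ltW.
have [psi [hpsi psi0 Jpsi]] := exists_kobayashi_map n0 oD hconv hz hp.
have N0 : 0 < n%:R ^+ n :> R by rewrite exprn_gt0// ltr0n.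
have Nup : n%:R ^+ n <= upper.
  rewrite lerXn2r ?nnegrE ?natr_le_pow4//.
  exact: le_trans (natr_le_pow4 R n).
have Lower e : 0 < e -> exists F, [/\ holomorphic D (@unit_ball R n) F, F z = 0 &
    lower - e <= jac2 F z * pD ^+ 2].
  move=> e0; have [s [s0 s4 Ls]] := lower_constant_approx n0 e0.
  have [F [hF F0 JF]] := exists_caratheodory_map n0 oD hconv hz hp s0 s4.
  (* One near-extremal map per [e] serves twice: as a competitor for the Caratheodory element and as
     a test map against every competitor of the Kobayashi element. *)
  by exists F; split => //; exact: le_trans Ls JF.
split; split.
- apply/lee_addgt0Pr => e e0; have [F [hF F0 JF]] := Lower e e0.
  apply: (@le_trans _ _ ((jac2 F z)%:E * (pD ^+ 2)%:E + e%:E)%E).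
    by rewrite -EFinM -EFinD lee_fin -lerBlDr.
  rewrite leeD2r// lee_wpmul2r//.
  by apply: ereal_sup_ubound; exists F.
- apply: (@le_trans _ _ ((n%:R ^+ n / pD ^+ 2)%:E * (pD ^+ 2)%:E)%E); last first.
    by rewrite -EFinM divfK// lee_fin.
  (* Every competitor is tested against the single map [psi]. *)
  rewrite lee_wpmul2r//; apply: ge_ereal_sup => _ [f [hf fz] <-].
  rewrite lee_fin ler_pdivlMr//.
  by have := jac2_mul_le1 hz hf fz hpsi psi0; rewrite Jpsi mulrA ler_pdivrMr// mul1r.
- apply: (@le_trans _ _ ((lower / pD ^+ 2)%:E * (pD ^+ 2)%:E)%E).
    by rewrite -EFinM divfK.
  rewrite lee_wpmul2r//; apply: le_ereal_inf_tmp => _ [f [hf f0] <-].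
  (* A competitor with vanishing Jacobian contributes infinity to the infimum. *)
  rewrite inver; case: eqVneq => [_|J0]; first exact: leey.
  have Jf : 0 < jac2 f 0 by rewrite lt_def J0 /= sqr_ge0.
  rewrite lee_fin ler_pdivrMr//; apply/ler_addgt0Pr => e e0.
  have [F [hF F0 JF]] := Lower e e0.
  rewrite -lerBlDr (le_trans JF)// ler_pM2r// -[leRHS]mul1r ler_pdivlMr//.
  exact: jac2_mul_le1 hz hF F0 hf f0.
- apply: (@le_trans _ _ ((n%:R ^+ n / pD ^+ 2)%:E * (pD ^+ 2)%:E)%E); last first.
    by rewrite -EFinM divfK// lee_fin.
  rewrite lee_wpmul2r//; apply: ereal_inf_lbound.
  exists psi => //; rewrite inver Jpsi -/pD mulf_eq0 invr_eq0 (negbTE P0') gt_eqF//=.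
  by rewrite invf_div.
Qed.
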